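(* Fix $p\in(0,1)$ and let $P_n$ be the number of distinct directed source-to-sink paths in a random series-parallel network of size $n$ in the Bernoulli model with parameter $p$. Then $$\mathbb{E}(P_n)=\begin{cases}\displaystyle\sum_{j=0}^{n-1}(-1)^{n+j-1}\binom{(2p-1)j-1}{n-1}\sum_{k=0}^{n-1}\binom{k}{j}\Big(\frac{p}{2p-1}\Big)^{k}, & p\neq\tfrac12,\\[3mm] \displaystyle\sum_{k=0}^{n-1}\frac{(-1)^k}{2^k}B_k\big(-H^{(1)}_{n-1},-H^{(2)}_{n-1},-2H^{(3)}_{n-1},\dots,-(k-1)!H^{(k)}_{n-1}\big), & p=\tfrac12,\end{cases}$$ where $B_k(x_1,\dots,x_k)$ is the $k$-th complete Bell polynomial and $H^{(m)}_n=\sum_{j=1}^n j^{-m}$. Asymptotically, as $n\to\infty$, $$\mathbb{E}(P_n)=\frac{1}{1-p}\alpha_p^{\,n}+R_p(n),$$ where $\alpha_p=\Big(1-\big(\tfrac{p}{1-p}\big)^{\frac{1}{1-2p}}\Big)^{-1}$ for $p\ne\tfrac12$ and $\alpha_{1/2}=\frac{1}{1-e^{-2}}$, and $R_p(n)=-\frac{1-2p}{p\,\Gamma(2p)}n^{2p-1}+O(n^{2(2p-1)})$ for $0<p<\tfrac12$; $R_{1/2}(n)=-\frac{2}{\log n}+O\big(\frac{1}{\log^2 n}\big)$; and $R_p(n)=-\frac{2p-1}{1-p}+O(n^{1-2p})$ for $\tfrac12<p<1$.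
   Context: Bernoulli model of series-parallel networks with parameter $p\in(0,1)$: at step $1$ the network is a single edge from the source to the sink; at step $n>1$ one of the $n-1$ edges $(x,y)$ is chosen uniformly at random and with probability $p$ a parallel edge $(x,y)$ is added, with probability $1-p$ the edge is subdivided by a new vertex $z$ into $(x,z),(z,y)$. Size $n$ means the network after step $n$ ($n$ edges). Paths are directed paths following the edge orientation. Binomial coefficients with real upper argument: $\binom{a}{k}=a(a-1)\cdots(a-k+1)/k!$. *)

(* Defs.v *)
From Stdlib Require Import Arith Reals Lra List ClassicalEpsilon.
Import ListNotations.
Open Scope R_scope.

(* A network: (number of vertices, list of directed edges (tail, head)).
   Vertices are 0 .. nv-1; the source is 0, the sink is 1.
   Parallel edges are distinct list entries. *)
Definition network : Type := (nat * list (nat * nat))%type.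

Definition net_init : network := (2%nat, [(0%nat, 1%nat)]).

Fixpoint upd_nth {A : Type} (l : list A) (i : nat) (a : A) : list A :=
  match l, i with
  | [], _ => []
  | _ :: t, O => a :: t
  | h :: t, S i' => h :: upd_nth t i' a
  end.

Definition net_parallel (G : network) (i : nat) : network :=
  let e := nth i (snd G) (0%nat, 0%nat) in (fst G, snd G ++ [e]).

Definition net_series (G : network) (i : nat) : network :=
  let '(x, y) := nth i (snd G) (0%nat, 0%nat) in
  let z := fst G in
  (S z, upd_nth (snd G) i (x, z) ++ [(z, y)]).

Definition sp_step (p : R) (D : list (R * network)) : list (R * network) :=
  flat_map (fun wG : R * network =>
    let (w, G) := wG in
    let m := length (snd G) in
    flat_map (fun i => [(w * p / INR m, net_parallel G i);
                        (w * (1 - p) / INR m, net_series G i)]) (seq 0 m)) D.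

(* distribution (list of weighted outcomes) of the network after step m+1,
   i.e. of size m+1 *)
Fixpoint sp_dist (p : R) (m : nat) : list (R * network) :=
  match m with
  | O => [(1, net_init)]
  | S m' => sp_step p (sp_dist p m')
  end.

Fixpoint walk_ok (E : list (nat * nat)) (v : nat) (visited : list nat)
    (l : list nat) : bool :=
  match l with
  | [] => Nat.eqb v 1
  | i :: l' =>
      let e := nth i E (0%nat, 0%nat) in
      Nat.ltb i (length E) && Nat.eqb (fst e) v
      && negb (existsb (Nat.eqb (snd e)) visited)
      && walk_ok E (snd e) (snd e :: visited) l'
  end.

Definition is_st_path (E : list (nat * nat)) (l : list nat) : bool :=
  walk_ok E 0 [0%nat] l.

Fixpoint lists_of (m k : nat) : list (list nat) :=
  match k with
  | O => [[]]
  | S k' => flat_map (fun l => map (fun i => i :: l) (seq 0 m)) (lists_of m k')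
  end.

(* number of distinct directed source-to-sink paths (as edge sequences;
   a path uses each edge at most once, so has length <= #edges) *)
Definition num_paths (G : network) : nat :=
  let E := snd G in
  fold_right Nat.add 0%nat
    (map (fun k => length (filter (is_st_path E) (lists_of (length E) k)))
         (seq 0 (S (length E)))).

Definition EP (p : R) (n : nat) : R :=
  fold_right Rplus 0
    (map (fun wG : R * network => fst wG * INR (num_paths (snd wG)))
         (sp_dist p (pred n))).

Fixpoint sumR (n : nat) (f : nat -> R) : R :=
  match n with
  | O => 0
  | S n' => sumR n' f + f n'
  end.

Fixpoint falling (a : R) (k : nat) : R :=
  match k with
  | O => 1
  | S k' => falling a k' * (a - INR k')
  end.
Definition gbinom (a : R) (k : nat) : R := falling a k / INR (fact k).

Definition harm (m n : nat) : R := sumR n (fun j => / (INR (S j)) ^ m).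

(* complete Bell polynomials, x i = x_i (1-indexed), via the standard
   recurrence B_0 = 1, B_{k+1} = sum_{i=0}^k C(k,i) B_{k-i} x_{i+1}.
   [bells k x] is the list [B_0; ...; B_k]. *)
Fixpoint bells (k : nat) (x : nat -> R) : list R :=
  match k with
  | O => [1]
  | S k' =>
      let L := bells k' x in
      L ++ [sumR (S k') (fun i =>
               gbinom (INR k') i * nth (k' - i) L 0 * x (S i))]
  end.
Definition bell (k : nat) (x : nat -> R) : R := nth k (bells k x) 0.

(* Euler's Gamma function via Gauss's limit formula:
   Gamma x = lim_n n! n^x / (x (x+1) ... (x+n)),  x > 0. *)
Definition Gamma_seq (x : R) (n : nat) : R :=
  INR (fact n) * Rpower (INR n) x /
    fold_right Rmult 1 (map (fun i => x + INR i) (seq 0 (S n))).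

Definition Gamma (x : R) : R :=
  epsilon (inhabits 0) (fun g => Un_cv (Gamma_seq x) g).

Definition alpha (p : R) : R :=
  if Req_EM_T p (1/2) then / (1 - exp (-2))
  else / (1 - Rpower (p / (1 - p)) (/ (1 - 2 * p))).

Definition EP_formula_ne (p : R) (n : nat) : R :=
  sumR n (fun j =>
    (-1) ^ (n + j - 1) * gbinom ((2 * p - 1) * INR j - 1) (n - 1)
    * sumR n (fun k => gbinom (INR k) j * (p / (2 * p - 1)) ^ k)).

Definition EP_formula_half (n : nat) : R :=
  sumR n (fun k =>
    (-1) ^ k / 2 ^ k *
    bell k (fun m => - INR (fact (m - 1)) * harm m (n - 1))).

(* Main.v *)
(** The edges of the current network evolve independently of each other, and replacing an
    edge by two parallel or two consecutive ones doubles, respectively lengthens, exactly the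
    paths through that edge. Hence [E(P_n)] is the coefficient of [z^(n-1)] in the solution [Phi]
    of [Phi' = 2p Phi/(1-z) + (1-p) Phi^2], [Phi(0) = 1], that is
    [Phi = 1/((1-z)(1-h))] with [h = c(1-(1-z)^(2p-1))], [c = p/(2p-1)], and
    [h = log(1/(1-z))/2] for [p = 1/2]. Expanding the geometric series in [h] gives the exact
    formulas.

    For the asymptotics no complex analysis is needed. After multiplying by a power of
    [1-z] when [p < 1/2], [Phi] is [(1-z)^(-s)/(1-h)] where [h] has positive log-convex
    coefficients. If [h(z0) = 1], then [1-h = (1-z/z0) D], where the coefficients of [D] are
    the tails [sum_(j>=1) h_(n+j) z0^j]. These are again log-convex, so by Kaluza's theorem
    [1/D = 1-F] with [0 <= F_n <= D_n]. Thus [F] has small coefficients, and dividing by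
    [1-z/z0] yields the pole [alpha^n/(1-p)] plus a tail of a sequence of controlled size. For
    [p = 1/2] the sequence is [w = (1-F)/(1-z)], which is decreasing and satisfies the renewal
    identity [sum_k D_k w_(n-k) = 1]; this forces [w_n = 1/(D_0+...+D_n)] up to a relative error
    [O(1/log n)]. *)
Require Import Defs.
From Stdlib Require Import Reals Lra Lia Arith List Bool Permutation ClassicalEpsilon
  FunctionalExtensionality.
From Coquelicot Require Import Coquelicot.
Import ListNotations.
Open Scope R_scope.

(** The law of the random network is never described. A path with [l] of the [m] edges carries a
    power series weight whose derivative reproduces the mean effect of one step, so in expectation a
    random step can be traded for a derivative; trading all steps back to the single edge leaves a
    coefficient of [Phi]. Path lengths must be tracked because a longer path is hit more often.

    Estimating [(1-z)^(-s)/(1-h)] directly would lose the second-order term, since the error then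
    has the size of the coefficients of [(1-z)^(-s)] itself. Solving [1 - h = (1 - c) + c(1-z)^g]
    for the constant part separates that term exactly and leaves the same quotient with exponent
    [g - s], whose error is smaller by the factor [n^(-g)]. At [p = 1/2] there is no such gain: the
    coefficients of [D] are only [O(1/n)] and their sum diverges, so monotonicity has to replace
    absolute convergence. *)

(** * Finite sums *)

Lemma sumR_ext (n : nat) (f g : nat -> R) :
  (forall i, (i < n)%nat -> f i = g i) -> sumR n f = sumR n g.
Proof.
  induction n as [|n IH]; intros H; simpl; [reflexivity|].
  rewrite IH, H; auto with arith.
Qed.

Lemma sumR_shift (n : nat) (f : nat -> R) :
  sumR (S n) f = f 0%nat + sumR n (fun i => f (S i)).
Proof.
  induction n as [|n IH]; [simpl; ring|].
  change (sumR (S n) f + f (S n) = f 0%nat + (sumR n (fun i => f (S i)) + f (S n))).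
  rewrite IH; ring.
Qed.

Lemma sumR_plus (n : nat) (f g : nat -> R) :
  sumR n (fun i => f i + g i) = sumR n f + sumR n g.
Proof. induction n as [|n IH]; simpl; [ring|rewrite IH; ring]. Qed.

Lemma sumR_scal (n : nat) (c : R) (f : nat -> R) :
  sumR n (fun i => c * f i) = c * sumR n f.
Proof. induction n as [|n IH]; simpl; [ring|rewrite IH; ring]. Qed.

Lemma sumR_0 (n : nat) (f : nat -> R) :
  (forall i, (i < n)%nat -> f i = 0) -> sumR n f = 0.
Proof.
  induction n as [|n IH]; intros H; simpl; [reflexivity|].
  rewrite IH, H; auto with arith; ring.
Qed.

Lemma sumR_le (n : nat) (f g : nat -> R) :
  (forall i, (i < n)%nat -> f i <= g i) -> sumR n f <= sumR n g.
Proof.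
  induction n as [|n IH]; intros H; simpl; [lra|].
  apply Rplus_le_compat; auto with arith.
Qed.

Lemma sumR_pos (n : nat) (f : nat -> R) :
  (forall i, (i < n)%nat -> 0 <= f i) -> 0 <= sumR n f.
Proof.
  intros H. rewrite <- (sumR_0 n (fun _ => 0)) by reflexivity.
  now apply sumR_le.
Qed.

Lemma sumR_abs (n : nat) (f : nat -> R) :
  Rabs (sumR n f) <= sumR n (fun i => Rabs (f i)).
Proof.
  induction n as [|n IH]; simpl; [rewrite Rabs_R0; lra|].
  eapply Rle_trans; [apply Rabs_triang|lra].
Qed.

Lemma sumR_rev (n : nat) (f : nat -> R) :
  sumR n f = sumR n (fun i => f (n - 1 - i)%nat).
Proof.
  induction n as [|n IH]; [reflexivity|].
  rewrite (sumR_shift n (fun i => f (S n - 1 - i)%nat)); simpl.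
  rewrite Rplus_comm, IH. f_equal; [f_equal; lia|].
  apply sumR_ext; intros i Hi; f_equal; lia.
Qed.

Lemma sumR_add (m n : nat) (f : nat -> R) :
  sumR (m + n) f = sumR m f + sumR n (fun i => f (m + i)%nat).
Proof.
  induction n as [|n IH].
  - rewrite Nat.add_0_r; simpl; ring.
  - rewrite Nat.add_succ_r; simpl; rewrite IH; ring.
Qed.

Lemma sumR_exchange (m n : nat) (f : nat -> nat -> R) :
  sumR m (fun i => sumR n (f i)) = sumR n (fun j => sumR m (fun i => f i j)).
Proof.
  induction m as [|m IH]; simpl.
  - symmetry; now apply sumR_0.
  - rewrite IH, <- sumR_plus; reflexivity.
Qed.

Lemma sum_n_sumR (n : nat) (f : nat -> R) : sum_n f n = sumR (S n) f.
Proof.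
  induction n as [|n IH]; [rewrite sum_O; simpl; ring|].
  rewrite sum_Sn, IH; reflexivity.
Qed.

(** * Formal power series *)

Definition fps := nat -> R.
Definition fconst (c : R) : fps := fun n => match n with O => c | _ => 0 end.
Definition fadd (a b : fps) : fps := fun n => a n + b n.
Definition fopp (a : fps) : fps := fun n => - a n.
Definition fsub (a b : fps) : fps := fun n => a n - b n.
Definition fmul (a b : fps) : fps :=
  fun n => sumR (S n) (fun i => a i * b (n - i)%nat).
Definition fder (a : fps) : fps := fun n => INR (S n) * a (S n).

Lemma fmul_S (a b : fps) (n : nat) :
  fmul a b (S n) = a 0%nat * b (S n) + fmul (fun k => a (S k)) b n.
Proof. unfold fmul; rewrite sumR_shift; reflexivity. Qed.

Lemma fmul_comm (a b : fps) : fmul a b = fmul b a.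
Proof.
  apply functional_extensionality; intros n; unfold fmul.
  rewrite sumR_rev. apply sumR_ext; intros i Hi.
  rewrite Rmult_comm; f_equal; f_equal; lia.
Qed.

Lemma fmul_add_l (a b c : fps) : fmul (fadd a b) c = fadd (fmul a c) (fmul b c).
Proof.
  apply functional_extensionality; intros n; unfold fmul, fadd.
  rewrite <- sumR_plus; apply sumR_ext; intros; ring.
Qed.

Lemma fmul_scal_l (c : R) (a b : fps) (n : nat) :
  fmul (fun k => c * a k) b n = c * fmul a b n.
Proof.
  unfold fmul; rewrite <- sumR_scal; apply sumR_ext; intros; ring.
Qed.

(** Peeling off the constant term of [a] allows induction on the coefficient and avoids reindexing a
    double sum. *)
Lemma fmul_assoc (a b c : fps) : fmul a (fmul b c) = fmul (fmul a b) c.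
Proof.
  apply functional_extensionality; intros n; revert a b c.
  induction n as [|n IH]; intros a b c; [unfold fmul; simpl; ring|].
  rewrite (fmul_S a), (fmul_S (fmul a b)), IH, (fmul_S b c).
  replace (fun k => fmul a b (S k))
    with (fadd (fun k => a 0%nat * b (S k)) (fmul (fun k => a (S k)) b))
    by (apply functional_extensionality; intros k; rewrite fmul_S; reflexivity).
  rewrite fmul_add_l; unfold fadd; rewrite fmul_scal_l.
  replace (fmul a b 0%nat) with (a 0%nat * b 0%nat) by (unfold fmul; simpl; ring).
  ring.
Qed.

Lemma fmul_const (c : R) (a : fps) (n : nat) : fmul (fconst c) a n = c * a n.
Proof.
  unfold fmul; rewrite sumR_shift, sumR_0; simpl.
  - rewrite Nat.sub_0_r; ring.
  - intros; ring.
Qed.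

Lemma fps_ring : ring_theory (fconst 0) (fconst 1) fadd fmul fsub fopp eq.
Proof.
  split; intros; try apply fmul_comm; try apply fmul_assoc; try apply fmul_add_l;
    apply functional_extensionality; intros n; rewrite ?fmul_const;
    unfold fadd, fsub, fopp; try ring; destruct n; simpl; ring.
Qed.
Add Ring fps_ring_inst : fps_ring.

Lemma fconst_add (x y : R) : fconst (x + y) = fadd (fconst x) (fconst y).
Proof.
  apply functional_extensionality; intros [|n]; unfold fadd; simpl; ring.
Qed.

Lemma fconst_opp (x : R) : fconst (- x) = fopp (fconst x).
Proof.
  apply functional_extensionality; intros [|n]; unfold fopp; simpl; ring.
Qed.

Lemma fconst_sub (x y : R) : fconst (x - y) = fsub (fconst x) (fconst y).
Proof.
  apply functional_extensionality; intros [|n]; unfold fsub; simpl; ring.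
Qed.

Lemma fconst_mul (x y : R) : fconst (x * y) = fmul (fconst x) (fconst y).
Proof.
  apply functional_extensionality; intros n; rewrite fmul_const.
  destruct n; simpl; ring.
Qed.

Lemma fder_const (c : R) : fder (fconst c) = fconst 0.
Proof.
  apply functional_extensionality; intros n; unfold fder; simpl fconst.
  destruct n; simpl; ring.
Qed.

Lemma fder_sub (a b : fps) : fder (fsub a b) = fsub (fder a) (fder b).
Proof. apply functional_extensionality; intros n; unfold fder, fsub; ring. Qed.

Lemma fder_mul (a b : fps) :
  fder (fmul a b) = fadd (fmul (fder a) b) (fmul a (fder b)).
Proof.
  apply functional_extensionality; intros n; unfold fadd.
  (* The factor [n + 1] is split as [i + (n + 1 - i)], one share for each factor of the product. *)
  replace (fder (fmul a b) n) with
    (sumR (S (S n)) (fun i => INR i * a i * b (S n - i)%nat) +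
     sumR (S (S n)) (fun i => a i * (INR (S n - i) * b (S n - i)%nat))).
  - f_equal.
    + rewrite sumR_shift; simpl (INR 0); rewrite !Rmult_0_l, Rplus_0_l.
      apply sumR_ext; intros i Hi; reflexivity.
    + change (sumR (S (S n)) (fun i => a i * (INR (S n - i) * b (S n - i)%nat)))
        with (sumR (S n) (fun i => a i * (INR (S n - i) * b (S n - i)%nat))
              + a (S n) * (INR (S n - S n) * b (S n - S n)%nat)).
      rewrite Nat.sub_diag; simpl (INR 0); rewrite Rmult_0_l, Rmult_0_r, Rplus_0_r.
      apply sumR_ext; intros i Hi; unfold fder.
      replace (S n - i)%nat with (S (n - i)) by lia; reflexivity.
  - unfold fder, fmul; rewrite <- sumR_plus, <- sumR_scal.
    apply sumR_ext; intros i Hi.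
    rewrite minus_INR by lia; ring.
Qed.

Lemma fmul_const_l (c : R) (a : fps) : fmul (fconst c) a = fun n => c * a n.
Proof. apply functional_extensionality; intros n; apply fmul_const. Qed.

Lemma fmul_unit_cancel (a a' b c : fps) :
  fmul a' a = fconst 1 -> fmul a b = fmul a c -> b = c.
Proof.
  intros Hu H.
  transitivity (fmul (fmul a' a) b); [rewrite Hu; ring|].
  transitivity (fmul (fmul a' a) c); [|rewrite Hu; ring].
  rewrite <- !fmul_assoc, H; reflexivity.
Qed.

Fixpoint fpow (a : fps) (k : nat) : fps :=
  match k with O => fconst 1 | S k' => fmul a (fpow a k') end.

Lemma fmul_at0 (a b : fps) : fmul a b 0%nat = a 0%nat * b 0%nat.
Proof. unfold fmul; simpl; ring. Qed.

Lemma fpow_at0 (a : fps) (k : nat) : a 0%nat = 1 -> fpow a k 0%nat = 1.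
Proof.
  intros H; induction k as [|k IH]; simpl; [reflexivity|].
  rewrite fmul_at0, H, IH; ring.
Qed.

Lemma fpow_low (a : fps) (k n : nat) :
  a 0%nat = 0 -> (n < k)%nat -> fpow a k n = 0.
Proof.
  intros H; revert n; induction k as [|k IH]; intros n Hn; [lia|]; simpl.
  apply sumR_0; intros [|i] Hi; [rewrite H; ring|].
  rewrite IH by lia; ring.
Qed.

Lemma fder_pow (a : fps) (k : nat) :
  fder (fpow a (S k)) = fmul (fconst (INR (S k))) (fmul (fpow a k) (fder a)).
Proof.
  induction k as [|k IH].
  - change (fpow a 1) with (fmul a (fconst 1)).
    rewrite fder_mul, fder_const; simpl; ring.
  - change (fpow a (S (S k))) with (fmul a (fpow a (S k))).
    rewrite fder_mul, IH, (S_INR (S k)), fconst_add; simpl (fpow a (S k)); ring.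
Qed.

Lemma fmul_sum_r (a : fps) (b : nat -> fps) (N n : nat) :
  fmul a (fun m => sumR N (fun k => b k m)) n = sumR N (fun k => fmul a (b k) n).
Proof.
  unfold fmul. rewrite <- sumR_exchange.
  apply sumR_ext; intros i _; rewrite sumR_scal; reflexivity.
Qed.

Lemma fmul_ext_le (a b a' b' : fps) (n : nat) :
  (forall m, (m <= n)%nat -> a m = a' m) -> (forall m, (m <= n)%nat -> b m = b' m) ->
  fmul a b n = fmul a' b' n.
Proof.
  intros Ha Hb; apply sumR_ext; intros i Hi. rewrite Ha, Hb by lia; reflexivity.
Qed.

(* [1 / (1 - x)], meaningful when [x] has no constant term: then [x^k] contributes
   to the coefficient [n] only for [k <= n]. *)
Definition fgeo (x : fps) : fps := fun n => sumR (S n) (fun k => fpow x k n).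

Lemma fgeo_trunc (x : fps) (n N : nat) :
  x 0%nat = 0 -> (n < N)%nat -> fgeo x n = sumR N (fun k => fpow x k n).
Proof.
  intros H0 HN; unfold fgeo.
  replace N with (S n + (N - S n))%nat by lia.
  rewrite sumR_add, (sumR_0 (N - S n)); [ring|].
  intros i _; apply fpow_low; [exact H0|lia].
Qed.

Lemma fgeo_inv (x : fps) :
  x 0%nat = 0 -> fmul (fsub (fconst 1) x) (fgeo x) = fconst 1.
Proof.
  intros H0; apply functional_extensionality; intros n.
  rewrite (fmul_ext_le _ (fgeo x) (fsub (fconst 1) x)
             (fun m => sumR (S n) (fun k => fpow x k m)));
    [|reflexivity|intros m Hm; apply fgeo_trunc; [exact H0|lia]].
  rewrite fmul_sum_r.
  (* The partial sums telescope; for [N = n + 1] the remainder [x^N] does not reach the coefficient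
     [n]. *)
  assert (E : forall N, sumR N (fun k => fmul (fsub (fconst 1) x) (fpow x k) n)
                        = fconst 1 n - fpow x N n).
  { induction N as [|N IH]; [simpl; ring|].
    change (sumR N (fun k => fmul (fsub (fconst 1) x) (fpow x k) n)
            + fmul (fsub (fconst 1) x) (fpow x N) n = fconst 1 n - fpow x (S N) n).
    rewrite IH.
    replace (fmul (fsub (fconst 1) x) (fpow x N)) with (fsub (fpow x N) (fpow x (S N)))
      by (simpl; ring).
    unfold fsub; ring. }
  rewrite E, fpow_low; [ring|exact H0|lia].
Qed.

Lemma fgeo_at0 (x : fps) : fgeo x 0%nat = 1.
Proof. unfold fgeo; simpl; ring. Qed.

(** Implicit differentiation of [(1 - x) y = 1], after which the invertible factor [1 - x] is
    cancelled. *)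
Lemma fder_fgeo (x : fps) :
  x 0%nat = 0 -> fder (fgeo x) = fmul (fder x) (fmul (fgeo x) (fgeo x)).
Proof.
  intros H0; pose proof (fgeo_inv x H0) as Hi.
  apply (fmul_unit_cancel (fsub (fconst 1) x) (fgeo x)).
  - rewrite fmul_comm; exact Hi.
  - assert (Hd := f_equal fder Hi).
    rewrite fder_mul, fder_sub, !fder_const in Hd.
    transitivity (fmul (fder x) (fgeo x)).
    + transitivity (fadd (fmul (fder x) (fgeo x))
        (fadd (fmul (fsub (fconst 0) (fder x)) (fgeo x))
              (fmul (fsub (fconst 1) x) (fder (fgeo x))))); [ring|].
      rewrite Hd; ring.
    + transitivity (fmul (fmul (fder x) (fgeo x)) (fmul (fsub (fconst 1) x) (fgeo x)));
        [rewrite Hi; ring|ring].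
Qed.

(* The coefficients of [(1 - z)^d]. *)
Fixpoint pw (d : R) (n : nat) : R :=
  match n with O => 1 | S n' => pw d n' * ((INR n' - d) / INR (S n')) end.

Lemma INR_S_neq0 (n : nat) : INR (S n) <> 0.
Proof. apply not_0_INR; lia. Qed.

Definition fone_minus_z : fps := fun n => match n with O => 1 | 1%nat => -1 | _ => 0 end.

Lemma fmul_one_minus_z_S (a : fps) (n : nat) :
  fmul fone_minus_z a (S n) = a (S n) - a n.
Proof.
  rewrite fmul_S; simpl.
  rewrite (fmul_ext_le _ a (fconst (-1)) a); [rewrite fmul_const; ring| |reflexivity].
  intros [|m] _; reflexivity.
Qed.

Lemma fder_pw (d : R) :
  fmul fone_minus_z (fder (pw d)) = fmul (fconst (- d)) (pw d).
Proof.
  apply functional_extensionality; intros n; rewrite fmul_const.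
  destruct n as [|n].
  - rewrite fmul_at0; unfold fder; simpl; field.
  - rewrite fmul_one_minus_z_S; unfold fder.
    change (pw d (S (S n))) with (pw d (S n) * ((INR (S n) - d) / INR (S (S n)))).
    change (pw d (S n)) with (pw d n * ((INR n - d) / INR (S n))).
    pose proof (INR_S_neq0 n); pose proof (INR_S_neq0 (S n)).
    rewrite (S_INR (S n)), (S_INR n) in *. field; auto.
Qed.

(** On coefficients the equation is the first-order recurrence [(n+1) f(n+1) = (n+c) f(n)], so the
    constant term determines everything. *)
Lemma fde_unique (a b : fps) (c : R) :
  fmul fone_minus_z (fder a) = fmul (fconst c) a ->
  fmul fone_minus_z (fder b) = fmul (fconst c) b ->
  a 0%nat = b 0%nat -> a = b.
Proof.
  intros Ha Hb H0; apply functional_extensionality.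
  assert (R1 : forall f, fmul fone_minus_z (fder f) = fmul (fconst c) f ->
             forall n, INR (S n) * f (S n) = (INR n + c) * f n).
  { intros f Hf [|n].
    - assert (E := f_equal (fun g : fps => g 0%nat) Hf); cbv beta in E.
      rewrite fmul_const, fmul_at0 in E; unfold fder in E; simpl in *; lra.
    - assert (E := f_equal (fun g : fps => g (S n)) Hf); cbv beta in E.
      rewrite fmul_const, fmul_one_minus_z_S in E; unfold fder in E; lra. }
  induction x as [|n IH]; [exact H0|].
  apply (Rmult_eq_reg_l (INR (S n))); [|apply INR_S_neq0].
  rewrite (R1 a Ha), (R1 b Hb), IH; reflexivity.
Qed.

(** Both sides solve the same differential equation. In coefficients this is the Chu-Vandermonde
    convolution. *)
Lemma pw_add (d e : R) : fmul (pw d) (pw e) = pw (d + e).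
Proof.
  apply (fde_unique _ _ (- (d + e))).
  - rewrite fder_mul.
    transitivity (fadd (fmul (fmul fone_minus_z (fder (pw d))) (pw e))
                       (fmul (fmul fone_minus_z (fder (pw e))) (pw d))); [ring|].
    rewrite !fder_pw, (fconst_opp (d + e)), fconst_add, !fconst_opp; ring.
  - apply fder_pw.
  - rewrite fmul_at0; simpl; ring.
Qed.

Lemma pw_0 : pw 0 = fconst 1.
Proof.
  apply functional_extensionality; intros [|n]; [reflexivity|].
  induction n as [|n IH]; simpl in *; [field|].
  rewrite IH; ring.
Qed.

Lemma pw_m1 (n : nat) : pw (-1) n = 1.
Proof.
  induction n as [|n IH]; [reflexivity|].
  change (pw (-1) n * ((INR n - -1) / INR (S n)) = 1).
  pose proof (INR_S_neq0 n); rewrite IH, S_INR in *; field; auto.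
Qed.

Lemma pw_1 : pw 1 = fone_minus_z.
Proof.
  apply functional_extensionality; intros [|[|n]]; [reflexivity|simpl; field|].
  induction n as [|n IH]; [simpl; field|].
  change (pw 1 (S (S n)) * ((INR (S (S n)) - 1) / INR (S (S (S n)))) = 0).
  rewrite IH; simpl (fone_minus_z _); ring.
Qed.

Lemma fder_pw_mul (d : R) :
  fder (pw d) = fmul (fconst (- d)) (fmul (pw (-1)) (pw d)).
Proof.
  apply (fmul_unit_cancel fone_minus_z (pw (-1))).
  - rewrite <- pw_1, pw_add, <- pw_0; f_equal; ring.
  - rewrite fder_pw.
    transitivity (fmul (fmul fone_minus_z (pw (-1))) (fmul (fconst (- d)) (pw d))); [|ring].
    rewrite <- pw_1, pw_add.
    replace (1 + -1) with 0 by ring; rewrite pw_0; ring.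
Qed.

(** * Paths and edge replacement *)

Definition lsum {A : Type} (l : list A) (f : A -> R) : R :=
  fold_right Rplus 0 (map f l).

Lemma lsum_app {A : Type} (l1 l2 : list A) (f : A -> R) :
  lsum (l1 ++ l2) f = lsum l1 f + lsum l2 f.
Proof. unfold lsum; induction l1; simpl in *; [ring|rewrite IHl1; ring]. Qed.

Lemma lsum_plus {A : Type} (l : list A) (f g : A -> R) :
  lsum l (fun a => f a + g a) = lsum l f + lsum l g.
Proof. unfold lsum; induction l; simpl in *; [ring|rewrite IHl; ring]. Qed.

Lemma lsum_scal {A : Type} (l : list A) (c : R) (f : A -> R) :
  lsum l (fun a => c * f a) = c * lsum l f.
Proof. unfold lsum; induction l; simpl in *; [ring|rewrite IHl; ring]. Qed.

Lemma lsum_ext {A : Type} (l : list A) (f g : A -> R) :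
  (forall a, In a l -> f a = g a) -> lsum l f = lsum l g.
Proof.
  intros H; unfold lsum; f_equal; apply map_ext_in; exact H.
Qed.

Lemma lsum_map {A B : Type} (l : list A) (h : A -> B) (f : B -> R) :
  lsum (map h l) f = lsum l (fun a => f (h a)).
Proof. unfold lsum; rewrite map_map; reflexivity. Qed.

Lemma lsum_flat_map {A B : Type} (l : list A) (h : A -> list B) (f : B -> R) :
  lsum (flat_map h l) f = lsum l (fun a => lsum (h a) f).
Proof.
  induction l as [|a l IH]; [reflexivity|]; simpl.
  rewrite lsum_app, IH; reflexivity.
Qed.

Lemma lsum_filter {A : Type} (l : list A) (b : A -> bool) (f : A -> R) :
  lsum (filter b l) f = lsum l (fun a => if b a then f a else 0).
Proof.
  unfold lsum; induction l as [|a l IH]; [reflexivity|]; simpl.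
  destruct (b a); simpl; rewrite IH; ring.
Qed.

Lemma lsum_perm {A : Type} (l1 l2 : list A) (f : A -> R) :
  Permutation l1 l2 -> lsum l1 f = lsum l2 f.
Proof. unfold lsum; induction 1; simpl; try lra. Qed.

Lemma lsum_exchange {A B : Type} (l1 : list A) (l2 : list B) (f : A -> B -> R) :
  lsum l1 (fun a => lsum l2 (f a)) = lsum l2 (fun b => lsum l1 (fun a => f a b)).
Proof.
  induction l1 as [|a l1 IH].
  - unfold lsum at 1; simpl. induction l2; unfold lsum in *; simpl in *; lra.
  - change (lsum l2 (f a) + lsum l1 (fun a => lsum l2 (f a))
            = lsum l2 (fun b => f a b + lsum l1 (fun a => f a b))).
    rewrite lsum_plus, IH; reflexivity.
Qed.

Lemma lsum_const {A : Type} (l : list A) (c : R) :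
  lsum l (fun _ => c) = INR (length l) * c.
Proof.
  induction l as [|a l IH]; [unfold lsum; simpl; ring|].
  change (c + lsum l (fun _ => c) = INR (S (length l)) * c).
  rewrite IH, S_INR; ring.
Qed.

Lemma NoDup_flat_map {A B : Type} (l : list A) (f : A -> list B) :
  NoDup l -> (forall x, NoDup (f x)) ->
  (forall x y b, In b (f x) -> In b (f y) -> x = y) -> NoDup (flat_map f l).
Proof.
  intros Hl Hf Hd; induction Hl as [|a l Ha Hl IH]; simpl; [constructor|].
  apply NoDup_app; auto.
  intros b Hb Hb'. apply in_flat_map in Hb'. destruct Hb' as [y [Hy Hb']].
  apply Ha. rewrite (Hd a y b Hb Hb'); exact Hy.
Qed.

Lemma NoDup_map_in_inj {A B : Type} (l : list A) (f : A -> B) :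
  (forall x y, In x l -> In y l -> f x = f y -> x = y) -> NoDup l -> NoDup (map f l).
Proof.
  intros Hf Hl; induction Hl as [|a l Ha Hl IH]; simpl; constructor.
  - intros H; apply in_map_iff in H; destruct H as [y [E Hy]].
    apply Ha. rewrite <- (Hf y a); simpl; auto.
  - apply IH; intros; apply Hf; simpl; auto.
Qed.

Lemma NoDup_map_eq {A B : Type} (l : list A) (f : A -> B) (x y : A) :
  NoDup (map f l) -> In x l -> In y l -> f x = f y -> x = y.
Proof.
  induction l as [|a l IH]; intros Hn Hx Hy E; [destruct Hx|].
  simpl in Hn; inversion Hn as [|? ? Ha Hl]; subst.
  destruct Hx as [->|Hx], Hy as [->|Hy]; auto.
  - exfalso; apply Ha; rewrite E; apply in_map; exact Hy.
  - exfalso; apply Ha; rewrite <- E; apply in_map; exact Hx.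
Qed.

Definition memb (i : nat) (l : list nat) : bool := existsb (Nat.eqb i) l.

Lemma memb_In (i : nat) (l : list nat) : memb i l = true <-> In i l.
Proof.
  unfold memb; rewrite existsb_exists; split.
  - intros [x [Hx E]]; apply Nat.eqb_eq in E; subst; exact Hx.
  - intros H; exists i; split; [exact H|apply Nat.eqb_refl].
Qed.

Lemma memb_notIn (i : nat) (l : list nat) : memb i l = false <-> ~ In i l.
Proof. rewrite <- memb_In; destruct (memb i l); split; congruence. Qed.

Lemma in_lists_of (m k : nat) (l : list nat) :
  In l (lists_of m k) <-> length l = k /\ List.Forall (fun i => (i < m)%nat) l.
Proof.
  revert l; induction k as [|k IH]; intros l; simpl.
  - split.
    + intros [<-|[]]; split; [reflexivity|constructor].
    + intros [E _]; destruct l; [auto|discriminate].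
  - rewrite in_flat_map; split.
    + intros [l' [Hl' Hl]]. apply in_map_iff in Hl; destruct Hl as [i [<- Hi]].
      apply IH in Hl'; destruct Hl' as [<- Hl']; apply in_seq in Hi.
      split; [reflexivity|constructor; [lia|exact Hl']].
    + intros [E H]; destruct l as [|i l]; [discriminate|].
      inversion H; subst; exists l; split; [apply IH; auto|].
      apply in_map_iff; exists i; split; [reflexivity|apply in_seq; lia].
Qed.

Lemma NoDup_lists_of (m k : nat) : NoDup (lists_of m k).
Proof.
  induction k as [|k IH]; simpl; [repeat constructor; auto|].
  apply NoDup_flat_map; [exact IH| |].
  - intros l; apply NoDup_map_in_inj; [congruence|apply seq_NoDup].
  - intros x y b Hx Hy; apply in_map_iff in Hx, Hy.
    destruct Hx as [? [<- _]], Hy as [? [E _]]; congruence.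
Qed.

(** * Source-to-sink paths as an explicit list *)

Definition paths (E : list (nat * nat)) : list (list nat) :=
  flat_map (fun k => filter (is_st_path E) (lists_of (length E) k))
           (seq 0 (S (length E))).

Lemma num_paths_length (G : network) : num_paths G = length (paths (snd G)).
Proof.
  unfold num_paths, paths; induction (seq 0 (S (length (snd G)))) as [|k s IH];
    [reflexivity|]; simpl; rewrite length_app, IH; reflexivity.
Qed.

Lemma walk_ok_idx (E : list (nat * nat)) (v : nat) (vis l : list nat) :
  walk_ok E v vis l = true -> List.Forall (fun i => (i < length E)%nat) l.
Proof.
  revert v vis; induction l as [|i l IH]; intros v vis H; constructor;
    simpl in H; rewrite !andb_true_iff in H; destruct H as [[[H1 _] _] H2].
  - apply Nat.ltb_lt; exact H1.
  - eapply IH; exact H2.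
Qed.

Lemma walk_ok_fresh (E : list (nat * nat)) (v : nat) (vis l : list nat) (i : nat) :
  walk_ok E v vis l = true -> In i l -> ~ In (snd (nth i E (0%nat, 0%nat))) vis.
Proof.
  revert v vis; induction l as [|j l IH]; intros v vis H Hi Hv; [destruct Hi|].
  simpl in H; rewrite !andb_true_iff, negb_true_iff in H; destruct H as [[_ H1] H2].
  destruct Hi as [<-|Hi].
  - apply memb_notIn in H1; exact (H1 Hv).
  - apply (IH _ _ H2 Hi); right; exact Hv.
Qed.

(** Using an edge twice would enter its head twice, and the head is marked as visited the first
    time. With the pigeonhole principle this shows that the length cutoff in [num_paths] loses no
    path. *)
Lemma walk_ok_NoDup (E : list (nat * nat)) (v : nat) (vis l : list nat) :
  walk_ok E v vis l = true -> NoDup l.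
Proof.
  revert v vis; induction l as [|j l IH]; intros v vis H; constructor;
    simpl in H; rewrite !andb_true_iff in H; destruct H as [_ H].
  - intros Hj; apply (walk_ok_fresh _ _ _ _ _ H Hj); left; reflexivity.
  - eapply IH; exact H.
Qed.

Lemma NoDup_bounded_length (m : nat) (l : list nat) :
  NoDup l -> List.Forall (fun i => (i < m)%nat) l -> (length l <= m)%nat.
Proof.
  intros Hn Hf. rewrite <- (length_seq m 0). apply NoDup_incl_length; [exact Hn|].
  intros i Hi; apply in_seq; rewrite Forall_forall in Hf; specialize (Hf i Hi); lia.
Qed.

Lemma in_paths (E : list (nat * nat)) (l : list nat) :
  In l (paths E) <-> is_st_path E l = true.
Proof.
  unfold paths; rewrite in_flat_map; split.
  - intros [k [_ H]]; apply filter_In in H; apply H.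
  - intros H; pose proof (walk_ok_idx _ _ _ _ H) as Hi.
    pose proof (walk_ok_NoDup _ _ _ _ H) as Hn.
    exists (length l); split.
    + apply in_seq; pose proof (NoDup_bounded_length _ _ Hn Hi); lia.
    + apply filter_In; split; [apply in_lists_of; auto|exact H].
Qed.

Lemma NoDup_paths (E : list (nat * nat)) : NoDup (paths E).
Proof.
  apply NoDup_flat_map; [apply seq_NoDup| |].
  - intros k; apply NoDup_filter, NoDup_lists_of.
  - intros x y b Hx Hy; apply filter_In in Hx, Hy.
    destruct Hx as [Hx _], Hy as [Hy _]; apply in_lists_of in Hx, Hy.
    destruct Hx as [<- _], Hy as [<- _]; reflexivity.
Qed.

Lemma paths_idx (E : list (nat * nat)) (l : list nat) (j : nat) :
  In l (paths E) -> In j l -> (j < length E)%nat.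
Proof.
  intros H Hj; apply in_paths, walk_ok_idx in H.
  rewrite Forall_forall in H; auto.
Qed.

Lemma paths_NoDup (E : list (nat * nat)) (l : list nat) : In l (paths E) -> NoDup l.
Proof. intros H; apply in_paths in H; eapply walk_ok_NoDup; exact H. Qed.

Definition subst_idx (a b j : nat) : nat := if Nat.eqb j a then b else j.

Lemma map_id_in {A : Type} (f : A -> A) (l : list A) :
  (forall x, In x l -> f x = x) -> map f l = l.
Proof. intros H; rewrite <- (map_id l) at 2; apply map_ext_in; exact H. Qed.

(** * Doubling an edge *)

Section Parallel.
Variables (E : list (nat * nat)) (i : nat).
Hypothesis Hi : (i < length E)%nat.
Let m := length E.
Let E' := E ++ [nth i E (0%nat, 0%nat)].

(** The index [m] of the new edge reads the same endpoints as [i], so renaming it back does not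
    change any test. *)
Lemma walk_ok_parallel (v : nat) (vis l : list nat) :
  walk_ok E' v vis l = walk_ok E v vis (map (subst_idx m i) l).
Proof.
  revert v vis; induction l as [|j l IH]; intros v vis; [reflexivity|].
  simpl.
  assert (E1 : nth j E' (0%nat, 0%nat) = nth (subst_idx m i j) E (0%nat, 0%nat)).
  { unfold E', subst_idx; destruct (Nat.eqb_spec j m) as [->|Hj].
    - rewrite app_nth2, Nat.sub_diag by (unfold m; lia); reflexivity.
    - destruct (Nat.lt_ge_cases j m) as [Hl|Hl]; [apply app_nth1; exact Hl|].
      (* Beyond the end, both lists return the same default edge. *)
      rewrite (@nth_overflow _ E j) by exact Hl.
      apply nth_overflow; rewrite length_app; simpl; fold m; lia. }
  assert (E2 : Nat.ltb j (length E') = Nat.ltb (subst_idx m i j) (length E)).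
  { unfold E', subst_idx; rewrite length_app; simpl; fold m.
    destruct (Nat.eqb_spec j m) as [->|Hj].
    - transitivity true; [apply Nat.ltb_lt; lia|symmetry; apply Nat.ltb_lt; exact Hi].
    - destruct (Nat.ltb_spec j m), (Nat.ltb_spec j (m + 1)); try reflexivity; lia. }
  rewrite E1, E2, IH; reflexivity.
Qed.

(** A path of [E'] either avoids the copy [m], and is an old path, or uses it, and is an old path
    through [i] with [i] renamed. *)
Lemma paths_parallel :
  Permutation (paths E')
    (paths E ++ map (map (subst_idx i m)) (filter (memb i) (paths E))).
Proof.
  assert (Hst : forall l, In l (paths E) -> map (subst_idx m i) (map (subst_idx i m) l) = l).
  { intros l Hl; rewrite map_map; apply map_id_in; intros j Hj.
    pose proof (paths_idx _ _ _ Hl Hj). unfold subst_idx.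
    destruct (Nat.eqb_spec j i) as [->|Hji]; [rewrite Nat.eqb_refl; reflexivity|].
    destruct (Nat.eqb_spec j m); [unfold m in *; lia|reflexivity]. }
  assert (Hs : forall l, In l (paths E) -> map (subst_idx m i) l = l).
  { intros l Hl; apply map_id_in; intros j Hj.
    pose proof (paths_idx _ _ _ Hl Hj). unfold subst_idx.
    destruct (Nat.eqb_spec j m); [unfold m in *; lia|reflexivity]. }
  apply NoDup_Permutation.
  - apply NoDup_paths.
  - apply NoDup_app.
    + apply NoDup_paths.
    + apply NoDup_map_in_inj; [|apply NoDup_filter, NoDup_paths].
      intros x y Hx Hy Exy; apply filter_In in Hx, Hy.
      rewrite <- (Hst x), <- (Hst y), Exy by tauto; reflexivity.
    + intros l Hl Hl'; apply in_map_iff in Hl'; destruct Hl' as [q [<- Hq]].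
      apply filter_In in Hq; destruct Hq as [_ Hq]; apply memb_In in Hq.
      assert (In m (map (subst_idx i m) q)).
      { apply in_map_iff; exists i; split; [|exact Hq].
        unfold subst_idx; rewrite Nat.eqb_refl; reflexivity. }
      pose proof (paths_idx _ _ _ Hl H); unfold m in *; lia.
  - intros l; rewrite in_app_iff, in_map_iff, in_paths.
    unfold is_st_path; rewrite walk_ok_parallel; fold (is_st_path E (map (subst_idx m i) l)).
    rewrite <- in_paths; split.
    + intros H; destruct (in_dec Nat.eq_dec m l) as [Hm|Hm].
      * right; exists (map (subst_idx m i) l); split.
        -- rewrite map_map; apply map_id_in; intros j Hj; unfold subst_idx.
           destruct (Nat.eqb_spec j m) as [->|Hjm]; [rewrite Nat.eqb_refl; reflexivity|].
           destruct (Nat.eqb_spec j i) as [->|Hji]; [|reflexivity].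
           (* A path through both copies would be renamed to a path using the edge [i] twice. *)
           exfalso; apply Hjm.
           apply (NoDup_map_eq l (subst_idx m i)); auto; [eapply paths_NoDup; exact H|].
           unfold subst_idx; rewrite Nat.eqb_refl.
           destruct (Nat.eqb_spec i m); reflexivity.
        -- apply filter_In; split; [exact H|apply memb_In, in_map_iff].
           exists m; split; [unfold subst_idx; rewrite Nat.eqb_refl; reflexivity|exact Hm].
      * left; rewrite map_id_in in H; [exact H|].
        intros j Hj; unfold subst_idx; destruct (Nat.eqb_spec j m); [congruence|reflexivity].
    + intros [H|[q [<- H]]].
      * rewrite Hs; exact H.
      * apply filter_In in H; rewrite Hst; apply H.
Qed.

(** The weight [path_fps] sees a path only through its length, hence a summand of the form
    [g (length l)]. *)
Lemma lsum_paths_parallel (g : nat -> R) :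
  lsum (paths E') (fun l => g (length l)) =
  lsum (paths E) (fun l => g (length l) + (if memb i l then g (length l) else 0)).
Proof.
  rewrite (lsum_perm _ _ _ paths_parallel), lsum_app, lsum_map, lsum_filter, lsum_plus.
  f_equal; apply lsum_ext; intros l _; rewrite length_map; reflexivity.
Qed.
End Parallel.

Lemma length_upd_nth {A : Type} (l : list A) (i : nat) (a : A) :
  length (upd_nth l i a) = length l.
Proof. revert i; induction l; intros [|i]; simpl; auto. Qed.

Lemma nth_upd_nth {A : Type} (l : list A) (i j : nat) (a d : A) :
  (i < length l)%nat ->
  nth j (upd_nth l i a) d = if Nat.eqb j i then a else nth j l d.
Proof.
  revert i j; induction l as [|b l IH]; intros [|i] [|j] Hi; simpl in *; try lia; auto.
  apply IH; lia.
Qed.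

(** * Subdividing an edge *)

Section Series.
Variables (E : list (nat * nat)) (i x y z : nat).
Hypothesis Hi : (i < length E)%nat.
Hypothesis Hxy : nth i E (0%nat, 0%nat) = (x, y).
Hypothesis Hz : (1 < z)%nat.
Hypothesis HE : forall a b, In (a, b) E -> (a < z)%nat /\ (b < z)%nat.
Let m := length E.
Let E' := upd_nth E i (x, z) ++ [(z, y)].

(** The first half of the subdivided edge inherits the index [i]; the second half is appended and
    gets the index [m]. *)
Definition expand : list nat -> list nat :=
  flat_map (fun j => if Nat.eqb j i then [i; m] else [j]).

Lemma nth_series (j : nat) :
  nth j E' (0%nat, 0%nat) =
  if Nat.eqb j i then (x, z) else if Nat.eqb j m then (z, y) else nth j E (0%nat, 0%nat).
Proof.
  unfold E'. destruct (Nat.lt_ge_cases j m) as [Hj|Hj].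
  - rewrite app_nth1 by (rewrite length_upd_nth; exact Hj).
    rewrite nth_upd_nth by exact Hi.
    destruct (Nat.eqb_spec j m); [lia|reflexivity].
  - destruct (Nat.eqb_spec j i); [unfold m in *; lia|].
    rewrite app_nth2; rewrite length_upd_nth; [|exact Hj]; fold m.
    destruct (Nat.eqb_spec j m) as [->|Hjm]; [rewrite Nat.sub_diag; reflexivity|].
    rewrite !nth_overflow; try reflexivity; simpl; [exact Hj|lia].
Qed.

Lemma length_series : length E' = S m.
Proof. unfold E'; rewrite length_app, length_upd_nth; simpl; unfold m; lia. Qed.

Lemma edge_bound (j : nat) : (j < m)%nat ->
  (fst (nth j E (0%nat, 0%nat)) < z)%nat /\ (snd (nth j E (0%nat, 0%nat)) < z)%nat.
Proof.
  intros Hj; apply HE; rewrite <- surjective_pairing; apply nth_In; exact Hj.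
Qed.

Lemma xy_bound : (x < z)%nat /\ (y < z)%nat.
Proof. pose proof (edge_bound i Hi) as H; rewrite Hxy in H; exact H. Qed.

(** The visited lists need to agree only on old vertices. From [z] an expanded walk can only go on
    to [y], so [z] being visited forces [y] to be visited; hence the extra test at [z] fails only
    where the test at [y] fails anyway. *)
Lemma walk_ok_expand (l : list nat) (v : nat) (vis vis' : list nat) :
  (v < z)%nat ->
  (forall u, (u < z)%nat -> memb u vis' = memb u vis) ->
  (memb z vis' = true -> memb y vis = true) ->
  walk_ok E' v vis' (expand l) = walk_ok E v vis l.
Proof.
  destruct xy_bound as [Hxz Hyz].
  revert v vis vis'; induction l as [|j l IH]; intros v vis vis' Hv Hvis Hzy;
    [reflexivity|].
  simpl expand; destruct (Nat.eqb_spec j i) as [->|Hji].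
  - simpl. rewrite !nth_series, Nat.eqb_refl, Hxy, length_series.
    destruct (Nat.eqb_spec m i) as [Hmi|_]; [unfold m in *; lia|].
    rewrite (Nat.eqb_refl m); simpl.
    replace (Nat.ltb i (S m)) with true by (symmetry; apply Nat.ltb_lt; unfold m; lia).
    replace (Nat.ltb i (length E)) with true by (symmetry; apply Nat.ltb_lt; exact Hi).
    replace (Nat.ltb m (S m)) with true by (symmetry; apply Nat.ltb_lt; lia).
    rewrite Nat.eqb_refl; simpl.
    replace (Nat.eqb y z) with false by (symmetry; apply Nat.eqb_neq; lia); simpl.
    fold (memb y vis') (memb y vis) (memb z vis'); rewrite (Hvis y Hyz).
    destruct (memb y vis) eqn:Ey; simpl; [rewrite !andb_false_r; reflexivity|].
    destruct (memb z vis') eqn:Ez; [specialize (Hzy eq_refl); discriminate|].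
    simpl; f_equal; apply IH; [exact Hyz| |].
    + intros u Hu; unfold memb in *; simpl; rewrite Hvis by exact Hu.
      replace (Nat.eqb u z) with false by (symmetry; apply Nat.eqb_neq; lia).
      reflexivity.
    + intros _; unfold memb; simpl; rewrite Nat.eqb_refl; reflexivity.
  - simpl. rewrite nth_series, length_series.
    destruct (Nat.eqb_spec j i) as [?|_]; [contradiction|].
    destruct (Nat.eqb_spec j m) as [->|Hjm].
    (* The edge [m] starts at [z], never at the old vertex [v], and in [E] the index [m] is out of
       range: both walks are rejected. *)
    + simpl.
      replace (Nat.eqb z v) with false by (symmetry; apply Nat.eqb_neq; lia).
      replace (Nat.ltb m (length E)) with false
        by (symmetry; apply Nat.ltb_ge; unfold m; lia).
      rewrite andb_false_r; reflexivity.
    + destruct (Nat.lt_ge_cases j m) as [Hl|Hl].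
      * replace (Nat.ltb j (S m)) with true by (symmetry; apply Nat.ltb_lt; lia).
        replace (Nat.ltb j (length E)) with true by (symmetry; apply Nat.ltb_lt; exact Hl).
        destruct (edge_bound j Hl) as [_ Hb].
        set (b := snd (nth j E (0%nat, 0%nat))) in *.
        fold (memb b vis') (memb b vis); rewrite (Hvis b Hb).
        f_equal; apply IH; [exact Hb| |].
        -- intros u Hu; unfold memb in *; simpl; rewrite Hvis by exact Hu; reflexivity.
        -- unfold memb in *; simpl.
           replace (Nat.eqb z b) with false by (symmetry; apply Nat.eqb_neq; lia).
           simpl; intros H; rewrite Hzy by exact H; apply orb_true_r.
      * replace (Nat.ltb j (S m)) with false by (symmetry; apply Nat.ltb_ge; lia).
        replace (Nat.ltb j (length E)) with false by (symmetry; apply Nat.ltb_ge; exact Hl).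
        reflexivity.
Qed.

(** After the edge [i] the walk stands at [z], which is not the sink and is left only by the edge
    [m]. Two entries are consumed at once, so the induction runs on a bound for the length instead
    of on the list. *)
Lemma walk_ok_is_expand (n : nat) (l : list nat) (v : nat) (vis : list nat) :
  (length l <= n)%nat -> (v < z)%nat -> walk_ok E' v vis l = true ->
  exists q, l = expand q.
Proof.
  destruct xy_bound as [Hxz Hyz].
  revert l v vis; induction n as [|n IH]; intros l v vis Hn Hv H.
  { destruct l; [exists []; reflexivity|simpl in Hn; lia]. }
  destruct l as [|j l]; [exists []; reflexivity|].
  simpl in Hn, H; rewrite !andb_true_iff, Nat.ltb_lt, Nat.eqb_eq, nth_series, length_series in H.
  destruct H as [[[Hj Hv'] _] H].
  destruct (Nat.eqb_spec j i) as [->|Hji].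
  - simpl in *; destruct l as [|k l].
    { simpl in H; apply Nat.eqb_eq in H; lia. }
    simpl in Hn, H; rewrite !andb_true_iff, Nat.ltb_lt, Nat.eqb_eq, nth_series, length_series in H.
    destruct H as [[[Hk Hkz] _] H].
    destruct (Nat.eqb_spec k i) as [->|Hki]; [simpl in Hkz; lia|].
    destruct (Nat.eqb_spec k m) as [->|Hkm].
    + simpl in *; destruct (IH l _ _ ltac:(lia) Hyz H) as [q ->].
      exists (i :: q); simpl; rewrite Nat.eqb_refl; reflexivity.
    + destruct (edge_bound k); lia.
  - destruct (Nat.eqb_spec j m) as [->|Hjm]; [simpl in Hv'; lia|].
    destruct (edge_bound j ltac:(lia)) as [_ Hb].
    destruct (IH l _ _ ltac:(lia) Hb H) as [q ->].
    exists (j :: q); simpl; destruct (Nat.eqb_spec j i); [contradiction|reflexivity].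
Qed.

(** A left inverse of [expand], which makes it injective on paths. *)
Lemma filter_expand (l : list nat) :
  (forall j, In j l -> (j < m)%nat) ->
  filter (fun j => negb (Nat.eqb j m)) (expand l) = l.
Proof.
  induction l as [|j l IH]; intros H; [reflexivity|]; simpl.
  assert (Hjm : Nat.eqb j m = false)
    by (apply Nat.eqb_neq; specialize (H j (or_introl eq_refl)); lia).
  rewrite filter_app, IH by (intros; apply H; right; assumption).
  destruct (Nat.eqb_spec j i) as [->|Hji]; simpl; rewrite Hjm, ?Nat.eqb_refl; reflexivity.
Qed.

Lemma length_expand (l : list nat) :
  NoDup l -> length (expand l) = if memb i l then S (length l) else length l.
Proof.
  intros Hn; induction Hn as [|j l Hj Hn IH]; [reflexivity|]; simpl.
  rewrite length_app, IH; unfold memb in *; simpl.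
  rewrite (Nat.eqb_sym i j).
  destruct (Nat.eqb_spec j i) as [->|Hji]; simpl.
  - apply memb_notIn in Hj; unfold memb in Hj; rewrite Hj; reflexivity.
  - destruct (existsb (Nat.eqb i) l); reflexivity.
Qed.

Lemma paths_series : Permutation (paths E') (map expand (paths E)).
Proof.
  assert (He : forall l, is_st_path E' (expand l) = is_st_path E l).
  { intros l; apply walk_ok_expand; [lia|reflexivity|].
    unfold memb; simpl; replace (Nat.eqb z 0) with false
      by (symmetry; apply Nat.eqb_neq; lia); discriminate. }
  apply NoDup_Permutation.
  - apply NoDup_paths.
  - apply NoDup_map_in_inj; [|apply NoDup_paths].
    intros a b Ha Hb Eab.
    rewrite <- (filter_expand a), <- (filter_expand b), Eab; [reflexivity| |].
    + intros j; apply (paths_idx _ _ _ Hb).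
    + intros j; apply (paths_idx _ _ _ Ha).
  - intros l; rewrite in_map_iff, in_paths; split.
    + intros H; destruct (walk_ok_is_expand (length l) l _ _ (le_n _) (Nat.lt_trans _ _ _ Nat.lt_0_1 Hz) H)
        as [q ->].
      exists q; split; [reflexivity|]. rewrite in_paths, <- He; exact H.
    + intros [q [<- Hq]]; rewrite He, <- in_paths; exact Hq.
Qed.

Lemma lsum_paths_series (g : nat -> R) :
  lsum (paths E') (fun l => g (length l)) =
  lsum (paths E) (fun l => if memb i l then g (S (length l)) else g (length l)).
Proof.
  rewrite (lsum_perm _ _ _ paths_series), lsum_map.
  apply lsum_ext; intros l Hl; rewrite length_expand by (eapply paths_NoDup; exact Hl).
  destruct (memb i l); reflexivity.
Qed.
End Series.

(** Among the [m] equally likely edges, a path is hit exactly as many times as it has edges. *)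
Lemma lsum_memb (m : nat) (l : list nat) (a b : R) :
  NoDup l -> (forall j, In j l -> (j < m)%nat) ->
  lsum (seq 0 m) (fun i => if memb i l then a else b)
  = INR (length l) * a + (INR m - INR (length l)) * b.
Proof.
  intros Hn Hl.
  rewrite (lsum_ext _ _ (fun i => b + (if memb i l then a - b else 0)))
    by (intros i _; destruct (memb i l); ring).
  rewrite lsum_plus, lsum_const, length_seq.
  rewrite <- lsum_filter, (lsum_perm _ l), lsum_const; [ring|].
  apply NoDup_Permutation; [apply NoDup_filter, seq_NoDup|exact Hn|].
  intros j; rewrite filter_In, memb_In, in_seq; split; [tauto|].
  intros H; specialize (Hl j H); split; [lia|exact H].
Qed.

(** * The expected number of paths *)

(** It guarantees that [fst G], the name of the next subdividing vertex, is fresh and is neither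
    source nor sink. *)
Definition wf_net (G : network) : Prop :=
  (1 < fst G)%nat /\
  forall a b, In (a, b) (snd G) -> (a < fst G)%nat /\ (b < fst G)%nat.

Lemma wf_net_parallel (G : network) (i : nat) :
  wf_net G -> (i < length (snd G))%nat -> wf_net (net_parallel G i).
Proof.
  intros [H1 H2] Hi; split; [exact H1|]; simpl; intros a b H.
  apply in_app_iff in H; destruct H as [H|[H|[]]]; [auto|].
  apply H2; rewrite <- H; apply nth_In; exact Hi.
Qed.

Lemma in_upd_nth {A : Type} (l : list A) (i : nat) (a b : A) :
  In b (upd_nth l i a) -> b = a \/ In b l.
Proof.
  revert i; induction l as [|c l IH]; intros [|i]; simpl; auto.
  - intros [H|H]; auto.
  - intros [H|H]; auto; destruct (IH _ H); auto.
Qed.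

Lemma wf_net_series (G : network) (i : nat) :
  wf_net G -> (i < length (snd G))%nat -> wf_net (net_series G i).
Proof.
  intros [H1 H2] Hi; unfold net_series.
  destruct (nth i (snd G) (0%nat, 0%nat)) as [x y] eqn:Exy.
  destruct (H2 x y) as [Hx Hy]; [rewrite <- Exy; apply nth_In; exact Hi|].
  split; simpl; [lia|]; intros a b H.
  apply in_app_iff in H; destruct H as [H|[H|[]]].
  - apply in_upd_nth in H; destruct H as [H|H]; [inversion H; lia|].
    destruct (H2 a b H); lia.
  - inversion H; lia.
Qed.

Lemma sp_dist_wf (p : R) (m : nat) (w : R) (G : network) :
  In (w, G) (sp_dist p m) -> wf_net G /\ length (snd G) = S m.
Proof.
  revert w G; induction m as [|m IH]; intros w G H; simpl in H.
  - destruct H as [H|[]]; inversion H; split; [|reflexivity].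
    split; simpl; [lia|]; intros a b [Hab|[]]; inversion Hab; lia.
  - apply in_flat_map in H; destruct H as [[w' G'] [HG' H]].
    destruct (IH w' G' HG') as [Hwf Hlen].
    apply in_flat_map in H; destruct H as [i [Hi H]]; apply in_seq in Hi.
    destruct H as [H|[H|[]]]; inversion H.
    + split; [apply wf_net_parallel; [exact Hwf|lia]|].
      simpl; rewrite length_app; simpl; lia.
    + split; [apply wf_net_series; [exact Hwf|lia]|].
      unfold net_series; destruct (nth i (snd G') (0%nat, 0%nat)); simpl.
      rewrite length_app, length_upd_nth; simpl; lia.
Qed.

(* Every edge of the current network evolves independently. [Phi] generates the expected
   number of paths an edge turns into and [pw (-1)] = 1/(1-z) is the weight of an edge
   which is not used; so a path with [l] of [m] edges contributes [path_fps Phi l m]. *)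
Definition path_fps (Phi : fps) (l m : nat) : fps :=
  fmul (fpow Phi l) (fpow (pw (-1)) (m - l)).

Definition net_fps (Phi : fps) (G : network) : fps :=
  fun k => lsum (paths (snd G)) (fun q => path_fps Phi (length q) (length (snd G)) k).

Lemma fder_fpow_log (a b : fps) (k : nat) :
  fder a = fmul a b -> fder (fpow a k) = fmul (fconst (INR k)) (fmul (fpow a k) b).
Proof.
  intros H; destruct k as [|k]; [simpl fpow; rewrite fder_const; simpl; ring|].
  rewrite fder_pow, H; simpl fpow; ring.
Qed.

Section Expectation.
Variables (p : R) (Phi : fps).
Hypothesis HPhi :
  fder Phi = fmul Phi (fadd (fmul (fconst (2 * p)) (pw (-1))) (fmul (fconst (1 - p)) Phi)).
Hypothesis HPhi0 : Phi 0%nat = 1.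

(** A logarithmic derivative: each factor [Phi] contributes [2p/(1-z) + (1-p) Phi], each factor
    [1/(1-z)] contributes [1/(1-z)]. These are the effects of one step: an edge of the path is
    doubled, giving two paths of length [l], or subdivided, giving one of length [l + 1]; any other
    edge leaves the path alone and only raises [m]. *)
Lemma fder_path_fps (l m k : nat) : (l <= m)%nat ->
  INR (S k) * path_fps Phi l m (S k) =
  (2 * p * INR l + (INR m - INR l)) * path_fps Phi l (S m) k
  + (1 - p) * INR l * path_fps Phi (S l) (S m) k.
Proof.
  intros Hl. change (fder (path_fps Phi l m) k =
    (2 * p * INR l + (INR m - INR l)) * path_fps Phi l (S m) k
    + (1 - p) * INR l * path_fps Phi (S l) (S m) k).
  transitivity (fadd (fmul (fconst (2 * p * INR l + (INR m - INR l))) (path_fps Phi l (S m)))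
                     (fmul (fconst ((1 - p) * INR l)) (path_fps Phi (S l) (S m))) k);
    [|unfold fadd; rewrite !fmul_const; reflexivity].
  apply (f_equal (fun f : fps => f k)).
  unfold path_fps; rewrite fder_mul, (fder_fpow_log _ _ _ HPhi).
  rewrite (fder_fpow_log (pw (-1)) (pw (-1))).
  - replace (S m - l)%nat with (S (m - l)) by lia.
    rewrite Nat.sub_succ; simpl fpow.
    rewrite minus_INR, fconst_add, !fconst_mul, fconst_sub by exact Hl; ring.
  - rewrite fder_pw_mul; replace (- -1) with 1 by ring; ring.
Qed.

Lemma net_fps_step (G : network) (k : nat) : wf_net G ->
  lsum (seq 0 (length (snd G)))
    (fun i => p * net_fps Phi (net_parallel G i) k + (1 - p) * net_fps Phi (net_series G i) k)
  = INR (S k) * net_fps Phi G (S k).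
Proof.
  intros [Hz HE].
  set (m := length (snd G)).
  set (f := fun l => path_fps Phi l (S m) k).
  assert (Hpar : forall i, (i < m)%nat -> net_fps Phi (net_parallel G i) k =
            lsum (paths (snd G)) (fun q => f (length q) + (if memb i q then f (length q) else 0))).
  { intros i Hi; rewrite <- (lsum_paths_parallel (snd G) i Hi f).
    unfold net_fps, f; simpl; rewrite length_app; simpl.
    replace (length (snd G) + 1)%nat with (S m) by (unfold m; lia); reflexivity. }
  assert (Hser : forall i, (i < m)%nat -> net_fps Phi (net_series G i) k =
            lsum (paths (snd G)) (fun q => if memb i q then f (S (length q)) else f (length q))).
  { intros i Hi; unfold net_series.
    destruct (nth i (snd G) (0%nat, 0%nat)) as [x y] eqn:Exy.
    rewrite <- (lsum_paths_series (snd G) i x y (fst G) Hi Exy Hz HE f).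
    unfold net_fps, f; simpl; rewrite length_app, length_upd_nth; simpl.
    replace (length (snd G) + 1)%nat with (S m) by (unfold m; lia); reflexivity. }
  rewrite (lsum_ext _ _ (fun i => lsum (paths (snd G)) (fun q =>
     p * (f (length q)) + (p * (if memb i q then f (length q) else 0) +
     (1 - p) * (if memb i q then f (S (length q)) else f (length q)))))).
  2:{ intros i Hi; apply in_seq in Hi. rewrite Hpar, Hser by lia.
      rewrite !lsum_plus, !lsum_scal; ring. }
  rewrite lsum_exchange. unfold net_fps; rewrite <- lsum_scal.
  apply lsum_ext; intros q Hq.
  pose proof (paths_NoDup _ _ Hq) as Hn.
  pose proof (fun j => paths_idx _ _ j Hq) as Hb.
  rewrite !lsum_plus, lsum_const, !lsum_scal, !lsum_memb, length_seq by assumption.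
  fold m; rewrite fder_path_fps.
  - unfold f; ring.
  - apply NoDup_bounded_length; [exact Hn|]. apply Forall_forall; exact Hb.
Qed.

Definition expect (D : list (R * network)) (F : network -> R) : R :=
  lsum D (fun wG => fst wG * F (snd wG)).

(** Every network in [sp_dist p m] has exactly [S m] edges, so the uniform choice is the constant
    factor [1/(m+1)] and the sum over edges is [net_fps_step]. *)
Lemma expect_step (m k : nat) :
  INR (S m) * expect (sp_dist p (S m)) (fun G => net_fps Phi G k) =
  INR (S k) * expect (sp_dist p m) (fun G => net_fps Phi G (S k)).
Proof.
  unfold expect; simpl sp_dist; unfold sp_step.
  rewrite lsum_flat_map, <- !lsum_scal; apply lsum_ext; intros [w G] HG.
  destruct (sp_dist_wf _ _ _ _ HG) as [Hwf Hlen].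
  rewrite lsum_flat_map; simpl fst; simpl snd.
  rewrite (lsum_ext _ _ (fun i => w / INR (S m) *
     (p * net_fps Phi (net_parallel G i) k + (1 - p) * net_fps Phi (net_series G i) k))).
  - rewrite lsum_scal, net_fps_step by exact Hwf.
    pose proof (INR_S_neq0 m); generalize dependent (INR (S m)); intros a Ha.
    field; exact Ha.
  - intros i _; rewrite Hlen; unfold lsum; cbn [fold_right map fst snd].
    pose proof (INR_S_neq0 m); generalize dependent (INR (S m)); intros a Ha.
    field; exact Ha.
Qed.

(** Iterates the exchange of a step for a derivative down to the initial edge, whose [net_fps] is
    [Phi]; the factorials collect the factors [S m] and [S k]. *)
Lemma expect_net_fps (m k : nat) :
  INR (fact m) * INR (fact k) * expect (sp_dist p m) (fun G => net_fps Phi G k)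
  = INR (fact (m + k)) * Phi (m + k)%nat.
Proof.
  revert k; induction m as [|m IH]; intros k.
  - unfold expect, lsum; simpl sp_dist; simpl map; simpl fold_right; simpl fst; simpl snd.
    replace (net_fps Phi net_init k) with (Phi k); [simpl; ring|].
    unfold net_fps, paths, lsum, path_fps; simpl.
    replace (fmul (fmul Phi (fconst 1)) (fconst 1)) with Phi by ring; ring.
  - transitivity (INR (fact m) * INR (fact k) *
      (INR (S m) * expect (sp_dist p (S m)) (fun G => net_fps Phi G k))).
    { rewrite fact_simpl, mult_INR; ring. }
    rewrite expect_step.
    replace (S m + k)%nat with (m + S k)%nat by lia.
    rewrite <- IH, (fact_simpl k), mult_INR; ring.
Qed.

(** All path weights have constant term 1, so coefficient 0 of [net_fps] counts paths. Size [n] is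
    reached after [n - 1] random steps, hence [pred n]. *)
Lemma EP_fps (n : nat) : EP p n = Phi (pred n).
Proof.
  transitivity (expect (sp_dist p (pred n)) (fun G => net_fps Phi G 0%nat)).
  - unfold EP, expect, lsum; f_equal; apply map_ext; intros [w G]; simpl; f_equal.
    unfold net_fps; rewrite num_paths_length.
    rewrite (lsum_ext _ _ (fun _ => 1)); [rewrite lsum_const; ring|].
    intros q _; unfold path_fps.
    rewrite fmul_at0, !fpow_at0; auto using pw_m1; ring.
  - pose proof (expect_net_fps (pred n) 0%nat) as H.
    rewrite Nat.add_0_r in H; simpl (fact 0%nat) in H; simpl (INR 1) in H.
    apply (Rmult_eq_reg_l (INR (fact (pred n)))); [lra|apply INR_fact_neq_0].
Qed.
End Expectation.

(** * The generating function and the exact formulas *)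

(** The equation for [Phi] is of Bernoulli type, so it becomes linear in [1/Phi]. Writing
    [1/Phi = (1-z)(1-h)] gives the stated equation for [h], uniformly in [p]; at [p = 1/2] the term
    with [1 - h] drops out and the logarithm appears. *)
Lemma path_gf_ode (p : R) (h : fps) :
  h 0%nat = 0 ->
  fder h = fmul (pw (-1)) (fadd (fmul (fconst (2 * p - 1)) (fsub (fconst 1) h)) (fconst (1 - p))) ->
  let Phi := fmul (pw (-1)) (fgeo h) in
  fder Phi = fmul Phi (fadd (fmul (fconst (2 * p)) (pw (-1))) (fmul (fconst (1 - p)) Phi)).
Proof.
  intros H0 Hh Phi; unfold Phi.
  pose proof (fgeo_inv h H0) as Hi.
  rewrite fder_mul, fder_fgeo, fder_pw_mul by exact H0.
  replace (fconst (- -1)) with (fconst 1) by (f_equal; ring).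
  rewrite Hh; set (y := fgeo h) in *; set (s := pw (-1)).
  transitivity (fadd (fmul (fmul s s) y)
    (fadd (fmul (fconst (2 * p - 1)) (fmul (fmul (fmul s s) y) (fmul (fsub (fconst 1) h) y)))
          (fmul (fconst (1 - p)) (fmul (fmul s s) (fmul y y))))); [ring|].
  rewrite Hi.
  replace (2 * p) with (1 + (2 * p - 1)) at 2 by ring.
  rewrite (fconst_add 1 (2 * p - 1)); ring.
Qed.

Lemma EP_gf (p : R) (h : fps) :
  h 0%nat = 0 ->
  fder h = fmul (pw (-1)) (fadd (fmul (fconst (2 * p - 1)) (fsub (fconst 1) h)) (fconst (1 - p))) ->
  forall n, EP p n = fmul (pw (-1)) (fgeo h) (pred n).
Proof.
  intros H0 Hh n; apply EP_fps.
  - apply path_gf_ode; assumption.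
  - rewrite fmul_at0, fgeo_at0; simpl; ring.
Qed.

Lemma EP_gf_sum (p : R) (h : fps) :
  h 0%nat = 0 ->
  fder h = fmul (pw (-1)) (fadd (fmul (fconst (2 * p - 1)) (fsub (fconst 1) h)) (fconst (1 - p))) ->
  forall n, (1 <= n)%nat -> EP p n = sumR n (fun k => fmul (pw (-1)) (fpow h k) (n - 1)%nat).
Proof.
  intros H0 Hh n Hn; rewrite (EP_gf p h H0 Hh).
  rewrite <- fmul_sum_r; replace (pred n) with (n - 1)%nat by lia.
  apply fmul_ext_le; [reflexivity|].
  intros m Hm; apply fgeo_trunc; [exact H0|lia].
Qed.

(** Used with [d = 2p - 1] for the exact formula and with [d = |2p - 1|] for the asymptotics. *)
Definition pow_defect (c d : R) : fps := fmul (fconst c) (fsub (fconst 1) (pw d)).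

Lemma pow_defect_0 (c d : R) : pow_defect c d 0%nat = 0.
Proof. unfold pow_defect; rewrite fmul_const; unfold fsub; simpl; ring. Qed.

Lemma pow_defect_ode (p : R) : p <> 1/2 ->
  let h := pow_defect (p / (2 * p - 1)) (2 * p - 1) in
  fder h = fmul (pw (-1)) (fadd (fmul (fconst (2 * p - 1)) (fsub (fconst 1) h)) (fconst (1 - p))).
Proof.
  intros Hp h; unfold h, pow_defect.
  rewrite fder_mul, fder_sub, !fder_const, fder_pw_mul.
  set (w := pw (2 * p - 1)); set (s := pw (-1)).
  assert (E : fmul (fconst (p / (2 * p - 1))) (fconst (2 * p - 1)) = fconst p)
    by (rewrite <- fconst_mul; f_equal; field; lra).
  rewrite fconst_opp.
  transitivity (fmul (fmul (fconst (p / (2 * p - 1))) (fconst (2 * p - 1))) (fmul s w)); [ring|].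
  transitivity (fmul s (fadd (fsub (fconst (2 * p - 1))
     (fmul (fmul (fconst (p / (2 * p - 1))) (fconst (2 * p - 1))) (fsub (fconst 1) w)))
     (fconst (1 - p)))); [|ring].
  rewrite E.
  replace (2 * p - 1) with (p - (1 - p)) by ring; rewrite (fconst_sub p (1 - p)); ring.
Qed.

(** * Generalized binomials and the exact formula for [p] different from 1/2 *)

Lemma falling_shift (a : R) (k : nat) : falling (a + 1) (S k) = (a + 1) * falling a k.
Proof.
  induction k as [|k IH]; [simpl; ring|].
  change (falling (a + 1) (S (S k))) with (falling (a + 1) (S k) * (a + 1 - INR (S k))).
  rewrite IH, S_INR; simpl; ring.
Qed.

Lemma gbinom_pascal (a : R) (k : nat) :
  gbinom (a + 1) (S k) = gbinom a (S k) + gbinom a k.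
Proof.
  unfold gbinom; rewrite falling_shift, fact_simpl, mult_INR.
  pose proof (INR_fact_neq_0 k); pose proof (INR_S_neq0 k); rewrite S_INR in *.
  simpl falling; field; auto.
Qed.

Lemma gbinom_0 (a : R) : gbinom a 0 = 1.
Proof. unfold gbinom; simpl; field. Qed.

Lemma gbinom_small (k j : nat) : (k < j)%nat -> gbinom (INR k) j = 0.
Proof.
  revert j; induction k as [|k IH]; intros [|j] H; try lia.
  - unfold gbinom; replace (falling (INR 0) (S j)) with 0; [unfold Rdiv; ring|].
    clear H; induction j as [|j IH]; [simpl; ring|].
    change (0 = falling (INR 0) (S j) * (INR 0 - INR (S j))); rewrite <- IH; ring.
  - rewrite S_INR, gbinom_pascal, !IH by lia; ring.
Qed.

Lemma gbinom_fact (k i : nat) : (i <= k)%nat ->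
  gbinom (INR k) i = INR (fact k) / (INR (fact i) * INR (fact (k - i))).
Proof.
  intros H. assert (E : falling (INR k) i * INR (fact (k - i)) = INR (fact k)).
  { induction i as [|i IH]; [rewrite Nat.sub_0_r; simpl; ring|].
    rewrite <- IH by lia. replace (k - i)%nat with (S (k - S i)) by lia.
    rewrite fact_simpl, mult_INR. simpl falling.
    replace (S (k - S i)) with (k - i)%nat by lia.
    rewrite minus_INR by lia; ring. }
  unfold gbinom; rewrite <- E.
  field; split; apply INR_fact_neq_0.
Qed.

Lemma pw_gbinom (d : R) (n : nat) : pw d n = (-1) ^ n * gbinom d n.
Proof.
  induction n as [|n IH]; [rewrite gbinom_0; simpl; ring|].
  cbn [pw]; rewrite IH; unfold gbinom; rewrite fact_simpl, mult_INR.
  pose proof (INR_fact_neq_0 n); pose proof (INR_S_neq0 n).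
  cbn [falling pow]; generalize dependent (INR (S n)); intros; field; auto.
Qed.

(** The binomial theorem. The upper limit may be any [N > k], since the surplus binomials vanish;
    one range then serves all [k] and the two sums can be exchanged. *)
Lemma fpow_pow_defect (c d : R) (k N m : nat) : (k < N)%nat ->
  fpow (pow_defect c d) k m =
  sumR N (fun j => gbinom (INR k) j * (-1) ^ j * c ^ k * pw (d * INR j) m).
Proof.
  revert m; induction k as [|k IH]; intros m HN.
  - destruct N as [|N]; [lia|]; rewrite sumR_shift, sumR_0.
    + simpl (INR 0); rewrite gbinom_0, Rmult_0_r, pw_0; simpl; ring.
    + intros i _; rewrite gbinom_small by lia; ring.
  - simpl fpow.
    rewrite (fmul_ext_le _ (fpow (pow_defect c d) k) (pow_defect c d)
      (fun m => sumR N (fun j => gbinom (INR k) j * (-1) ^ j * c ^ k * pw (d * INR j) m)));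
      [|reflexivity|intros; apply IH; lia].
    rewrite fmul_sum_r.
    rewrite (sumR_ext _ _ (fun j =>
      gbinom (INR k) j * (-1) ^ j * c ^ S k * pw (d * INR j) m
      + gbinom (INR k) j * (-1) ^ S j * c ^ S k * pw (d * INR (S j)) m)).
    2:{ intros j _; rewrite fmul_comm, fmul_scal_l.
        replace (fmul (pw (d * INR j)) (pow_defect c d))
          with (fmul (fconst c) (fsub (pw (d * INR j)) (pw (d * INR (S j))))).
        - rewrite fmul_const; unfold fsub; simpl; ring.
        - unfold pow_defect; rewrite S_INR, Rmult_plus_distr_l, Rmult_1_r, <- pw_add; ring. }
    rewrite sumR_plus. destruct N as [|N]; [lia|].
    rewrite (sumR_shift N (fun j => gbinom (INR k) j * (-1) ^ j * c ^ S k * pw (d * INR j) m)).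
    rewrite (sumR_shift N (fun j => gbinom (INR (S k)) j * (-1) ^ j * c ^ S k * pw (d * INR j) m)).
    change (sumR (S N) (fun j => gbinom (INR k) j * (-1) ^ S j * c ^ S k * pw (d * INR (S j)) m))
      with (sumR N (fun j => gbinom (INR k) j * (-1) ^ S j * c ^ S k * pw (d * INR (S j)) m)
            + gbinom (INR k) N * (-1) ^ S N * c ^ S k * pw (d * INR (S N)) m).
    rewrite (gbinom_small k N), !gbinom_0 by lia.
    rewrite (sumR_ext N (fun i => gbinom (INR (S k)) (S i) * _ * _ * _)
      (fun i => gbinom (INR k) (S i) * (-1) ^ S i * c ^ S k * pw (d * INR (S i)) m
              + gbinom (INR k) i * (-1) ^ S i * c ^ S k * pw (d * INR (S i)) m))
      by (intros i _; rewrite (S_INR k), gbinom_pascal; ring).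
    rewrite sumR_plus; ring.
Qed.

Lemma EP_exact_ne (p : R) (n : nat) : p <> 1/2 -> (1 <= n)%nat -> EP p n = EP_formula_ne p n.
Proof.
  intros Hp Hn.
  rewrite (EP_gf_sum p _ (pow_defect_0 _ _) (pow_defect_ode p Hp) n Hn).
  unfold EP_formula_ne.
  rewrite (sumR_ext n _ (fun k => sumR n (fun j =>
     (-1) ^ (n + j - 1) * gbinom ((2 * p - 1) * INR j - 1) (n - 1)
     * (gbinom (INR k) j * (p / (2 * p - 1)) ^ k)))).
  - rewrite sumR_exchange; apply sumR_ext; intros j _; apply sumR_scal.
  - intros k Hk.
    rewrite (fmul_ext_le _ _ (pw (-1)) (fun m => sumR n (fun j =>
      gbinom (INR k) j * (-1) ^ j * (p / (2 * p - 1)) ^ k * pw ((2 * p - 1) * INR j) m)));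
      [|reflexivity|intros; apply fpow_pow_defect; exact Hk].
    rewrite fmul_sum_r; apply sumR_ext; intros j _.
    rewrite fmul_comm, fmul_scal_l, pw_add, pw_gbinom.
    (* The sign joins [(-1)^j] from the binomial theorem with [(-1)^(n-1)] from [pw_gbinom]. *)
    replace (n + j - 1)%nat with (j + (n - 1))%nat by lia; rewrite pow_add.
    replace ((2 * p - 1) * INR j + -1) with ((2 * p - 1) * INR j - 1) by ring; ring.
Qed.

(* The coefficients of [log (1 / (1 - z))]. *)
Definition flog : fps := fun n => match n with O => 0 | S _ => / INR n end.

Lemma fder_flog : fder flog = pw (-1).
Proof.
  apply functional_extensionality; intros n; rewrite pw_m1; unfold fder, flog.
  apply Rinv_r, INR_S_neq0.
Qed.

Definition half_log : fps := fmul (fconst (/ 2)) flog.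

Lemma half_log_0 : half_log 0%nat = 0.
Proof. unfold half_log; rewrite fmul_const; simpl; ring. Qed.

Lemma half_log_ode :
  fder half_log = fmul (pw (-1))
    (fadd (fmul (fconst (2 * (1/2) - 1)) (fsub (fconst 1) half_log)) (fconst (1 - 1/2))).
Proof.
  unfold half_log; rewrite fder_mul, fder_const, fder_flog.
  replace (2 * (1/2) - 1) with 0 by field.
  replace (1 - 1/2) with (/ 2) by field; ring.
Qed.

(* The product of [1 - a / j], [1 <= j <= N], as a power series in [a]. *)
Fixpoint inv_prod (N : nat) : fps :=
  match N with
  | O => fconst 1
  | S N' => fmul (inv_prod N')
      (fun i => match i with O => 1 | 1%nat => - / INR (S N') | _ => 0 end)
  end.

Lemma inv_prod_S (N k : nat) :
  inv_prod (S N) (S k) = inv_prod N (S k) - inv_prod N k / INR (S N).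
Proof.
  simpl inv_prod; rewrite fmul_comm, fmul_S.
  rewrite (fmul_ext_le _ (inv_prod N) (fconst (- / INR (S N))) (inv_prod N));
    [|intros [|m] _; reflexivity|reflexivity].
  rewrite fmul_const; unfold Rdiv; ring.
Qed.

Lemma inv_prod_S0 (N : nat) : inv_prod (S N) 0%nat = inv_prod N 0%nat.
Proof. simpl inv_prod; rewrite fmul_at0; ring. Qed.

(** Behind it is [(1-z)^(-1-a)], the sum over [k] of [a^k/k!] times [log(1/(1-z))^k/(1-z)], whose
    coefficient [N] is the product of [1 + a/j]. The proof compares recursions in [N], using that
    the derivative of [flog^(k+1)] is [(k+1) flog^k/(1-z)]. *)
Lemma flog_pow_coef (N k : nat) :
  fmul (pw (-1)) (fpow flog k) N = (-1) ^ k * INR (fact k) * inv_prod N k.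
Proof.
  assert (Hstep : forall k n, fmul (pw (-1)) (fpow flog k) (S n)
            = fmul (pw (-1)) (fpow flog k) n + fpow flog k (S n)).
  { intros j n.
    assert (E : fmul fone_minus_z (fmul (pw (-1)) (fpow flog j)) = fpow flog j).
    { transitivity (fmul (fmul (pw 1) (pw (-1))) (fpow flog j)); [rewrite pw_1; ring|].
      rewrite pw_add; replace (1 + -1) with 0 by ring; rewrite pw_0; ring. }
    assert (E' := f_equal (fun f : fps => f (S n)) E); cbv beta in E'.
    rewrite fmul_one_minus_z_S in E'; lra. }
  revert k; induction N as [|N IH]; intros k.
  - rewrite fmul_at0; destruct k as [|k]; simpl fpow; [simpl; ring|].
    rewrite fmul_at0; simpl; ring.
  - rewrite Hstep, IH; destruct k as [|k]; [rewrite inv_prod_S0; simpl; ring|].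
    rewrite inv_prod_S, fact_simpl, mult_INR.
    assert (E := f_equal (fun f : fps => f N) (fder_pow flog k)); cbv beta in E.
    rewrite fmul_const, fder_flog, (fmul_comm (fpow flog k)), IH in E; unfold fder in E.
    replace (fpow flog (S k) (S N))
      with (INR (S k) * ((-1) ^ k * INR (fact k) * inv_prod N k) / INR (S N)).
    + simpl pow; field; apply INR_S_neq0.
    + rewrite <- E; field; apply INR_S_neq0.
Qed.

(** Logarithmic derivative in [a]: the factor [1 - a/j] contributes [-1/(j-a)], a geometric series
    in [a], and summation over [j] produces the power sums [harm]. These are Newton's identities. *)
Lemma fder_inv_prod (N : nat) :
  fder (inv_prod N) = fopp (fmul (inv_prod N) (fun i => harm (S i) N)).
Proof.
  induction N as [|N IH].
  - simpl inv_prod; rewrite fder_const; unfold harm; simpl.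
    apply functional_extensionality; intros n; unfold fopp; rewrite fmul_const.
    destruct n; simpl; ring.
  - set (q := / INR (S N)).
    set (b := (fun i : nat => match i with O => 1 | 1%nat => - q | _ => 0 end) : fps).
    change (inv_prod (S N)) with (fmul (inv_prod N) b).
    set (g := (fun i : nat => q ^ S i) : fps).
    assert (Hb : fder b = fconst (- q)).
    { apply functional_extensionality; intros [|[|n]]; unfold fder, b; simpl; ring. }
    assert (Hg : fmul b g = fconst q).
    { apply functional_extensionality; intros [|n].
      - rewrite fmul_at0; unfold b, g; simpl; ring.
      - rewrite fmul_S.
        rewrite (fmul_ext_le _ g (fconst (- q)) g);
          [|intros [|m] _; reflexivity|reflexivity].
        rewrite fmul_const; unfold b, g; simpl; ring. }
    replace (fun i => harm (S i) (S N)) with (fadd (fun i => harm (S i) N) g).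
    + rewrite fder_mul, IH, Hb, fconst_opp.
      transitivity (fopp (fadd (fmul (fmul (inv_prod N) (fun i => harm (S i) N)) b)
                               (fmul (inv_prod N) (fmul b g)))); [rewrite Hg|]; ring.
    + apply functional_extensionality; intros i; unfold fadd, g, q, harm.
      simpl sumR; rewrite pow_inv; reflexivity.
Qed.

(** * Bell polynomials of harmonic numbers and the exact formula for [p = 1/2] *)

Lemma length_bells (k : nat) (x : nat -> R) : length (bells k x) = S k.
Proof. induction k as [|k IH]; [reflexivity|]; simpl; rewrite length_app, IH; simpl; lia. Qed.

Lemma nth_bells (j k : nat) (x : nat -> R) : (j <= k)%nat -> nth j (bells k x) 0 = bell j x.
Proof.
  intros H; induction H as [|k H IH]; [reflexivity|]; simpl.
  rewrite app_nth1; [exact IH|rewrite length_bells; lia].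
Qed.

Lemma bell_S (k : nat) (x : nat -> R) :
  bell (S k) x = sumR (S k) (fun i => gbinom (INR k) i * bell (k - i) x * x (S i)).
Proof.
  transitivity (sumR (S k) (fun i => gbinom (INR k) i * nth (k - i) (bells k x) 0 * x (S i))).
  - unfold bell; cbn [bells]; rewrite app_nth2; rewrite length_bells; [|lia].
    rewrite Nat.sub_diag; reflexivity.
  - apply sumR_ext; intros i Hi; rewrite nth_bells by lia; reflexivity.
Qed.

(** Coefficient [k] of [fder_inv_prod], multiplied by [k!], is the Bell recurrence, because
    [C(k,i) i! = k!/(k-i)!]. *)
Lemma bell_harm (N k : nat) :
  bell k (fun m => - INR (fact (m - 1)) * harm m N) = INR (fact k) * inv_prod N k.
Proof.
  induction k as [k IH] using (well_founded_induction Wf_nat.lt_wf).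
  destruct k as [|k].
  - assert (E : inv_prod N 0%nat = 1).
    { clear IH; induction N as [|N IHN]; [reflexivity|rewrite inv_prod_S0; exact IHN]. }
    rewrite E; unfold bell; simpl; ring.
  - rewrite bell_S.
    assert (E := f_equal (fun f : fps => f k) (fder_inv_prod N)); cbv beta in E.
    unfold fopp in E; rewrite fmul_comm in E; unfold fmul in E; unfold fder in E.
    rewrite fact_simpl, mult_INR.
    replace (INR (S k) * INR (fact k) * inv_prod N (S k))
      with (INR (fact k) * (INR (S k) * inv_prod N (S k))) by ring.
    rewrite E, <- Ropp_mult_distr_r, <- (Ropp_involutive (sumR _ _)); f_equal.
    rewrite <- sumR_scal; replace (- sumR (S k) _) with
      (sumR (S k) (fun i => -1 * (gbinom (INR k) i * bell (k - i)
         (fun m => - INR (fact (m - 1)) * harm m N) * (- INR (fact (S i - 1)) * harm (S i) N))))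
      by (rewrite sumR_scal; ring).
    apply sumR_ext; intros i Hi.
    rewrite IH, gbinom_fact by lia.
    replace (S i - 1)%nat with i by lia.
    field; split; apply INR_fact_neq_0.
Qed.

Lemma fpow_const_mul (c : R) (a : fps) (k : nat) :
  fpow (fmul (fconst c) a) k = fmul (fconst (c ^ k)) (fpow a k).
Proof.
  induction k as [|k IH]; simpl; [ring|]. rewrite IH, fconst_mul; ring.
Qed.

Lemma EP_exact_half (n : nat) : (1 <= n)%nat -> EP (1/2) n = EP_formula_half n.
Proof.
  intros Hn; rewrite (EP_gf_sum _ _ half_log_0 half_log_ode n Hn).
  unfold EP_formula_half; apply sumR_ext; intros k _.
  rewrite bell_harm; unfold half_log; rewrite fpow_const_mul.
  replace (fmul (pw (-1)) (fmul (fconst ((/ 2) ^ k)) (fpow flog k)))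
    with (fmul (fconst ((/ 2) ^ k)) (fmul (pw (-1)) (fpow flog k))) by ring.
  rewrite fmul_const, flog_pow_coef, pow_inv; field; apply pow_nonzero; lra.
Qed.

(** * Evaluation of power series *)

(** A condition easy to propagate that gives radius of convergence at least 1, enough for evaluation
    at every singularity in [(0,1)]. *)
Definition fbounded (a : fps) : Prop := exists B, forall n, Rabs (a n) <= B.

Lemma fmul_PS_mult (a b : fps) : fmul a b = PS_mult a b.
Proof.
  apply functional_extensionality; intros n; unfold fmul, PS_mult.
  rewrite <- sum_n_sumR; apply sum_n_Reals.
Qed.

Lemma fbounded_CV (a : fps) (x : R) :
  fbounded a -> Rabs x < 1 -> Rbar_lt (Rabs x) (CV_radius a).
Proof.
  intros [B HB] Hx. apply (Rbar_lt_le_trans _ 1); [exact Hx|].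
  apply (proj1 (CV_radius_bounded a)). exists B; intros n.
  rewrite pow1, Rmult_1_r; apply HB.
Qed.

Lemma PSeries_fmul (a b : fps) (x : R) :
  Rbar_lt (Rabs x) (CV_radius a) -> Rbar_lt (Rabs x) (CV_radius b) ->
  PSeries (fmul a b) x = PSeries a x * PSeries b x.
Proof. intros Ha Hb; rewrite fmul_PS_mult; apply PSeries_mult; assumption. Qed.

Lemma fbounded_finite (a : fps) (N : nat) :
  (forall n, (N <= n)%nat -> a n = 0) -> fbounded a.
Proof.
  intros H; exists (sumR N (fun i => Rabs (a i))); intros n.
  destruct (Nat.lt_ge_cases n N) as [Hn|Hn].
  - clear H; induction N as [|N IH]; [lia|]; simpl.
    assert (0 <= sumR N (fun i => Rabs (a i))) by (apply sumR_pos; intros; apply Rabs_pos).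
    pose proof (Rabs_pos (a N)).
    destruct (Nat.eq_dec n N) as [->|]; [lra|]. specialize (IH ltac:(lia)); lra.
  - rewrite H, Rabs_R0 by exact Hn; apply sumR_pos; intros; apply Rabs_pos.
Qed.

Lemma PSeries_finite2 (a : fps) (x : R) : (forall n, (2 <= n)%nat -> a n = 0) ->
  PSeries a x = a 0%nat + a 1%nat * x.
Proof.
  intros H; unfold PSeries.
  rewrite (Series_incr_n _ 2); [|lia|].
  - rewrite (Series_ext _ (fun _ => 0 * 0)) by (intros n; rewrite H by lia; ring).
    rewrite Series_scal_l; simpl; ring.
  - exists (sum_n (fun k => a k * x ^ k) 1).
    enough (L : is_lim_seq (sum_n (fun k => a k * x ^ k))
                  (Finite (sum_n (fun k => a k * x ^ k) 1))) by exact L.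
    apply is_lim_seq_ext_loc with (fun _ => sum_n (fun k => a k * x ^ k) 1);
      [|apply is_lim_seq_const].
    exists 1%nat; intros n Hn; induction Hn as [|n Hn IH]; [reflexivity|].
    rewrite (sum_Sn _ n), <- IH, (H (S n)) by lia.
    unfold plus; simpl; rewrite Rmult_0_l, Rplus_0_r; reflexivity.
Qed.

Lemma PSeries_fone_minus_z (x : R) : PSeries fone_minus_z x = 1 - x.
Proof.
  rewrite PSeries_finite2; [simpl; ring|]. intros [|[|n]] H; [lia|lia|reflexivity].
Qed.

Lemma fbounded_one_minus_z : fbounded fone_minus_z.
Proof.
  apply (fbounded_finite _ 2). intros [|[|n]] H; [lia|lia|reflexivity].
Qed.

Lemma CV_fder (a : fps) (x : R) :
  Rbar_lt (Rabs x) (CV_radius a) -> Rbar_lt (Rabs x) (CV_radius (fder a)).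
Proof. intros H; change (fder a) with (PS_derive a); rewrite CV_radius_derive; exact H. Qed.

Lemma pw_abs_le_1 (d : R) : -1 <= d <= 1 -> forall n, Rabs (pw d n) <= 1.
Proof.
  intros Hd; induction n as [|n IH]; [simpl; rewrite Rabs_R1; lra|].
  cbn [pw]; rewrite Rabs_mult.
  replace 1 with (1 * 1) by ring.
  apply Rmult_le_compat; try apply Rabs_pos; [exact IH|].
  unfold Rdiv; rewrite Rabs_mult, (Rabs_pos_eq (/ _)).
  - apply Rmult_le_reg_r with (INR (S n)); [apply lt_0_INR; lia|].
    rewrite Rmult_assoc, Rinv_l, Rmult_1_r, Rmult_1_l by apply INR_S_neq0.
    rewrite S_INR; destruct n as [|n]; [simpl INR; apply Rabs_le; lra|].
    apply Rabs_le; pose proof (pos_INR n); rewrite S_INR; lra.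
  - left; apply Rinv_0_lt_compat, lt_0_INR; lia.
Qed.

Lemma fbounded_pw (d : R) : -1 <= d <= 1 -> fbounded (pw d).
Proof. intros Hd; exists 1; apply pw_abs_le_1; exact Hd. Qed.

Lemma zero_derive_const (g : R -> R) (z : R) : 0 <= z ->
  (forall x, 0 <= x <= z -> is_derive g x 0) -> g z = g 0.
Proof.
  intros Hz Hg.
  destruct (MVT_gen g 0 z (fun _ => 0)) as [c [_ Hc]].
  - rewrite Rmin_left, Rmax_right by exact Hz; intros x Hx; apply Hg; lra.
  - rewrite Rmin_left, Rmax_right by exact Hz; intros x Hx.
    apply continuity_pt_filterlim, (ex_derive_continuous g).
    exists 0; apply Hg; exact Hx.
  - lra.
Qed.

(** The quotient of the two sides has derivative zero, since the formal equation [fder_pw] holds for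
    the sums as well. *)
Lemma PSeries_pw (d z : R) : -1 <= d <= 1 -> 0 <= z < 1 ->
  PSeries (pw d) z = Rpower (1 - z) d.
Proof.
  intros Hd Hz.
  pose proof (fbounded_pw d Hd) as Hb.
  assert (H : PSeries (pw d) z * exp (- d * ln (1 - z)) = PSeries (pw d) 0 * exp (- d * ln (1 - 0))).
  { apply (zero_derive_const (fun x => PSeries (pw d) x * exp (- d * ln (1 - x)))); [lra|].
    intros x Hx.
    assert (Hx1 : Rabs x < 1) by (rewrite Rabs_pos_eq; lra).
    pose proof (fbounded_CV _ x Hb Hx1) as Hcv.
    pose proof (is_derive_PSeries _ x Hcv) as D1.
    assert (D2 : is_derive (fun x => exp (- d * ln (1 - x))) x
                   (d / (1 - x) * exp (- d * ln (1 - x)))).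
    { auto_derive; [lra|]. change (1 + - x) with (1 - x); field; lra. }
    assert (E : (1 - x) * PSeries (PS_derive (pw d)) x = - d * PSeries (pw d) x).
    { rewrite <- PSeries_fone_minus_z.
      change (PS_derive (pw d)) with (fder (pw d)).
      rewrite <- PSeries_fmul.
      - rewrite fder_pw, fmul_const_l; apply PSeries_scal.
      - apply fbounded_CV; [apply fbounded_one_minus_z|exact Hx1].
      - apply CV_fder; exact Hcv. }
    pose proof (is_derive_mult _ _ x _ _ D1 D2 ltac:(intros; apply Rmult_comm)) as D3.
    replace 0 with (plus (mult (PSeries (PS_derive (pw d)) x) (exp (- d * ln (1 - x))))
      (mult (PSeries (pw d) x) (d / (1 - x) * exp (- d * ln (1 - x))))); [exact D3|].
    unfold plus, mult; simpl.
    replace (PSeries (PS_derive (pw d)) x) with (- d * PSeries (pw d) x / (1 - x)).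
    - field; lra.
    - rewrite <- E; field; lra. }
  rewrite Rminus_0_r, ln_1, Rmult_0_r, exp_0, PSeries_0 in H.
  simpl in H. unfold Rpower.
  replace (d * ln (1 - z)) with (- (- d * ln (1 - z))) by ring.
  rewrite exp_Ropp.
  pose proof (exp_pos (- d * ln (1 - z))).
  apply (Rmult_eq_reg_r (exp (- d * ln (1 - z)))); [|lra].
  rewrite H, Rinv_l; lra.
Qed.

Lemma fbounded_flog : fbounded flog.
Proof.
  exists 1; intros [|n]; unfold flog; [rewrite Rabs_R0; lra|].
  assert (H : 1 <= INR (S n)) by (apply (le_INR 1); lia).
  rewrite Rabs_pos_eq; [|left; apply Rinv_0_lt_compat; lra].
  rewrite <- Rinv_1; apply Rinv_le_contravar; lra.
Qed.

Lemma PSeries_flog (z : R) : 0 <= z < 1 -> PSeries flog z = - ln (1 - z).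
Proof.
  intros Hz.
  assert (H : PSeries flog z + ln (1 - z) = PSeries flog 0 + ln (1 - 0)).
  { apply (zero_derive_const (fun x => PSeries flog x + ln (1 - x))); [lra|].
    intros x Hx.
    assert (Hx1 : Rabs x < 1) by (rewrite Rabs_pos_eq; lra).
    pose proof (is_derive_PSeries _ x (fbounded_CV _ x fbounded_flog Hx1)) as D1.
    assert (D2 : is_derive (fun x => ln (1 - x)) x (- / (1 - x)))
      by (auto_derive; [lra|change (1 + - x) with (1 - x); field; lra]).
    pose proof (is_derive_plus _ _ x _ _ D1 D2) as D3.
    replace 0 with (plus (PSeries (PS_derive flog) x) (- / (1 - x))); [exact D3|].
    change (PS_derive flog) with (fder flog); rewrite fder_flog.
    rewrite PSeries_pw by lra.
    unfold plus; simpl; replace (-1) with (- (1)) by ring.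
    rewrite Rpower_Ropp, Rpower_1 by lra; ring. }
  rewrite Rminus_0_r, ln_1, PSeries_0 in H; simpl in H; lra.
Qed.

(** * Growth of the coefficients of [(1 - z)^d] *)

Lemma Rpower_pos (x y : R) : 0 < Rpower x y.
Proof. apply exp_pos. Qed.

Lemma Rpower_base1 (y : R) : Rpower 1 y = 1.
Proof. unfold Rpower; rewrite ln_1, Rmult_0_r, exp_0; reflexivity. Qed.

Lemma exp_le_mono (x y : R) : x <= y -> exp x <= exp y.
Proof. intros [H| ->]; [left; apply exp_increasing; exact H|right; reflexivity]. Qed.

Lemma INR_gt0 (n : nat) : (1 <= n)%nat -> 0 < INR n.
Proof. intros H; apply lt_0_INR; lia. Qed.

(** The derivative [-d(1+d) t (1+t)^(d-1)] of the product vanishes at 0, so only a quadratic error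
    remains. For [x = 1/n] the product is the ratio of consecutive values of [pw d n] times
    [n^(1+d)]. *)
Lemma pw_ratio (d : R) : exists K, 0 <= K /\ forall x, 0 <= x <= 1 ->
  Rabs ((1 - d * x) * Rpower (1 + x) d - 1) <= K * x ^ 2.
Proof.
  (* The exponential bounds [(1+c)^(d-1)] for the intermediate point [c] in [[0,1]], where
     [ln (1+c) <= c <= 1]. *)
  exists (Rabs (d * (1 + d)) * exp (Rabs (d - 1))).
  split; [apply Rmult_le_pos; [apply Rabs_pos|left; apply exp_pos]|].
  intros x Hx.
  destruct (MVT_gen (fun t => (1 - d * t) * Rpower (1 + t) d) 0 x
     (fun t => - (d * (1 + d)) * t * Rpower (1 + t) (d - 1))) as [c [Hc E]].
  - rewrite Rmin_left, Rmax_right by lra; intros t Ht.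
    unfold Rpower; auto_derive; [lra|].
    replace ((d - 1) * ln (1 + t)) with (d * ln (1 + t) + - ln (1 + t)) by ring.
    rewrite exp_plus, exp_Ropp, exp_ln by lra. field; lra.
  - rewrite Rmin_left, Rmax_right by lra; intros t Ht.
    apply continuity_pt_filterlim.
    apply (ex_derive_continuous (fun t => (1 - d * t) * Rpower (1 + t) d)).
    unfold Rpower; auto_derive; lra.
  - rewrite Rmin_left, Rmax_right in Hc by lra.
    replace ((1 - d * 0) * Rpower (1 + 0) d) with 1 in E
      by (rewrite Rplus_0_r; unfold Rpower; rewrite ln_1, !Rmult_0_r, exp_0; ring).
    rewrite E, Rminus_0_r, !Rabs_mult, Rabs_Ropp, (Rabs_pos_eq c), (Rabs_pos_eq x) by lra.
    rewrite (Rabs_pos_eq (Rpower _ _)) by (left; apply Rpower_pos).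
    assert (Hexp : Rpower (1 + c) (d - 1) <= exp (Rabs (d - 1))).
    { unfold Rpower; apply exp_le_mono.
      eapply Rle_trans; [apply Rle_abs|].
      rewrite Rabs_mult; rewrite <- (Rmult_1_r (Rabs (d - 1))) at 2.
        apply Rmult_le_compat_l; [apply Rabs_pos|].
      assert (0 <= ln (1 + c)) by (rewrite <- ln_1; apply ln_le; lra).
      rewrite Rabs_pos_eq by assumption.
      assert (ln (1 + c) <= c); [|lra].
      rewrite <- (ln_exp c) at 2; apply ln_le; [lra|apply exp_ineq1_le]. }
    pose proof (Rpower_pos (1 + c) (d - 1)).
    rewrite <- Rabs_mult.
    replace (Rabs (d * (1 + d)) * exp (Rabs (d - 1)) * x ^ 2)
      with (Rabs (d * (1 + d)) * (x * exp (Rabs (d - 1))) * x) by ring.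
    apply Rmult_le_compat_r; [lra|].
    rewrite Rmult_assoc; apply Rmult_le_compat_l; [apply Rabs_pos|].
    apply Rmult_le_compat; lra.
Qed.

(** Relative increments of order [n^(-2)] are summable: the sequence is bounded and Cauchy, and the
    sum of the remaining increments gives the rate [1/n]. *)
Lemma slow_seq_limit (a : nat -> R) (K : R) : 0 <= K ->
  (forall n, (1 <= n)%nat -> Rabs (a (S n) - a n) <= K * (/ INR n) ^ 2 * Rabs (a n)) ->
  exists l B, forall n, (1 <= n)%nat -> Rabs (a n) <= B /\ Rabs (a n - l) <= B / INR n.
Proof.
  intros HK Ha.
  (* Comparison with a telescoping difference replaces the infinite sum of inverse squares. *)
  assert (Hinv : forall n, (1 <= n)%nat -> (/ INR n) ^ 2 <= 2 * (/ INR n - / INR (S n))).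
  { intros n Hn; pose proof (INR_gt0 n Hn) as Hp. assert (1 <= INR n) by (apply (le_INR 1); exact Hn).
    rewrite S_INR; apply (Rmult_le_reg_r (INR n ^ 2 * (INR n + 1)));
      [apply Rmult_lt_0_compat; [apply pow_lt|]; lra|].
    replace ((/ INR n) ^ 2 * (INR n ^ 2 * (INR n + 1))) with (INR n + 1) by (field; lra).
    replace (2 * (/ INR n - / (INR n + 1)) * (INR n ^ 2 * (INR n + 1))) with (2 * INR n)
      by (field; lra). lra. }
  set (B := Rabs (a 1%nat) * exp (2 * K)).
  (* A discrete Gronwall argument: the factor [exp (2K/n)] shrinks fast enough to make the product
     nonincreasing. *)
  assert (HB : forall n, (1 <= n)%nat -> Rabs (a n) * exp (2 * K * / INR n) <= B).
  { intros n Hn; induction Hn as [|n Hn IH].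
    - unfold B; simpl INR; rewrite Rinv_1, Rmult_1_r; lra.
    - eapply Rle_trans; [|exact IH].
      specialize (Ha n Hn); specialize (Hinv n Hn).
      assert (H1 : Rabs (a (S n)) <= exp (K * (/ INR n) ^ 2) * Rabs (a n)).
      { eapply Rle_trans with ((1 + K * (/ INR n) ^ 2) * Rabs (a n)).
        - replace (a (S n)) with (a n + (a (S n) - a n)) by ring.
          eapply Rle_trans; [apply Rabs_triang|]; lra.
        - apply Rmult_le_compat_r; [apply Rabs_pos|apply exp_ineq1_le]. }
      eapply Rle_trans.
      + apply Rmult_le_compat_r; [left; apply exp_pos|exact H1].
      + rewrite (Rmult_comm (exp _)), Rmult_assoc, <- exp_plus.
        apply Rmult_le_compat_l; [apply Rabs_pos|]. apply exp_le_mono.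
        apply (Rmult_le_compat_l K) in Hinv; lra. }
  assert (HB' : forall n, (1 <= n)%nat -> Rabs (a n) <= B).
  { intros n Hn; eapply Rle_trans; [|apply HB; exact Hn].
    rewrite <- (Rmult_1_r (Rabs (a n))) at 1.
    apply Rmult_le_compat_l; [apply Rabs_pos|].
    rewrite <- exp_0; apply exp_le_mono.
    pose proof (Rinv_0_lt_compat _ (INR_gt0 n Hn)).
    apply Rmult_le_pos; lra. }
  assert (HB0 : 0 <= B) by (eapply Rle_trans; [apply Rabs_pos|apply (HB' 1%nat); lia]).
  assert (Hd : forall n k, (1 <= n)%nat ->
            Rabs (a (n + k)%nat - a n) <= 2 * K * B * (/ INR n - / INR (n + k))).
  { intros n k Hn; induction k as [|k IH].
    - rewrite Nat.add_0_r; unfold Rminus; rewrite !Rplus_opp_r, Rabs_R0; lra.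
    - replace (n + S k)%nat with (S (n + k)) by lia.
      replace (a (S (n + k)) - a n) with
        ((a (S (n + k)) - a (n + k)%nat) + (a (n + k)%nat - a n)) by ring.
      eapply Rle_trans; [apply Rabs_triang|].
      specialize (Ha (n + k)%nat ltac:(lia)); specialize (Hinv (n + k)%nat ltac:(lia)).
      specialize (HB' (n + k)%nat ltac:(lia)).
      assert (K * (/ INR (n + k)) ^ 2 * Rabs (a (n + k)%nat)
              <= K * (2 * (/ INR (n + k) - / INR (S (n + k)))) * B).
      { apply Rmult_le_compat; [|apply Rabs_pos| |exact HB'].
        - apply Rmult_le_pos; [exact HK|apply pow2_ge_0].
        - apply Rmult_le_compat_l; assumption. }
      lra. }
  assert (Hd' : forall n m, (1 <= n)%nat -> (n <= m)%nat ->
            Rabs (a m - a n) <= 2 * K * B / INR n).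
  { intros n m Hn Hm; replace m with (n + (m - n))%nat by lia.
    eapply Rle_trans; [apply Hd; exact Hn|].
    unfold Rdiv; apply Rmult_le_compat_l.
    - apply Rmult_le_pos; [lra|exact HB0].
    - pose proof (Rinv_0_lt_compat _ (INR_gt0 (n + (m - n)) ltac:(lia))); lra. }
  assert (HC : Cauchy_crit a).
  { intros eps Heps.
    destruct (archimed_cor1 (eps / (4 * K * B + 1))) as [N [HN1 HN2]].
    { apply Rdiv_lt_0_compat; [exact Heps|]. assert (0 <= K * B) by (apply Rmult_le_pos; auto). lra. }
    assert (HN : 2 * K * B / INR N < eps / 2).
    { assert (HKB : 0 <= K * B) by (apply Rmult_le_pos; auto).
      unfold Rdiv at 1. apply Rle_lt_trans with ((2 * K * B) * (eps / (4 * K * B + 1))).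
      - apply Rmult_le_compat_l; lra.
      - apply (Rmult_lt_reg_r (4 * K * B + 1)); [lra|].
        replace (2 * K * B * (eps / (4 * K * B + 1)) * (4 * K * B + 1))
          with (2 * K * B * eps) by (field; lra).
        replace (eps / 2 * (4 * K * B + 1)) with (2 * K * B * eps + eps / 2) by field. lra. }
    exists N; intros n m Hn Hm; unfold R_dist.
    replace (a n - a m) with ((a n - a N) - (a m - a N)) by ring.
    eapply Rle_lt_trans; [apply Rabs_triang|]. rewrite Rabs_Ropp.
    pose proof (Hd' N n ltac:(lia) ltac:(lia)); pose proof (Hd' N m ltac:(lia) ltac:(lia)).
    lra. }
  destruct (Rcomplete.R_complete a HC) as [l Hl].
  exists l, (B + 2 * K * B); intros n Hn.
  assert (HKB : 0 <= K * B) by (apply Rmult_le_pos; auto).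
  split; [specialize (HB' n Hn); lra|].
  apply le_epsilon; intros eps Heps.
  destruct (Hl eps Heps) as [N HN].
  specialize (HN (N + n)%nat ltac:(lia)); unfold R_dist in HN.
  specialize (Hd' n (N + n)%nat Hn ltac:(lia)).
  replace (a n - l) with ((a (N + n)%nat - l) - (a (N + n)%nat - a n)) by ring.
  eapply Rle_trans; [apply Rabs_triang|]; rewrite Rabs_Ropp.
  assert (0 <= B / INR n) by (apply Rdiv_le_0_compat; [exact HB0|apply INR_gt0; exact Hn]).
  unfold Rdiv in *; lra.
Qed.

Lemma pw_scaled_step (d : R) (n : nat) : (1 <= n)%nat ->
  pw d (S n) * Rpower (INR (S n)) (1 + d) =
  pw d n * Rpower (INR n) (1 + d) * ((1 - d * / INR n) * Rpower (1 + / INR n) d).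
Proof.
  intros Hn; pose proof (INR_gt0 n Hn) as Hp.
  pose proof (Rinv_0_lt_compat _ Hp).
  replace (INR (S n)) with (INR n * (1 + / INR n)) at 1 by (rewrite S_INR; field; lra).
  rewrite <- Rpower_mult_distr by lra.
  replace (Rpower (1 + / INR n) (1 + d)) with ((1 + / INR n) * Rpower (1 + / INR n) d)
    by (rewrite Rpower_plus, Rpower_1; lra).
  cbn [pw]; rewrite S_INR; field; split; lra.
Qed.

Lemma pw_scaled_limit (d : R) : exists l B, forall n, (1 <= n)%nat ->
  Rabs (pw d n * Rpower (INR n) (1 + d)) <= B /\
  Rabs (pw d n * Rpower (INR n) (1 + d) - l) <= B / INR n.
Proof.
  destruct (pw_ratio d) as [K [HK HR]].
  apply (slow_seq_limit (fun n => pw d n * Rpower (INR n) (1 + d)) K HK).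
  intros n Hn; rewrite pw_scaled_step by exact Hn.
  set (a := pw d n * Rpower (INR n) (1 + d)).
  set (r := (1 - d * / INR n) * Rpower (1 + / INR n) d).
  replace (a * r - a) with ((r - 1) * a) by ring.
  rewrite Rabs_mult; apply Rmult_le_compat_r; [apply Rabs_pos|].
  apply HR; split; [left; apply Rinv_0_lt_compat, INR_gt0; exact Hn|].
  rewrite <- Rinv_1; apply Rinv_le_contravar; [lra|apply (le_INR 1); exact Hn].
Qed.

Lemma Rpower_neg_half (x y s : R) : 0 <= s -> 0 < y -> y / 2 <= x ->
  Rpower x (- s) <= Rpower 2 s * Rpower y (- s).
Proof.
  intros Hs Hy Hx.
  rewrite !Rpower_Ropp.
  assert (H : Rpower (y / 2) s <= Rpower x s) by (apply Rle_Rpower_l; lra).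
  unfold Rdiv in H; rewrite <- Rpower_mult_distr in H by lra.
  rewrite <- (Rinv_inv (Rpower 2 s)).
  rewrite <- Rinv_mult.
  replace (Rpower (/ 2) s) with (/ Rpower 2 s) in H.
  - apply Rinv_le_contravar; [|rewrite Rmult_comm; exact H].
    apply Rmult_lt_0_compat; [apply Rinv_0_lt_compat|]; apply Rpower_pos.
  - unfold Rpower; rewrite ln_Rinv by lra.
    rewrite <- exp_Ropp; f_equal; ring.
Qed.

Lemma pw_bound (d : R) : -1 <= d -> exists C, 0 <= C /\ forall n,
  Rabs (pw d n) <= C * Rpower (INR (S n)) (- (1 + d)).
Proof.
  intros Hd; destruct (pw_scaled_limit d) as [l [B HB]].
  assert (HB0 : 0 <= B)
    by (eapply Rle_trans; [apply Rabs_pos|apply (HB 1%nat); lia]).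
  (* The summand 1 covers [n = 0]; the power of 2 pays for the base [n + 1] in place of [n]. *)
  exists (1 + B * Rpower 2 (1 + d)).
  assert (H2 : 0 <= B * Rpower 2 (1 + d))
    by (apply Rmult_le_pos; [exact HB0|left; apply Rpower_pos]).
  split; [lra|]; intros [|n].
  - simpl pw; simpl INR; rewrite Rabs_R1, Rpower_base1; lra.
  - destruct (HB (S n) ltac:(lia)) as [H _].
    pose proof (Rpower_pos (INR (S n)) (1 + d)) as Hp.
    rewrite Rabs_mult, (Rabs_pos_eq (Rpower _ _)) in H by lra.
    apply Rle_trans with (B * Rpower (INR (S n)) (- (1 + d))).
    + rewrite Rpower_Ropp; apply (Rmult_le_reg_r (Rpower (INR (S n)) (1 + d))); [exact Hp|].
      rewrite Rmult_assoc, Rinv_l; lra.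
    + apply Rle_trans with (B * (Rpower 2 (1 + d) * Rpower (INR (S (S n))) (- (1 + d)))).
      * apply Rmult_le_compat_l; [exact HB0|].
        apply Rpower_neg_half; [lra|apply INR_gt0; lia|].
        rewrite (S_INR (S n)). assert (1 <= INR (S n)) by (apply (le_INR 1); lia). lra.
      * rewrite <- Rmult_assoc; apply Rmult_le_compat_r; [left; apply Rpower_pos|lra].
Qed.

(** * Gauss's limit for Gamma and the coefficients of [(1-z)^(-x)] *)

Lemma rising_pw (x : R) (n : nat) :
  fold_right Rmult 1 (map (fun i => x + INR i) (seq 0 n)) = INR (fact n) * pw (- x) n.
Proof.
  assert (E : forall l b, fold_right Rmult b l = fold_right Rmult 1 l * b).
  { induction l as [|a l IH]; intros b; simpl; [ring|rewrite IH; ring]. }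
  induction n as [|n IH]; [simpl; ring|].
  rewrite seq_S, map_app, fold_right_app, E, IH, fact_simpl, mult_INR.
  cbn [map fold_right pw Nat.add].
  pose proof (INR_S_neq0 n); generalize dependent (INR (S n)); intros; field; assumption.
Qed.

Lemma pw_neg_pos (x : R) (n : nat) : 0 < x -> 0 < pw (- x) n.
Proof.
  intros Hx; induction n as [|n IH]; [simpl; lra|]; cbn [pw].
  apply Rmult_lt_0_compat; [exact IH|]. apply Rdiv_lt_0_compat.
  - pose proof (pos_INR n); lra.
  - apply INR_gt0; lia.
Qed.

Lemma Gamma_seq_pw (x : R) (n : nat) : 0 < x -> (1 <= n)%nat ->
  Gamma_seq x n = INR n / (INR n + x) * / (pw (- x) n * Rpower (INR n) (1 + - x)).
Proof.
  intros Hx Hn; unfold Gamma_seq; rewrite rising_pw, fact_simpl, mult_INR.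
  pose proof (INR_gt0 n Hn) as Hp.
  replace (Rpower (INR n) (1 + - x)) with (INR n / Rpower (INR n) x).
  - cbn [pw]. pose proof (INR_S_neq0 n); pose proof (INR_fact_neq_0 n).
    pose proof (pw_neg_pos x n Hx); pose proof (Rpower_pos (INR n) x).
    generalize dependent (INR (S n)); intros.
    field; repeat split; lra.
  - rewrite Rpower_plus, Rpower_1, Rpower_Ropp by exact Hp; reflexivity.
Qed.

(** By Gauss's formula [Gamma_seq] is, up to a factor tending to 1, the inverse of the scaled
    coefficient [a n], so [a] tends to [1/Gamma x] as soon as its limit is nonzero. The index
    [n - 1] is the one at which networks of size [n] are read off. *)
Lemma Gamma_pw (x : R) : 0 < x < 1 ->
  0 < Gamma x /\
  exists B, forall n, (1 <= n)%nat ->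
    Rabs (pw (- x) (n - 1)%nat - Rpower (INR n) (x - 1) / Gamma x)
    <= B * Rpower (INR n) (x - 2).
Proof.
  intros Hx; destruct (pw_scaled_limit (- x)) as [l [B HB]].
  set (a := fun n => pw (- x) n * Rpower (INR n) (1 + - x)) in *.
  (* The sequence starts at [a 1 = x] and increases by Bernoulli's inequality [(1+t)^x <= 1 + x t];
     this keeps its limit away from 0. *)
  assert (Hmono : forall n, (1 <= n)%nat -> x <= a n).
  { intros n Hn; induction Hn as [|n Hn IH].
    - unfold a; simpl; rewrite Rpower_base1; lra.
    - eapply Rle_trans; [exact IH|]. unfold a; rewrite (pw_scaled_step (- x) n Hn).
      fold (a n). rewrite <- (Rmult_1_r (a n)) at 1.
      apply Rmult_le_compat_l; [lra|].
      set (t := / INR n). assert (Ht : 0 < t) by (apply Rinv_0_lt_compat, INR_gt0; exact Hn).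
      assert (Hb : Rpower (1 + t) x <= 1 + x * t).
      { destruct (MVT_gen (fun t => 1 + x * t - Rpower (1 + t) x) 0 t
          (fun t => x - x * Rpower (1 + t) (x - 1))) as [c [Hc E]].
        - rewrite Rmin_left, Rmax_right by lra; intros u Hu.
          unfold Rpower; auto_derive; [lra|].
          replace ((x - 1) * ln (1 + u)) with (x * ln (1 + u) + - ln (1 + u)) by ring.
          rewrite exp_plus, exp_Ropp, exp_ln by lra; field; lra.
        - rewrite Rmin_left, Rmax_right by lra; intros u Hu.
          apply continuity_pt_filterlim.
          apply (ex_derive_continuous (fun t => 1 + x * t - Rpower (1 + t) x)).
          unfold Rpower; auto_derive; lra.
        - rewrite Rmin_left, Rmax_right in Hc by lra.
          replace (1 + x * 0 - Rpower (1 + 0) x) with 0 in E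
            by (rewrite Rplus_0_r; unfold Rpower; rewrite ln_1, !Rmult_0_r, exp_0; ring).
          assert (Rpower (1 + c) (x - 1) <= 1).
          { assert (H : Rpower (1 + c) (x - 1) <= Rpower (1 + c) 0) by (apply Rle_Rpower; lra).
            rewrite Rpower_O in H by lra; exact H. }
          assert (0 <= x * (1 - Rpower (1 + c) (x - 1)) * t)
            by (apply Rmult_le_pos; [apply Rmult_le_pos|]; lra).
          lra. }
      rewrite Rpower_Ropp.
      apply (Rmult_le_reg_r (Rpower (1 + t) x)); [apply Rpower_pos|].
      rewrite Rmult_assoc, Rinv_l by (apply Rgt_not_eq, Rpower_pos). lra. }
  assert (Hcv : Un_cv a l).
  { intros eps Heps. destruct (archimed_cor1 (eps / (Rabs B + 1))) as [N [HN1 HN2]].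
    { apply Rdiv_lt_0_compat; [exact Heps|]. pose proof (Rabs_pos B); lra. }
    exists N; intros n Hn; unfold R_dist.
    destruct (HB n ltac:(lia)) as [_ H]; eapply Rle_lt_trans; [exact H|].
    assert (HBp : 0 < Rabs B + 1) by (pose proof (Rabs_pos B); lra).
    apply Rle_lt_trans with ((Rabs B + 1) * / INR N).
    - unfold Rdiv; apply Rmult_le_compat.
      + eapply Rle_trans; [apply Rabs_pos|]. apply (HB n ltac:(lia)).
      + left; apply Rinv_0_lt_compat, INR_gt0; lia.
      + pose proof (Rle_abs B); lra.
      + apply Rinv_le_contravar; [apply INR_gt0; lia|apply le_INR; lia].
    - apply (Rmult_lt_compat_l (Rabs B + 1)) in HN1; [|exact HBp].
      replace ((Rabs B + 1) * (eps / (Rabs B + 1))) with eps in HN1 by (field; lra).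
      exact HN1. }
  assert (Hl : x <= l).
  { apply le_epsilon; intros eps Heps. destruct (Hcv eps Heps) as [N HN].
    specialize (HN (S N) ltac:(lia)); unfold R_dist in HN; apply Rabs_def2 in HN.
    specialize (Hmono (S N) ltac:(lia)); lra. }
  assert (Hratio : is_lim_seq (fun n => INR n / (INR n + x)) 1).
  { apply is_lim_seq_ext with (fun n => 1 - x * / (INR n + x)).
    - intros n; pose proof (pos_INR n); field; lra.
    - replace (Finite 1) with (Rbar_minus 1 (Rbar_mult x 0)) by (simpl; f_equal; ring).
      apply is_lim_seq_minus'; [apply is_lim_seq_const|].
      simpl; rewrite Rmult_0_r. replace 0 with (x * 0) by ring.
      apply (is_lim_seq_scal_l _ x 0).
      replace (Finite 0) with (Rbar_inv p_infty) by reflexivity.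
      apply is_lim_seq_inv; [|discriminate].
      apply is_lim_seq_plus with (l1 := p_infty) (l2 := x);
        [apply is_lim_seq_INR|apply is_lim_seq_const|reflexivity]. }
  assert (HG : Un_cv (Gamma_seq x) (/ l)).
  { apply is_lim_seq_Reals.
    apply is_lim_seq_ext_loc with (fun n => INR n / (INR n + x) * / a n).
    - exists 1%nat; intros n Hn; rewrite Gamma_seq_pw by (lra || exact Hn); reflexivity.
    - replace (Finite (/ l)) with (Finite (1 * / l)) by (f_equal; ring).
      apply is_lim_seq_mult'; [exact Hratio|].
      apply (is_lim_seq_inv a l); [apply is_lim_seq_Reals; exact Hcv|].
      intros E; inversion E; lra. }
  assert (HGam : Gamma x = / l).
  { apply (UL_sequence (Gamma_seq x)); [|exact HG].
    unfold Gamma; apply epsilon_spec; exists (/ l); exact HG. }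
  rewrite HGam; split; [apply Rinv_0_lt_compat; lra|].
  (* [B] comes from the convergence rate of [a], [B/x] from passing between the indices [n] and
     [n - 1]. *)
  exists (B + B / x); intros n Hn. pose proof (INR_gt0 n Hn) as Hp.
  destruct (HB n Hn) as [H1 H2]. fold (a n) in H1, H2.
  assert (Ea : pw (- x) n = a n * Rpower (INR n) (x - 1)).
  { unfold a; rewrite Rmult_assoc, <- Rpower_plus.
    replace (1 + - x + (x - 1)) with 0 by ring. rewrite Rpower_O by exact Hp; ring. }
  assert (Ep : pw (- x) n = pw (- x) (n - 1)%nat * ((INR n - 1 + x) / INR n)).
  { destruct n as [|n]; [lia|]. replace (S n - 1)%nat with n by lia.
    cbn [pw]; rewrite S_INR in *; f_equal; f_equal; ring. }
  assert (E2 : Rpower (INR n) (x - 2) = Rpower (INR n) (x - 1) / INR n).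
  { replace (x - 2) with (x - 1 + - (1)) by ring.
    rewrite Rpower_plus, Rpower_Ropp, Rpower_1 by exact Hp; reflexivity. }
  replace (Rpower (INR n) (x - 1) / / l) with (l * Rpower (INR n) (x - 1))
    by (field; lra).
  replace (pw (- x) (n - 1)%nat - l * Rpower (INR n) (x - 1)) with
    ((a n - l) * Rpower (INR n) (x - 1) + (pw (- x) (n - 1)%nat - pw (- x) n))
    by (rewrite Ea; ring).
  pose proof (Rpower_pos (INR n) (x - 1)) as Hrp.
  eapply Rle_trans; [apply Rabs_triang|]. rewrite Rmult_plus_distr_r.
  apply Rplus_le_compat.
  - rewrite Rabs_mult, (Rabs_pos_eq (Rpower _ _)), E2 by lra.
    replace (B * (Rpower (INR n) (x - 1) / INR n)) with (B / INR n * Rpower (INR n) (x - 1))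
      by (field; lra).
    apply Rmult_le_compat_r; lra.
  - replace (pw (- x) (n - 1)%nat - pw (- x) n) with (a n * Rpower (INR n) (x - 1) * ((1 - x) / (INR n - 1 + x))).
    + assert (Hn1 : 1 <= INR n) by (apply (le_INR 1); exact Hn).
      assert (Hq : 0 <= (1 - x) / (INR n - 1 + x) <= / x * / INR n).
      { split; [apply Rdiv_le_0_compat; lra|].
        rewrite <- Rinv_mult. apply Rle_trans with (1 * / (INR n - 1 + x)).
        - apply Rmult_le_compat_r; [left; apply Rinv_0_lt_compat|]; lra.
        - rewrite Rmult_1_l; apply Rinv_le_contravar; [apply Rmult_lt_0_compat; lra|].
          assert (x * (INR n - 1) <= 1 * (INR n - 1)) by (apply Rmult_le_compat_r; lra).
          lra. }
      specialize (Hmono n Hn). rewrite (Rabs_pos_eq (a n)) in H1 by lra.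
      rewrite Rabs_pos_eq.
      * rewrite E2.
        replace (B / x * (Rpower (INR n) (x - 1) / INR n))
          with (B * Rpower (INR n) (x - 1) * (/ x * / INR n)) by (field; lra).
        apply Rmult_le_compat; [|apply Hq| |apply Hq].
        -- apply Rmult_le_pos; lra.
        -- apply Rmult_le_compat_r; lra.
      * apply Rmult_le_pos; [apply Rmult_le_pos; lra|apply Hq].
    + rewrite <- Ea, Ep. assert (Hn1 : 1 <= INR n) by (apply (le_INR 1); exact Hn).
      field; lra.
Qed.

(** * Kaluza's theorem *)

Section Kaluza.
Variables d u : fps.
Hypothesis Hd0 : d 0%nat = 1.
Hypothesis Hdpos : forall n, 0 < d n.
Hypothesis Hlc : forall n, d (S n) * d (S n) <= d n * d (S (S n)).
Hypothesis Hud : fmul u d = fconst 1.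

Lemma kaluza_u0 : u 0%nat = 1.
Proof.
  assert (E := f_equal (fun f : fps => f 0%nat) Hud); cbv beta in E.
  rewrite fmul_at0, Hd0 in E; simpl in E; lra.
Qed.

(** The identity [u d = 1] read as a renewal equation for [d] with weights [-u (S k)]. *)
Lemma kaluza_renewal (n : nat) : d (S n) = fmul (fun k => - u (S k)) d n.
Proof.
  assert (E := f_equal (fun f : fps => f (S n)) Hud); cbv beta in E.
  rewrite fmul_S, kaluza_u0 in E; simpl fconst in E.
  transitivity (-1 * fmul (fun k => u (S k)) d n); [lra|].
  rewrite <- fmul_scal_l; apply fmul_ext_le; intros; [ring|reflexivity].
Qed.

Lemma kaluza_ratio (m n : nat) : (m <= n)%nat -> d (S m) / d m <= d (S n) / d n.
Proof.
  intros H; induction H as [|n H IH]; [lra|].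
  eapply Rle_trans; [exact IH|].
  pose proof (Hdpos n); pose proof (Hdpos (S n)); pose proof (Hlc n).
  apply (Rmult_le_reg_r (d n * d (S n))); [apply Rmult_lt_0_compat; assumption|].
  replace (d (S n) / d n * (d n * d (S n))) with (d (S n) * d (S n)) by (field; lra).
  replace (d (S (S n)) / d (S n) * (d n * d (S n))) with (d n * d (S (S n))) by (field; lra).
  assumption.
Qed.

(** Multiply the renewal equation for [d (S n)] by [r = d (S (S n)) / d (S n)]. By log-convexity [r]
    dominates all earlier ratios, so each term of the result is at least the matching term in the
    equation for [d (S (S n))]; the deficit is the new weight. *)
Lemma kaluza_nonneg (n : nat) : 0 <= - u (S n).
Proof.
  induction n as [n IH] using (well_founded_induction Wf_nat.lt_wf).
  destruct n as [|n].
  - pose proof (kaluza_renewal 0) as E; rewrite fmul_at0, Hd0 in E.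
    pose proof (Hdpos 1); lra.
  - pose proof (kaluza_renewal (S n)) as E1; pose proof (kaluza_renewal n) as E0.
    unfold fmul in E1, E0.
    change (d (S (S n)) = sumR (S n) (fun i => - u (S i) * d (S n - i)%nat)
                          + - u (S (S n)) * d (S n - S n)%nat) in E1.
    rewrite Nat.sub_diag, Hd0 in E1.
    set (r := d (S (S n)) / d (S n)).
    pose proof (Hdpos (S n)) as Hp.
    assert (Er : d (S (S n)) = r * d (S n)) by (unfold r; field; lra).
    rewrite E0, <- sumR_scal in Er.
    assert (sumR (S n) (fun i => - u (S i) * d (S n - i)%nat)
            <= sumR (S n) (fun i => r * (- u (S i) * d (n - i)%nat))); [|lra].
    apply sumR_le; intros i Hi.
    replace (r * (- u (S i) * d (n - i)%nat)) with (- u (S i) * (r * d (n - i)%nat)) by ring.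
    apply Rmult_le_compat_l; [apply IH; exact Hi|].
    replace (S n - i)%nat with (S (n - i)) by lia.
    pose proof (Hdpos (n - i)%nat) as Hq.
    apply (Rmult_le_reg_r (/ d (n - i)%nat)); [apply Rinv_0_lt_compat; exact Hq|].
    rewrite Rmult_assoc, Rinv_r, Rmult_1_r by lra.
    apply kaluza_ratio; lia.
Qed.

Lemma kaluza_le (n : nat) : - u (S n) <= d (S n).
Proof.
  rewrite kaluza_renewal; unfold fmul; simpl sumR.
  rewrite Nat.sub_diag, Hd0.
  assert (0 <= sumR n (fun i => - u (S i) * d (n - i)%nat)); [|lra].
  apply sumR_pos; intros i _; apply Rmult_le_pos; [apply kaluza_nonneg|left; apply Hdpos].
Qed.
End Kaluza.

(** * Geometrically weighted tails *)

Section Tail.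
Variable z : R.
Hypothesis Hz : 0 < z < 1.

(** The coefficients, as a series in [x], of [(a(z) - a(x)) / (1 - x/z)]. *)
Definition tail (a : fps) : fps :=
  fun n => Series (fun j => a (n + S j)%nat * z ^ S j).

Lemma pow_S_pos (j : nat) : 0 < z ^ S j.
Proof. apply pow_lt; lra. Qed.

Lemma is_series_pow_S : is_series (fun j => z ^ S j) (z / (1 - z)).
Proof.
  apply (is_series_scal_l z (fun j => z ^ j) (/ (1 - z))).
  apply is_series_geom; rewrite Rabs_pos_eq; lra.
Qed.

Lemma ex_tail (a : fps) (n : nat) :
  fbounded a -> ex_series (fun j => a (n + S j)%nat * z ^ S j).
Proof.
  intros [B HB].
  apply (@ex_series_le R_AbsRing R_CompleteNormedModule _ (fun j => B * z ^ S j)).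
  - intros j. change (Rabs (a (n + S j)%nat * z ^ S j) <= B * z ^ S j).
    rewrite Rabs_mult, (Rabs_pos_eq (z ^ _)) by (left; apply pow_S_pos).
    apply Rmult_le_compat_r; [left; apply pow_S_pos|apply HB].
  - exists (B * (z / (1 - z))).
    apply (is_series_scal_l B (fun j => z ^ S j)), is_series_pow_S.
Qed.

Lemma tail_rec (a : fps) (n : nat) :
  fbounded a -> tail a n = z * (a (S n) + tail a (S n)).
Proof.
  intros Ha; unfold tail; rewrite Series_incr_1 by (apply ex_tail; exact Ha).
  rewrite Rmult_plus_distr_l, <- Series_scal_l; f_equal.
  - rewrite Nat.add_1_r; simpl; ring.
  - apply Series_ext; intros j. replace (n + S (S j))%nat with (S n + S j)%nat by lia.
    simpl; ring.
Qed.

Lemma PSeries_tail0 (a : fps) : fbounded a -> PSeries a z = a 0%nat + tail a 0%nat.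
Proof.
  intros Ha; unfold PSeries; rewrite Series_incr_1.
  - simpl; rewrite Rmult_1_r; reflexivity.
  - apply ex_series_incr_1. exact (ex_tail a 0 Ha).
Qed.

Lemma tail_le (a b : fps) (n : nat) : fbounded a -> fbounded b ->
  (forall j, a (n + S j)%nat <= b (n + S j)%nat) -> tail a n <= tail b n.
Proof.
  intros Ha Hb H.
  assert (H0 : 0 <= tail b n - tail a n); [|lra].
  unfold tail; rewrite <- Series_minus by (apply ex_tail; assumption).
  rewrite <- (Rmult_0_l (Series (fun j => z ^ S j))), <- Series_scal_l.
  apply Series_le.
  - intros j; pose proof (pow_S_pos j); specialize (H j); split; [lra|].
    rewrite Rmult_0_l, <- Rmult_minus_distr_r.
    apply Rmult_le_pos; lra.
  - apply (@ex_series_minus R_AbsRing R_NormedModule); apply ex_tail; assumption.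
Qed.

Lemma tail_const (c : R) (n : nat) : tail (fun _ => c) n = c * (z / (1 - z)).
Proof.
  unfold tail; rewrite Series_scal_l; f_equal; apply is_series_unique, is_series_pow_S.
Qed.

Lemma fbounded_const (c : R) : fbounded (fun _ => c).
Proof. exists (Rabs c); intros; lra. Qed.

Lemma fbounded_plus (a b : fps) : fbounded a -> fbounded b -> fbounded (fun n => a n + b n).
Proof.
  intros [A HA] [B HB]; exists (A + B); intros n.
  eapply Rle_trans; [apply Rabs_triang|]; specialize (HA n); specialize (HB n); lra.
Qed.

Lemma fbounded_scal (c : R) (a : fps) : fbounded a -> fbounded (fun n => c * a n).
Proof.
  intros [A HA]; exists (Rabs c * A); intros n; rewrite Rabs_mult.
  apply Rmult_le_compat_l; [apply Rabs_pos|apply HA].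
Qed.

Lemma fbounded_shift (a : fps) : fbounded a -> fbounded (fun n => a (S n)).
Proof. intros [A HA]; exists A; intros n; apply HA. Qed.

Lemma tail_plus (a b : fps) (n : nat) : fbounded a -> fbounded b ->
  tail (fun k => a k + b k) n = tail a n + tail b n.
Proof.
  intros Ha Hb; unfold tail; rewrite <- Series_plus by (apply ex_tail; assumption).
  apply Series_ext; intros j; ring.
Qed.

Lemma tail_scal (c : R) (a : fps) (n : nat) : tail (fun k => c * a k) n = c * tail a n.
Proof.
  unfold tail; rewrite <- Series_scal_l; apply Series_ext; intros j; ring.
Qed.

Lemma tail_shift (a : fps) (n : nat) : tail (fun k => a (S k)) n = tail a (S n).
Proof. reflexivity. Qed.

Lemma tail_ext_bounds (a : fps) (n : nat) (lo hi : R) : fbounded a ->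
  (forall j, lo <= a (n + S j)%nat <= hi) ->
  lo * (z / (1 - z)) <= tail a n <= hi * (z / (1 - z)).
Proof.
  intros Ha H; rewrite <- !(tail_const _ n).
  split; apply tail_le; auto using fbounded_const; apply H.
Qed.

Lemma tail_abs (a : fps) (n : nat) (M : R) : fbounded a ->
  (forall j, Rabs (a (n + S j)%nat) <= M) -> Rabs (tail a n) <= M * (z / (1 - z)).
Proof.
  intros Ha H.
  assert (forall j, - M <= a (n + S j)%nat <= M) by (intros j; apply Rabs_le_between, H).
  destruct (tail_ext_bounds a n (- M) M Ha H0); apply Rabs_le; lra.
Qed.

Definition flin : fps := fun n => match n with O => 1 | 1%nat => - / z | _ => 0 end.

Lemma flin_S (a : fps) (n : nat) : fmul flin a (S n) = a (S n) - a n / z.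
Proof.
  rewrite fmul_S; simpl.
  rewrite (fmul_ext_le _ a (fconst (- / z)) a);
    [rewrite fmul_const; unfold Rdiv; ring|intros [|m] _; reflexivity|reflexivity].
Qed.

(* Dividing by [1 - x/z] produces the pole at [z] and a tail. *)
Lemma flin_solve (b w : fps) (n : nat) : fbounded w -> fmul flin b = w ->
  b n = (/ z) ^ n * PSeries w z - tail w n.
Proof.
  intros Hw E; induction n as [|n IH].
  - rewrite PSeries_tail0 by exact Hw.
    assert (E0 := f_equal (fun f : fps => f 0%nat) E); cbv beta in E0.
    rewrite fmul_at0 in E0; rewrite <- E0; simpl; ring.
  - assert (E1 := f_equal (fun f : fps => f (S n)) E); cbv beta in E1.
    rewrite flin_S, IH, (tail_rec w n Hw) in E1.
    replace (((/ z) ^ n * PSeries w z - z * (w (S n) + tail w (S n))) / z)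
      with ((/ z) ^ S n * PSeries w z - w (S n) - tail w (S n)) in E1 by (simpl; field; lra).
    lra.
Qed.

Lemma fbounded_flin : fbounded flin.
Proof.
  apply (fbounded_finite _ 2). intros [|[|n]] H; [lia|lia|reflexivity].
Qed.

Lemma PSeries_flin : PSeries flin z = 0.
Proof.
  rewrite PSeries_finite2; [simpl; field; lra|].
  intros [|[|n]] H; [lia|lia|reflexivity].
Qed.

Lemma CV_z (a : fps) : fbounded a -> Rbar_lt (Rabs z) (CV_radius a).
Proof. intros Ha; apply fbounded_CV; [exact Ha|rewrite Rabs_pos_eq; lra]. Qed.

(** * The reciprocal of [1 - h] when [h] has a log-convex coefficient sequence *)

Section Pole.
Variable h : fps.
Hypothesis Hh0 : h 0%nat = 0.
Hypothesis Hhpos : forall n, 0 < h (S n).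
Hypothesis Hhlc : forall n, h (S (S n)) * h (S (S n)) <= h (S n) * h (S (S (S n))).
Hypothesis Hhb : fbounded h.
Hypothesis Hhz : PSeries h z = 1.

Let d := tail h.
(** The series [1/d]; the geometric series is meaningful because [d 0 = h(z) - h 0 = 1]. *)
Definition pole_free : fps := fgeo (fsub (fconst 1) d).
Let u := pole_free.

Lemma tail_h_pos (n : nat) : 0 < d n.
Proof.
  unfold d; rewrite tail_rec by exact Hhb.
  apply Rmult_lt_0_compat; [lra|].
  pose proof (Hhpos n).
  assert (0 * (z / (1 - z)) <= tail h (S n)).
  { rewrite <- (tail_const 0 (S n)). apply tail_le; [apply fbounded_const|exact Hhb|].
    intros j; left; apply Hhpos. }
  lra.
Qed.

Lemma tail_h_0 : d 0%nat = 1.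
Proof. pose proof (PSeries_tail0 h Hhb); unfold d; lra. Qed.

(** Log-convexity of a positive sequence says that [t^2 h(m) - 2 t h(m+1) + h(m+2)] is nonnegative
    for all [t]. This is linear in [h], hence inherited by weighted sums; the choice
    [t = d (S n) / d n] turns it back into the inequality for [d]. *)
Lemma tail_h_log_convex (n : nat) : d (S n) * d (S n) <= d n * d (S (S n)).
Proof.
  assert (Q : forall t, 0 <= (t * t) * d n + (- 2 * t * d (S n) + d (S (S n)))).
  { intros t. unfold d. rewrite <- !tail_shift.
    rewrite <- (tail_scal (t * t)), <- (tail_scal (- 2 * t)).
    assert (Hb1 := fbounded_shift _ Hhb). assert (Hb2 := fbounded_shift _ Hb1).
    rewrite <- !tail_plus by auto using fbounded_plus, fbounded_scal.
    rewrite <- (Rmult_0_l (z / (1 - z))), <- (tail_const 0 n).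
    apply tail_le; auto using fbounded_plus, fbounded_scal, fbounded_const.
    intros j; replace (n + S j)%nat with (S (n + j)) by lia.
    set (m := (n + j)%nat). pose proof (Hhpos m) as Hm; pose proof (Hhlc m) as Hl.
    apply (Rmult_le_reg_l (h (S m))); [exact Hm|]. rewrite Rmult_0_r.
    replace (h (S m) * (t * t * h (S m) + (-2 * t * h (S (S m)) + h (S (S (S m))))))
      with ((h (S m) * t - h (S (S m))) ^ 2
            + (h (S m) * h (S (S (S m))) - h (S (S m)) * h (S (S m)))) by ring.
    pose proof (pow2_ge_0 (h (S m) * t - h (S (S m)))); lra. }
  pose proof (tail_h_pos n) as Hn.
  specialize (Q (d (S n) / d n)). apply (Rmult_le_compat_l (d n)) in Q; [|lra].
  replace (d n * (d (S n) / d n * (d (S n) / d n) * d n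
             + (-2 * (d (S n) / d n) * d (S n) + d (S (S n)))))
    with (d n * d (S (S n)) - d (S n) * d (S n)) in Q by (field; lra).
  lra.
Qed.

Lemma flin_tail_h : fmul flin d = fsub (fconst 1) h.
Proof.
  apply functional_extensionality; intros [|n]; unfold fsub.
  - rewrite fmul_at0, tail_h_0, Hh0; simpl; ring.
  - rewrite flin_S; unfold d; rewrite (tail_rec h n Hhb); simpl fconst; field; lra.
Qed.

Lemma pole_free_inv : fmul u d = fconst 1.
Proof.
  unfold u, pole_free. rewrite fmul_comm.
  rewrite <- (fgeo_inv (fsub (fconst 1) d)) at 2.
  - f_equal. ring.
  - unfold fsub; rewrite tail_h_0; simpl; ring.
Qed.

Lemma pole_free_0 : u 0%nat = 1.
Proof. apply fgeo_at0. Qed.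

Lemma pole_free_nonpos (n : nat) : 0 <= - u (S n) <= d (S n).
Proof.
  split.
  - apply (kaluza_nonneg d u); auto using tail_h_0, tail_h_pos, tail_h_log_convex, pole_free_inv.
  - apply (kaluza_le d u); auto using tail_h_0, tail_h_pos, tail_h_log_convex, pole_free_inv.
Qed.

Lemma flin_fgeo (a : fps) : fmul flin (fmul a (fgeo h)) = fmul a u.
Proof.
  transitivity (fmul (fmul a (fmul u d)) (fmul flin (fgeo h))); [rewrite pole_free_inv; ring|].
  transitivity (fmul (fmul a u) (fmul (fmul flin d) (fgeo h))); [ring|].
  rewrite flin_tail_h, fgeo_inv by exact Hh0; ring.
Qed.

Lemma fbounded_tail_h : fbounded d.
Proof.
  destruct Hhb as [B HB]; exists (B * (z / (1 - z))); intros n.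
  apply tail_abs; [exact Hhb|]; intros j; apply HB.
Qed.

Lemma fbounded_pole_free : fbounded u.
Proof.
  destruct fbounded_tail_h as [B HB]; exists (1 + B); intros [|n].
  - rewrite pole_free_0, Rabs_R1. pose proof (HB 0%nat); pose proof (Rabs_pos (d 0%nat)); lra.
  - destruct (pole_free_nonpos n) as [H1 H2]; specialize (HB (S n)).
    rewrite Rabs_left1 by lra. pose proof (Rle_abs (d (S n))); lra.
Qed.

(** Differentiating [(1 - x/z) d = 1 - h] at [x = z], where the linear factor vanishes, gives
    [d(z) = z h'(z)]; and [u(z) d(z) = 1]. This determines the constant of the pole. *)
Lemma PSeries_pole_free : PSeries u z * (z * PSeries (fder h) z) = 1.
Proof.
  assert (Hd : PSeries d z = z * PSeries (fder h) z).
  { assert (E := f_equal fder flin_tail_h).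
    rewrite fder_mul, fder_sub, fder_const in E.
    assert (E1 := f_equal (fun f => PSeries f z) E); cbv beta in E1.
    change (PSeries (PS_plus (fmul (fder flin) d) (fmul flin (fder d))) z
            = PSeries (PS_plus (fconst 0) (PS_opp (fder h))) z) in E1.
    assert (Cd := CV_z d fbounded_tail_h). assert (Cl := CV_z _ fbounded_flin).
    assert (Ch := CV_z h Hhb).
    assert (Cd' := CV_fder _ _ Cd). assert (Cl' := CV_fder _ _ Cl).
    assert (Ch' := CV_fder _ _ Ch).
    assert (X1 : ex_pseries (fmul (fder flin) d) z)
      by (rewrite fmul_PS_mult; apply ex_pseries_mult; assumption).
    assert (X2 : ex_pseries (fmul flin (fder d)) z)
      by (rewrite fmul_PS_mult; apply ex_pseries_mult; assumption).
    assert (X3 : ex_pseries (fder h) z)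
      by (apply CV_radius_inside; assumption).
    assert (F0 : fbounded (fconst 0)) by (apply (fbounded_finite _ 1); intros [|n] Hn; [lia|reflexivity]).
    rewrite !PSeries_plus, PSeries_opp, !PSeries_fmul, PSeries_flin in E1; auto.
    - rewrite (PSeries_finite2 (fconst 0)) in E1 by (intros [|n] Hn; [lia|reflexivity]).
      replace (fder flin) with (fconst (- / z)) in E1.
      + rewrite (PSeries_finite2 (fconst (- / z))) in E1 by (intros [|n] Hn; [lia|reflexivity]).
        simpl in E1.
        assert (E2 : - / z * PSeries d z = - PSeries (fder h) z) by lra.
        assert (E3 : PSeries d z = - z * (- / z * PSeries d z)) by (field; lra).
        rewrite E3, E2; ring.
      + apply functional_extensionality; intros [|[|n]]; unfold fder; simpl; ring.
    - apply CV_radius_inside, CV_z; exact F0.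
    - apply ex_pseries_opp; exact X3. }
  rewrite <- Hd, <- PSeries_fmul by (apply CV_z; (apply fbounded_pole_free || apply fbounded_tail_h)).
  rewrite pole_free_inv, PSeries_finite2; [simpl; ring|].
  intros [|n] Hn; [lia|reflexivity].
Qed.

Lemma pole_expansion (a : fps) (n : nat) : fbounded a -> fbounded (fmul a u) ->
  fmul a (fgeo h) n
  = (/ z) ^ n * (PSeries a z / (z * PSeries (fder h) z)) - tail (fmul a u) n.
Proof.
  intros Ha Hw; rewrite (flin_solve _ _ n Hw (flin_fgeo a)).
  rewrite PSeries_fmul by (apply CV_z; (exact Ha || apply fbounded_pole_free)).
  pose proof PSeries_pole_free as E.
  assert (z * PSeries (fder h) z <> 0) by (intros E0; rewrite E0 in E; lra).
  replace (PSeries u z) with (/ (z * PSeries (fder h) z)); [reflexivity|].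
  apply (Rmult_eq_reg_r (z * PSeries (fder h) z)); [|assumption].
  rewrite E, Rinv_l; auto.
Qed.
End Pole.
End Tail.

(** * Asymptotics for [p <> 1/2] *)

Lemma sum_Rpower_bounded (g : R) (n : nat) : 0 < g ->
  sumR n (fun k => Rpower (INR (S k)) (- (1 + g))) <= 1 + / g.
Proof.
  intros Hg; pose proof (Rinv_0_lt_compat g Hg) as Hig.
  (* Integral comparison; the bound is strengthened by the remaining integral [n^(-g)/g] so that the
     induction closes. *)
  assert (H : forall n, sumR (S n) (fun k => Rpower (INR (S k)) (- (1 + g)))
                        <= 1 + / g - / g * Rpower (INR (S n)) (- g)).
  { intros k; induction k as [|m IH].
    - cbn [sumR]; change (INR 1) with 1; rewrite !Rpower_base1; lra.
    - change (sumR (S m) (fun k => Rpower (INR (S k)) (- (1 + g)))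
        + Rpower (INR (S (S m))) (- (1 + g)) <= 1 + / g - / g * Rpower (INR (S (S m))) (- g)).
      set (x := INR (S m)) in *. assert (Hx : 0 < x) by (apply INR_gt0; lia).
      rewrite (S_INR (S m)); fold x.
      destruct (MVT_gen (fun t => Rpower t (- g)) x (x + 1)
                  (fun t => - g * Rpower t (- (1 + g)))) as [c [Hc E]].
      + rewrite Rmin_left, Rmax_right by lra; intros t Ht.
        unfold Rpower; auto_derive; [lra|].
        replace (- (1 + g) * ln t) with (- g * ln t + - ln t) by ring.
        rewrite exp_plus, exp_Ropp, exp_ln by lra; field; lra.
      + rewrite Rmin_left, Rmax_right by lra; intros t Ht.
        apply continuity_pt_filterlim.
        apply (ex_derive_continuous (fun t => Rpower t (- g))).
        unfold Rpower; auto_derive; lra.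
      + rewrite Rmin_left, Rmax_right in Hc by lra.
        assert (Hm : Rpower (x + 1) (- (1 + g)) <= Rpower c (- (1 + g))).
        { rewrite !Rpower_Ropp; apply Rinv_le_contravar; [apply Rpower_pos|].
          apply Rle_Rpower_l; lra. }
        assert (E2 : Rpower c (- (1 + g)) = / g * (Rpower x (- g) - Rpower (x + 1) (- g))).
        { replace (Rpower x (- g) - Rpower (x + 1) (- g))
            with (- (- g * Rpower c (- (1 + g)) * (x + 1 - x))) by (rewrite <- E; ring).
          field; lra. }
        lra. }
  destruct n as [|n]; [simpl; lra|].
  eapply Rle_trans; [apply H|].
  pose proof (Rmult_lt_0_compat _ _ Hig (Rpower_pos (INR (S n)) (- g))); lra.
Qed.

(** The larger of the two bases is at least half of [S (k + j)], so its power may be replaced by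
    that of [S (k + j)] at a cost of at most [2^t]. If the larger base carries the exponent [t], the
    excess [t - s] is handed to the smaller one. *)
Lemma conv_Rpower_pointwise (s t : R) (k j : nat) : 0 <= s <= t ->
  Rpower (INR (S k)) (- s) * Rpower (INR (S j)) (- t) <=
  Rpower 2 t * Rpower (INR (S (k + j))) (- s)
  * (Rpower (INR (S k)) (- t) + Rpower (INR (S j)) (- t)).
Proof.
  intros Hst.
  assert (Hk : 0 < INR (S k)) by (apply INR_gt0; lia).
  assert (Hj : 0 < INR (S j)) by (apply INR_gt0; lia).
  assert (Hn : 0 < INR (S (k + j))) by (apply INR_gt0; lia).
  assert (E : INR (S (k + j)) = INR (S k) + INR (S j) - 1)
    by (rewrite !S_INR, plus_INR; ring).
  assert (H1 : 1 <= INR (S k)) by (apply (le_INR 1); lia).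
  pose proof (Rpower_pos (INR (S k)) (- t)) as P1.
  pose proof (Rpower_pos (INR (S j)) (- t)) as P2.
  pose proof (Rpower_pos (INR (S (k + j))) (- s)) as P3.
  pose proof (Rpower_pos (INR (S k)) (- s)) as P4.
  pose proof (Rpower_pos 2 t) as P5.
  destruct (Nat.le_gt_cases j k) as [Hjk|Hjk].
  - assert (INR (S j) <= INR (S k)) by (apply le_INR; lia).
    assert (Q : Rpower (INR (S k)) (- s) <= Rpower 2 s * Rpower (INR (S (k + j))) (- s))
      by (apply Rpower_neg_half; lra).
    assert (Q2 : Rpower 2 s <= Rpower 2 t) by (apply Rle_Rpower; lra).
    apply Rle_trans with (Rpower 2 t * Rpower (INR (S (k + j))) (- s) * Rpower (INR (S j)) (- t)).
    + apply Rmult_le_compat_r; [lra|]. eapply Rle_trans; [exact Q|].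
      apply Rmult_le_compat_r; lra.
    + apply Rmult_le_compat_l; [left; apply Rmult_lt_0_compat|]; lra.
  - assert (INR (S k) <= INR (S j)) by (apply le_INR; lia).
    assert (Q : Rpower (INR (S j)) (- t) <= Rpower 2 t * Rpower (INR (S (k + j))) (- t))
      by (apply Rpower_neg_half; lra).
    assert (Q2 : Rpower (INR (S k)) (- s) * Rpower (INR (S (k + j))) (- t)
                 <= Rpower (INR (S (k + j))) (- s) * Rpower (INR (S k)) (- t)).
    { replace (- t) with (- s + - (t - s)) by ring; rewrite !Rpower_plus.
      assert (Q3 : Rpower (INR (S (k + j))) (- (t - s)) <= Rpower (INR (S k)) (- (t - s))).
      { rewrite !Rpower_Ropp; apply Rinv_le_contravar; [apply Rpower_pos|].
        apply Rle_Rpower_l; [lra|]. split; [lra|apply le_INR; lia]. }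
      apply (Rmult_le_compat_l (Rpower (INR (S k)) (- s) * Rpower (INR (S (k + j))) (- s))) in Q3;
        [lra|left; apply Rmult_lt_0_compat; assumption]. }
    apply Rle_trans with (Rpower (INR (S k)) (- s) * (Rpower 2 t * Rpower (INR (S (k + j))) (- t)));
      [apply Rmult_le_compat_l; lra|].
    apply Rle_trans with (Rpower 2 t * (Rpower (INR (S (k + j))) (- s) * Rpower (INR (S k)) (- t))).
    + replace (Rpower (INR (S k)) (- s) * (Rpower 2 t * Rpower (INR (S (k + j))) (- t)))
        with (Rpower 2 t * (Rpower (INR (S k)) (- s) * Rpower (INR (S (k + j))) (- t))) by ring.
      apply Rmult_le_compat_l; lra.
    + rewrite <- Rmult_assoc; apply Rmult_le_compat_l;
        [left; apply Rmult_lt_0_compat|]; lra.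
Qed.

(** Since [g > 0], the factor [v] is summable and the product keeps the slower decay of [a]. *)
Lemma fmul_Rpower_bound (a v : fps) (A V s g : R) :
  0 < g -> 0 <= s <= 1 + g -> 0 <= A -> 0 <= V ->
  (forall n, Rabs (a n) <= A * Rpower (INR (S n)) (- s)) ->
  (forall n, Rabs (v n) <= V * Rpower (INR (S n)) (- (1 + g))) ->
  exists C, 0 <= C /\ forall n, Rabs (fmul a v n) <= C * Rpower (INR (S n)) (- s).
Proof.
  intros Hg Hs HA HV Ha Hv.
  pose proof (Rinv_0_lt_compat g Hg) as Hig.
  pose proof (Rpower_pos 2 (1 + g)) as HP.
  exists (A * V * Rpower 2 (1 + g) * (2 * (1 + / g))).
  split; [repeat apply Rmult_le_pos; lra|]; intros n.
  set (y := fun k => Rpower (INR (S k)) (- (1 + g))).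
  set (x := Rpower (INR (S n)) (- s)).
  pose proof (Rpower_pos (INR (S n)) (- s)) as Hx; fold x in Hx.
  unfold fmul; eapply Rle_trans; [apply sumR_abs|].
  apply Rle_trans with (sumR (S n) (fun i => A * V * Rpower 2 (1 + g) * x * (y i + y (n - i)%nat))).
  - apply sumR_le; intros i Hi; rewrite Rabs_mult.
    apply Rle_trans with (A * Rpower (INR (S i)) (- s) * (V * y (n - i)%nat)).
    + apply Rmult_le_compat; try apply Rabs_pos; [apply Ha|apply Hv].
    + pose proof (conv_Rpower_pointwise s (1 + g) i (n - i) Hs) as H.
      replace (i + (n - i))%nat with n in H by lia. fold x in H; fold (y i) (y (n - i)%nat) in H.
      apply (Rmult_le_compat_l (A * V)) in H; [lra|apply Rmult_le_pos; assumption].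
  - rewrite sumR_scal, sumR_plus.
    replace (sumR (S n) (fun i => y (n - i)%nat)) with (sumR (S n) y)
      by (rewrite sumR_rev; apply sumR_ext; intros i Hi; f_equal; lia).
    pose proof (sum_Rpower_bounded g (S n) Hg) as H; fold y in H.
    replace (A * V * Rpower 2 (1 + g) * (2 * (1 + / g)) * x)
      with (A * V * Rpower 2 (1 + g) * x * (2 * (1 + / g))) by ring.
    apply Rmult_le_compat_l; [repeat apply Rmult_le_pos; lra|].
    change (fun i => y i) with y; lra.
Qed.

(** * Singularity of [1/(1-h)] for [h = c(1-(1-z)^g)] with [c > 1] and [0 < g < 1] *)

Section Singular.
Variables c g : R.
Hypothesis Hc : 1 < c.
Hypothesis Hg : 0 < g < 1.
Let h := pow_defect c g.
(** The solution of [h(z) = 1], that is of [(1-z)^g = (c-1)/c]; it lies in [(0,1)] because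
    [c > 1]. *)
Let z := 1 - Rpower ((c - 1) / c) (/ g).

Lemma ratio_c_bounds : 0 < (c - 1) / c < 1.
Proof.
  split; [apply Rdiv_lt_0_compat; lra|].
  apply (Rmult_lt_reg_r c); [lra|]; unfold Rdiv; rewrite Rmult_assoc, Rinv_l; lra.
Qed.

Lemma sing_bounds : 0 < z < 1.
Proof.
  pose proof ratio_c_bounds as H; unfold z.
  pose proof (Rpower_pos ((c - 1) / c) (/ g)).
  assert (H1 : Rpower ((c - 1) / c) (/ g) < exp 0); [|rewrite exp_0 in H1; lra].
  apply exp_increasing.
  assert (Hl : ln ((c - 1) / c) < 0) by (rewrite <- ln_1; apply ln_increasing; apply H).
  pose proof (Rinv_0_lt_compat g (proj1 Hg)) as Hi.
  pose proof (Rmult_lt_0_compat _ _ Hi (Ropp_0_gt_lt_contravar _ Hl)); lra.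
Qed.

Lemma sing_power : Rpower (1 - z) g = (c - 1) / c.
Proof.
  unfold z; replace (1 - (1 - Rpower ((c - 1) / c) (/ g))) with (Rpower ((c - 1) / c) (/ g)) by ring.
  rewrite Rpower_mult, Rinv_l, Rpower_1; [reflexivity|apply ratio_c_bounds|lra].
Qed.

Lemma pow_defect_S (n : nat) : h (S n) = - c * pw g (S n).
Proof.
  unfold h, pow_defect; rewrite fmul_const; unfold fsub; simpl fconst; ring.
Qed.

Lemma pw_S_neg (n : nat) : pw g (S n) < 0.
Proof.
  induction n as [|n IH]; [simpl; lra|].
  change (pw g (S n) * ((INR (S n) - g) / INR (S (S n))) < 0).
  assert (0 < (INR (S n) - g) / INR (S (S n))).
  { apply Rdiv_lt_0_compat; [|apply INR_gt0; lia].
    assert (1 <= INR (S n)) by (apply (le_INR 1); lia). lra. }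
  assert (0 < - pw g (S n) * ((INR (S n) - g) / INR (S (S n))))
    by (apply Rmult_lt_0_compat; lra). lra.
Qed.

Lemma pow_defect_pos (n : nat) : 0 < h (S n).
Proof.
  rewrite pow_defect_S; pose proof (pw_S_neg n).
  pose proof (Rmult_lt_0_compat c (- pw g (S n))); lra.
Qed.

Lemma pow_defect_log_convex (n : nat) :
  h (S (S n)) * h (S (S n)) <= h (S n) * h (S (S (S n))).
Proof.
  rewrite !pow_defect_S.
  change (pw g (S (S (S n)))) with
    (pw g (S n) * ((INR (S n) - g) / INR (S (S n))) * ((INR (S (S n)) - g) / INR (S (S (S n))))).
  change (pw g (S (S n))) with (pw g (S n) * ((INR (S n) - g) / INR (S (S n)))).
  set (q := pw g (S n)).
  assert (H1 : 1 <= INR (S n)) by (apply (le_INR 1); lia).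
  rewrite (S_INR (S (S n))), (S_INR (S n)). set (m := INR (S n)) in *.
  assert (H : (m - g) / (m + 1) <= (m + 1 - g) / (m + 1 + 1)).
  { apply (Rmult_le_reg_r ((m + 1) * (m + 1 + 1))); [apply Rmult_lt_0_compat; lra|].
    replace ((m - g) / (m + 1) * ((m + 1) * (m + 1 + 1))) with ((m - g) * (m + 2)) by (field; lra).
    replace ((m + 1 - g) / (m + 1 + 1) * ((m + 1) * (m + 1 + 1)))
      with ((m + 1 - g) * (m + 1)) by (field; lra). lra. }
  assert (H0 : 0 <= (m - g) / (m + 1)) by (apply Rdiv_le_0_compat; lra).
  set (r := (m - g) / (m + 1)) in *; set (r' := (m + 1 - g) / (m + 1 + 1)) in *.
  replace (- c * (q * r) * (- c * (q * r))) with ((c * q) ^ 2 * r * r) by ring.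
  replace (- c * q * (- c * (q * r * r'))) with ((c * q) ^ 2 * r * r') by ring.
  apply Rmult_le_compat_l; [|exact H].
  apply Rmult_le_pos; [apply pow2_ge_0|exact H0].
Qed.

Lemma pow_defect_bound : exists C, 0 <= C /\ forall n,
  Rabs (h n) <= C * Rpower (INR (S n)) (- (1 + g)).
Proof.
  destruct (pw_bound g) as [C [HC HB]]; [lra|].
  exists (c * C); split; [apply Rmult_le_pos; lra|]; intros [|n].
  - unfold h; rewrite pow_defect_0, Rabs_R0.
    apply Rmult_le_pos; [apply Rmult_le_pos; lra|left; apply Rpower_pos].
  - rewrite pow_defect_S, Rabs_mult, Rabs_Ropp, (Rabs_pos_eq c), Rmult_assoc by lra.
    apply Rmult_le_compat_l; [lra|apply HB].
Qed.

Lemma Rpower_neg_le_1 (n : nat) (s : R) : 0 <= s -> Rpower (INR (S n)) (- s) <= 1.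
Proof.
  intros Hs; rewrite Rpower_Ropp, <- Rinv_1; apply Rinv_le_contravar; [lra|].
  rewrite <- (Rpower_base1 s); apply Rle_Rpower_l; [exact Hs|].
  split; [lra|apply (le_INR 1); lia].
Qed.

Lemma fbounded_Rpower (a : fps) (C s : R) : 0 <= s -> 0 <= C ->
  (forall n, Rabs (a n) <= C * Rpower (INR (S n)) (- s)) -> fbounded a.
Proof.
  intros Hs HC H; exists C; intros n; eapply Rle_trans; [apply H|].
  rewrite <- (Rmult_1_r C) at 2; apply Rmult_le_compat_l; [exact HC|].
  apply Rpower_neg_le_1; exact Hs.
Qed.

Lemma fbounded_pow_defect : fbounded h.
Proof.
  destruct pow_defect_bound as [C [HC HB]]; apply (fbounded_Rpower h C (1 + g)); auto; lra.
Qed.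

Lemma tail_Rpower_bound (a : fps) (C s : R) : 0 <= s -> 0 <= C ->
  (forall n, Rabs (a n) <= C * Rpower (INR (S n)) (- s)) ->
  forall n, Rabs (tail z a n) <= C * (z / (1 - z)) * Rpower (INR (S n)) (- s).
Proof.
  intros Hs HC H n.
  replace (C * (z / (1 - z)) * Rpower (INR (S n)) (- s))
    with (C * Rpower (INR (S n)) (- s) * (z / (1 - z))) by ring.
  apply (tail_abs z sing_bounds); [apply (fbounded_Rpower a C s); auto|].
  intros j; eapply Rle_trans; [apply H|].
  apply Rmult_le_compat_l; [exact HC|].
  rewrite !Rpower_Ropp; apply Rinv_le_contravar; [apply Rpower_pos|].
  apply Rle_Rpower_l; [exact Hs|]. split; [apply INR_gt0; lia|apply le_INR; lia].
Qed.

Lemma PSeries_pow_defect : PSeries h z = 1.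
Proof.
  pose proof sing_bounds as Hz.
  unfold h, pow_defect; rewrite fmul_const_l.
  change (PSeries (PS_scal c (PS_plus (fconst 1) (PS_opp (pw g)))) z = 1).
  assert (X : ex_pseries (pw g) z)
    by (apply CV_radius_inside, (CV_z z Hz), fbounded_pw; lra).
  assert (X1 : ex_pseries (fconst 1) z).
  { apply CV_radius_inside, (CV_z z Hz), (fbounded_finite _ 1).
    intros [|n] Hn; [lia|reflexivity]. }
  rewrite PSeries_scal, PSeries_plus; [|exact X1|apply ex_pseries_opp; exact X].
  rewrite PSeries_opp, PSeries_pw, sing_power by lra.
  rewrite PSeries_finite2 by (intros [|n] Hn; [lia|reflexivity]).
  simpl; field; lra.
Qed.

Lemma PSeries_fder_pow_defect : PSeries (fder h) z = c * g * Rpower (1 - z) (g - 1).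
Proof.
  pose proof sing_bounds as Hz.
  assert (E : fder h = fmul (fconst (c * g)) (pw (g - 1))).
  { unfold h, pow_defect.
    rewrite fder_mul, fder_sub, !fder_const, fder_pw_mul, pw_add, fconst_mul, fconst_opp.
    replace (-1 + g) with (g - 1) by ring; ring. }
  rewrite E, fmul_const_l.
  change (PSeries (PS_scal (c * g) (pw (g - 1))) z = c * g * Rpower (1 - z) (g - 1)).
  rewrite PSeries_scal, PSeries_pw by lra; reflexivity.
Qed.

(** The coefficients of [pw e] are of order at most [n^(-1-e)], those of the pole-free factor
    [n^(-1-g)]. As [e <= g], their product and its tail inherit the first rate, and the rest is the
    pole. *)
Lemma pow_over_defect_asymp (e : R) : -1 <= e <= g -> exists C, forall n,
  Rabs (fmul (pw e) (fgeo h) n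
        - (/ z) ^ n * (Rpower (1 - z) e / (z * (c * g * Rpower (1 - z) (g - 1)))))
  <= C * Rpower (INR (S n)) (- (1 + e)).
Proof.
  intros He; pose proof sing_bounds as Hz.
  pose proof fbounded_pow_defect as Hb.
  pose proof (pow_defect_0 c g) as H0; fold h in H0.
  destruct pow_defect_bound as [C1 [HC1 HB1]].
  assert (Hs1 : 0 <= 1 + g) by lra.
  pose proof (tail_Rpower_bound h C1 (1 + g) Hs1 HC1 HB1) as HT.
  set (u := pole_free z h).
  assert (Hzz : 0 <= z / (1 - z)) by (apply Rdiv_le_0_compat; lra).
  assert (HCz : 0 <= C1 * (z / (1 - z))) by (apply Rmult_le_pos; assumption).
  assert (HU : forall n, Rabs (u n) <= (1 + C1 * (z / (1 - z))) * Rpower (INR (S n)) (- (1 + g))).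
  { intros n; pose proof (Rpower_pos (INR (S n)) (- (1 + g))) as HP. destruct n as [|n].
    - unfold u; rewrite pole_free_0, Rabs_R1; simpl INR; rewrite Rpower_base1; lra.
    - destruct (pole_free_nonpos z Hz h H0 pow_defect_pos pow_defect_log_convex Hb
                  PSeries_pow_defect n) as [Hn1 Hn2].
      fold u in Hn1, Hn2; rewrite Rabs_left1 by lra.
      specialize (HT (S n)); pose proof (Rle_abs (tail z h (S n))); lra. }
  destruct (pw_bound e) as [C2 [HC2 HB2]]; [lra|].
  destruct (fmul_Rpower_bound (pw e) u C2 (1 + C1 * (z / (1 - z))) (1 + e) g) as [C [HC HW]];
    try lra; auto.
  exists (C * (z / (1 - z))); intros n.
  rewrite (pole_expansion z Hz h H0 pow_defect_pos pow_defect_log_convex Hb PSeries_pow_defect).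
  - rewrite PSeries_fder_pow_defect, PSeries_pw by lra; fold u.
    replace (_ - _) with (- tail z (fmul (pw e) u) n) by ring.
    rewrite Rabs_Ropp; apply tail_Rpower_bound; [lra|exact HC|exact HW].
  - apply fbounded_pw; lra.
  - apply (fbounded_Rpower _ C (1 + e)); [lra|exact HC|exact HW].
Qed.

(** From [1 - h = (1-c) + c(1-z)^g] follows [(c-1)/(1-h) = c(1-z)^g/(1-h) - 1]. This isolates an
    explicit term and improves the exponent in the remaining quotient by [g]. *)
Lemma inv_defect_split (s : R) (n : nat) :
  fmul (pw (- s)) (fgeo h) n =
  - / (c - 1) * pw (- s) n + c / (c - 1) * fmul (pw (g - s)) (fgeo h) n.
Proof.
  assert (E : fmul (fconst (c - 1)) (fmul (pw (- s)) (fgeo h))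
    = fsub (fmul (fconst c) (fmul (pw (g - s)) (fgeo h))) (pw (- s))).
  { pose proof (fgeo_inv h (pow_defect_0 c g)) as Hi.
    replace (g - s) with (g + - s) by ring. rewrite <- (pw_add g (- s)), fconst_sub.
    fold h in Hi.
    assert (Hh : fsub (fconst 1) h = fadd (fsub (fconst 1) (fconst c)) (fmul (fconst c) (pw g)))
      by (unfold h, pow_defect; ring).
    rewrite Hh in Hi; set (G := fgeo h) in *.
    transitivity (fsub (fmul (fconst c) (fmul (fmul (pw g) (pw (- s))) G))
      (fmul (pw (- s)) (fmul (fadd (fsub (fconst 1) (fconst c)) (fmul (fconst c) (pw g))) G)));
      [ring|].
    rewrite Hi; ring. }
  assert (E1 := f_equal (fun f : fps => f n) E); cbv beta in E1.
  unfold fsub in E1; rewrite !fmul_const in E1.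
  apply (Rmult_eq_reg_l (c - 1)); [|lra]. rewrite E1; field; lra.
Qed.
End Singular.

Definition sing (c g : R) : R := 1 - Rpower ((c - 1) / c) (/ g).

Lemma pow_S_pred (x : R) (n : nat) : (1 <= n)%nat -> x ^ n = x * x ^ pred n.
Proof. destruct n; [lia|reflexivity]. Qed.

Lemma EP_asymp_large (p : R) : 1/2 < p -> p < 1 ->
  exists C : R, exists N : nat, forall n : nat, (N <= n)%nat ->
    Rabs (EP p n - alpha p ^ n / (1 - p) - (- (2 * p - 1) / (1 - p)))
    <= C * Rpower (INR n) (1 - 2 * p).
Proof.
  intros Hp Hp1.
  set (g := 2 * p - 1). set (c := p / (2 * p - 1)).
  assert (Hg : 0 < g < 1) by (unfold g; lra).
  assert (Hc1 : c - 1 = (1 - p) / g) by (unfold c, g; field; lra).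
  assert (Hcg : 0 < (1 - p) / g) by (apply Rdiv_lt_0_compat; lra).
  assert (Hc : 1 < c) by lra.
  assert (Hr : (c - 1) / c = (1 - p) / p)
    by (rewrite Hc1; unfold c, g; field; lra).
  pose proof (sing_bounds c g Hc Hg) as Hz. pose proof (sing_power c g Hc Hg) as Hw.
  fold (sing c g) in Hz, Hw.
  assert (Halpha : alpha p = / sing c g).
  { unfold alpha; destruct (Req_EM_T p (1/2)) as [E|_]; [lra|].
    unfold sing; f_equal; f_equal. rewrite Hr; unfold Rpower, g; f_equal.
    replace ((1 - p) / p) with (/ (p / (1 - p))) by (field; lra).
    rewrite ln_Rinv by (apply Rdiv_lt_0_compat; lra). field; lra. }
  (* After the splitting with [s = 1] the exponent is [g - 1], and the error [n^(-g)] is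
     [n^(1-2p)]. *)
  destruct (pow_over_defect_asymp c g Hc Hg (g - 1)) as [C HC]; [lra|].
  fold (sing c g) in HC; set (z := sing c g) in *.
  exists (c / (c - 1) * C), 1%nat; intros n Hn.
  rewrite (EP_gf p _ (pow_defect_0 _ _) (pow_defect_ode p ltac:(lra)) n).
  fold g; fold c.
  replace (-1) with (- (1)) at 1 by ring. rewrite (inv_defect_split c g Hc 1).
  (* The explicit term [-1/(c-1)] is the constant [-(2p-1)/(1-p)]; the factor [1/z] in the pole
     constant restores the power [n] from [n - 1]. *)
  replace (- (1)) with (-1) by ring; rewrite pw_m1, Halpha, (pow_S_pred (/ z) n Hn).
  specialize (HC (pred n)). replace (S (pred n)) with n in HC by lia.
  set (G := fmul (pw (g - 1)) (fgeo (pow_defect c g)) (pred n)) in *.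
  replace (1 - 2 * p) with (- (1 + (g - 1))) by (unfold g; ring).
  assert (Hk : 0 <= c / (c - 1)) by (apply Rdiv_le_0_compat; lra).
  match goal with |- Rabs ?X <= _ => replace X with (c / (c - 1) * (G - (/ z) ^ pred n *
       (Rpower (1 - z) (g - 1) / (z * (c * g * Rpower (1 - z) (g - 1)))))) end.
  - rewrite Rabs_mult, (Rabs_pos_eq _ Hk), (Rmult_assoc _ C); apply Rmult_le_compat_l; assumption.
  - pose proof (Rpower_pos (1 - z) (g - 1)).
    rewrite Hc1; unfold g, c in *; field; repeat split; lra.
Qed.

Lemma EP_asymp_small (p : R) : 0 < p -> p < 1/2 ->
  exists C : R, exists N : nat, forall n : nat, (N <= n)%nat ->
    Rabs (EP p n - alpha p ^ n / (1 - p)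
          - (- (1 - 2 * p) / (p * Gamma (2 * p)) * Rpower (INR n) (2 * p - 1)))
    <= C * Rpower (INR n) (2 * (2 * p - 1)).
Proof.
  intros Hp0 Hp.
  set (g := 1 - 2 * p). set (c := (1 - p) / (1 - 2 * p)).
  assert (Hg : 0 < g < 1) by (unfold g; lra).
  assert (Hc1 : c - 1 = p / g) by (unfold c, g; field; lra).
  assert (Hcg : 0 < p / g) by (apply Rdiv_lt_0_compat; lra).
  assert (Hc : 1 < c) by lra.
  assert (Hr : (c - 1) / c = p / (1 - p))
    by (rewrite Hc1; unfold c, g; field; lra).
  pose proof (sing_bounds c g Hc Hg) as Hz. pose proof (sing_power c g Hc Hg) as Hw.
  fold (sing c g) in Hz, Hw.
  assert (Halpha : alpha p = / sing c g).
  { unfold alpha; destruct (Req_EM_T p (1/2)) as [E|_]; [lra|].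
    unfold sing; rewrite Hr; reflexivity. }
  (* Here [s = 2p] and [g - s = 1 - 4p], which gives the error exponent [-(2-4p) = 2(2p-1)]. *)
  destruct (pow_over_defect_asymp c g Hc Hg (g - 2 * p)) as [C HC]; [unfold g; lra|].
  fold (sing c g) in HC; set (z := sing c g) in *.
  destruct (Gamma_pw (2 * p)) as [HGp [B HB]]; [lra|].
  (* With the exponent [2p - 1 < 0] the defect itself is unbounded near 1. Since [p/(2p-1) = 1 - c],
     multiplying [1 - h1] by [(1-z)^g] yields [1 - h2], a defect with positive exponent. *)
  assert (Hgf : fmul (pw (-1)) (fgeo (pow_defect (p / (2 * p - 1)) (2 * p - 1)))
                = fmul (pw (- (2 * p))) (fgeo (pow_defect c g))).
  { set (h1 := pow_defect (p / (2 * p - 1)) (2 * p - 1)). set (h2 := pow_defect c g).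
    pose proof (fgeo_inv h1 (pow_defect_0 _ _)) as I1.
    pose proof (fgeo_inv h2 (pow_defect_0 _ _)) as I2.
    assert (E : fmul (pw g) (fsub (fconst 1) h1) = fsub (fconst 1) h2).
    { unfold h1, h2, pow_defect.
      transitivity (fadd (fmul (pw g) (fconst (1 - p / (2 * p - 1))))
        (fmul (fconst (p / (2 * p - 1))) (fmul (pw g) (pw (2 * p - 1)))));
        [rewrite fconst_sub; ring|].
      rewrite pw_add; replace (g + (2 * p - 1)) with 0 by (unfold g; ring); rewrite pw_0.
      replace (p / (2 * p - 1)) with (1 - c) by (unfold c; field; lra).
      rewrite !fconst_sub; ring. }
    replace (- (2 * p)) with (-1 + g) by (unfold g; ring); rewrite <- pw_add.
    transitivity (fmul (fmul (pw (-1)) (fgeo h1)) (fmul (fsub (fconst 1) h2) (fgeo h2)));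
      [rewrite I2; ring|].
    rewrite <- E.
    transitivity (fmul (fmul (pw (-1)) (fmul (pw g) (fgeo h2))) (fmul (fsub (fconst 1) h1) (fgeo h1)));
      [ring|rewrite I1; ring]. }
  exists (/ (c - 1) * B + c / (c - 1) * C), 1%nat; intros n Hn.
  rewrite (EP_gf p _ (pow_defect_0 _ _) (pow_defect_ode p ltac:(lra)) n), Hgf.
  rewrite (inv_defect_split c g Hc (2 * p)), Halpha, (pow_S_pred (/ z) n Hn).
  specialize (HC (pred n)). replace (S (pred n)) with n in HC by lia.
  specialize (HB n Hn). replace (n - 1)%nat with (pred n) in HB by lia.
  set (G := fmul (pw (g - 2 * p)) (fgeo (pow_defect c g)) (pred n)) in *.
  set (M := pw (- (2 * p)) (pred n)) in *.
  replace (- (1 + (g - 2 * p))) with (2 * (2 * p - 1)) in HC by (unfold g; ring).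
  assert (HBn : 0 <= B) .
  { pose proof (Rpower_pos (INR n) (2 * p - 2)).
    assert (0 <= B * Rpower (INR n) (2 * p - 2)) by (eapply Rle_trans; [apply Rabs_pos|exact HB]).
    apply (Rmult_le_reg_r (Rpower (INR n) (2 * p - 2))); lra. }
  (* The Gamma estimate has error [n^(2p-2)], which [p > 0] makes no larger than [n^(4p-2)]. *)
  assert (HB' : Rabs (M - Rpower (INR n) (2 * p - 1) / Gamma (2 * p))
                <= B * Rpower (INR n) (2 * (2 * p - 1))).
  { eapply Rle_trans; [exact HB|]. apply Rmult_le_compat_l; [exact HBn|].
    destruct (Req_dec (INR n) 1) as [->|Hn1]; [rewrite !Rpower_base1; lra|].
    apply Rle_Rpower; [apply (le_INR 1); exact Hn|lra]. }
  assert (Hk : 0 <= c / (c - 1)) by (apply Rdiv_le_0_compat; lra).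
  assert (Hk2 : 0 < / (c - 1)) by (apply Rinv_0_lt_compat; lra).
  match goal with |- Rabs ?X <= _ => replace X
    with (- (/ (c - 1) * (M - Rpower (INR n) (2 * p - 1) / Gamma (2 * p)))
          + c / (c - 1) * (G - (/ z) ^ pred n *
              (Rpower (1 - z) (g - 2 * p) / (z * (c * g * Rpower (1 - z) (g - 1)))))) end.
  - eapply Rle_trans; [apply Rabs_triang|].
    rewrite Rabs_Ropp, !Rabs_mult, (Rabs_pos_eq _ Hk), (Rabs_pos_eq _ (Rlt_le _ _ Hk2)).
    rewrite Rmult_plus_distr_r, (Rmult_assoc _ B), (Rmult_assoc _ C).
    apply Rplus_le_compat; apply Rmult_le_compat_l; try assumption; left; exact Hk2.
  (* As [1 - 2p = g], the pole constant contains [(1-z)^g = (c-1)/c] and the other powers cancel. *)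
  - replace (Rpower (1 - z) (g - 2 * p)) with (Rpower (1 - z) g * Rpower (1 - z) (g - 1)).
    + pose proof (Rpower_pos (1 - z) (g - 1)). rewrite Hw, Hr, Hc1.
      unfold g, c in *; field; repeat split; lra.
    + rewrite <- Rpower_plus; f_equal; unfold g; ring.
Qed.

(** * Asymptotics for [p = 1/2] *)

Section Half.
Let h := half_log.
Let z := 1 - exp (-2).
Let d := tail z h.
Let u := pole_free z h.
(** [w] and [s] are the partial sums of [u] and [d]; [rho] is the total weight of the geometric
    average in [tail]. *)
Let w := fmul (pw (-1)) u.
Let s := fmul (pw (-1)) d.
Let rho := z / (1 - z).

Lemma half_sing : 0 < z < 1.
Proof.
  unfold z; pose proof (exp_pos (-2)).
  assert (H1 : exp (-2) < exp 0) by (apply exp_increasing; lra).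
  rewrite exp_0 in H1; lra.
Qed.

Lemma half_log_S (n : nat) : h (S n) = / 2 * / INR (S n).
Proof. unfold h, half_log; rewrite fmul_const; reflexivity. Qed.

Lemma half_log_pos (n : nat) : 0 < h (S n).
Proof.
  rewrite half_log_S; apply Rmult_lt_0_compat; apply Rinv_0_lt_compat; [lra|apply INR_gt0; lia].
Qed.

Lemma half_log_decr (n : nat) : h (S (S n)) <= h (S n).
Proof.
  rewrite !half_log_S; apply Rmult_le_compat_l; [lra|].
  apply Rinv_le_contravar; [apply INR_gt0; lia|apply le_INR; lia].
Qed.

Lemma half_log_log_convex (n : nat) : h (S (S n)) * h (S (S n)) <= h (S n) * h (S (S (S n))).
Proof.
  rewrite !half_log_S, (S_INR (S (S n))), (S_INR (S n)).
  assert (Hp : 0 < INR (S n)) by (apply INR_gt0; lia). set (m := INR (S n)) in *.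
  replace (/ 2 * / (m + 1) * (/ 2 * / (m + 1))) with (/ 4 * / ((m + 1) * (m + 1))) by (field; lra).
  replace (/ 2 * / m * (/ 2 * / (m + 1 + 1))) with (/ 4 * / (m * (m + 2))) by (field; lra).
  apply Rmult_le_compat_l; [lra|].
  apply Rinv_le_contravar; [apply Rmult_lt_0_compat|]; lra.
Qed.

Lemma fbounded_half_log : fbounded h.
Proof. unfold h, half_log; rewrite fmul_const_l; apply fbounded_scal, fbounded_flog. Qed.

Lemma PSeries_half_log : PSeries h z = 1.
Proof.
  pose proof half_sing as Hz.
  unfold h, half_log; rewrite fmul_const_l.
  change (PSeries (PS_scal (/ 2) flog) z = 1).
  rewrite PSeries_scal, PSeries_flog by lra.
  unfold z; replace (1 - (1 - exp (-2))) with (exp (-2)) by ring; rewrite ln_exp; field.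
Qed.

Lemma PSeries_fder_half_log : PSeries (fder h) z = / 2 * / (1 - z).
Proof.
  pose proof half_sing as Hz.
  assert (E : fder h = fmul (fconst (/ 2)) (pw (-1)))
    by (unfold h, half_log; rewrite fder_mul, fder_const, fder_flog; ring).
  rewrite E, fmul_const_l.
  change (PSeries (PS_scal (/ 2) (pw (-1))) z = / 2 * / (1 - z)).
  rewrite PSeries_scal, PSeries_pw by lra.
  replace (-1) with (- (1)) by ring; rewrite Rpower_Ropp, Rpower_1 by lra; reflexivity.
Qed.

Lemma half_inv : fmul u d = fconst 1.
Proof.
  exact (pole_free_inv z half_sing h half_log_0 fbounded_half_log PSeries_half_log).
Qed.

Lemma half_d0 : d 0%nat = 1.
Proof.
  exact (tail_h_0 z half_sing h half_log_0 fbounded_half_log PSeries_half_log).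
Qed.

Lemma half_d_pos (n : nat) : 0 < d n.
Proof. exact (tail_h_pos z half_sing h half_log_pos fbounded_half_log n). Qed.

Lemma rho_pos : 0 < rho.
Proof. pose proof half_sing; apply Rdiv_lt_0_compat; lra. Qed.

Lemma half_d_decr (n : nat) : d (S n) <= d n.
Proof.
  unfold d; rewrite <- tail_shift; apply (tail_le z half_sing).
  - apply fbounded_shift, fbounded_half_log.
  - apply fbounded_half_log.
  - intros j; rewrite Nat.add_succ_r; apply half_log_decr.
Qed.

Lemma half_h_decr_le (m n : nat) : (m <= n)%nat -> h (S n) <= h (S m).
Proof.
  intros H; induction H as [|n H IH]; [lra|].
  eapply Rle_trans; [apply half_log_decr|exact IH].
Qed.

Lemma half_d_le (n : nat) : d n <= rho / 2 * / INR (S n).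
Proof.
  replace (rho / 2 * / INR (S n)) with (h (S n) * (z / (1 - z)))
    by (rewrite half_log_S; unfold rho; field; split;
        [apply INR_S_neq0|pose proof half_sing; lra]).
  apply (tail_ext_bounds z half_sing h n 0 (h (S n)) fbounded_half_log).
  intros j; rewrite Nat.add_succ_r; split; [left; apply half_log_pos|].
  apply half_h_decr_le; lia.
Qed.

Lemma half_s_sum (n : nat) : s n = sumR (S n) d.
Proof.
  unfold s; rewrite fmul_comm; apply sumR_ext; intros i _; rewrite pw_m1; ring.
Qed.

Lemma half_s_S (n : nat) : s (S n) = s n + d (S n).
Proof. rewrite !half_s_sum; reflexivity. Qed.

Lemma half_s_mono (m n : nat) : (m <= n)%nat -> s m <= s n.
Proof.
  intros H; induction H as [|n H IH]; [lra|].
  rewrite half_s_S; pose proof (half_d_pos (S n)); lra.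
Qed.

Lemma half_s_ge_1 (n : nat) : 1 <= s n.
Proof.
  eapply Rle_trans; [|apply (half_s_mono 0); lia].
  rewrite half_s_sum; simpl; rewrite half_d0; lra.
Qed.

(* Summing [(1 - z) d n = z h (n+1) - z (d n - d (n+1))], the differences telescope. *)
Lemma half_s_harm (n : nat) :
  s n = rho / 2 * sumR (S n) (fun k => / INR (S k)) - rho * (1 - d (S n)).
Proof.
  pose proof half_sing as Hz.
  assert (Hrec : forall n, d n = rho / 2 * / INR (S n) - rho * (d n - d (S n))).
  { intros k. pose proof (tail_rec z half_sing h k fbounded_half_log) as E.
    rewrite half_log_S in E; fold d in E.
    unfold rho. apply (Rmult_eq_reg_r (1 - z)); [|lra].
    replace ((z / (1 - z) / 2 * / INR (S k) - z / (1 - z) * (d k - d (S k))) * (1 - z))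
      with (z * (/ 2 * / INR (S k)) - z * (d k - d (S k))) by (field; split; (lra || apply INR_S_neq0)).
    lra. }
  induction n as [|n IH].
  - rewrite half_s_sum; cbn [sumR]; pose proof (Hrec 0%nat) as E; rewrite half_d0 in *; lra.
  - rewrite half_s_S, IH.
    change (sumR (S (S n)) (fun k => / INR (S k)))
      with (sumR (S n) (fun k => / INR (S k)) + / INR (S (S n))).
    pose proof (Hrec (S n)); lra.
Qed.

Lemma ln_step (x : R) : 0 < x -> / (x + 1) <= ln (x + 1) - ln x <= / x.
Proof.
  intros Hx; pose proof (Rinv_0_lt_compat _ Hx) as Hi.
  assert (Hi1 : 0 < / (x + 1)) by (apply Rinv_0_lt_compat; lra).
  assert (Hln : forall y, 0 < y -> ln y <= y - 1).
  { intros y Hy; pose proof (exp_ineq1_le (ln y)) as H; rewrite exp_ln in H by exact Hy; lra. }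
  split.
  - assert (H := Hln (x / (x + 1)) ltac:(apply Rdiv_lt_0_compat; lra)).
    rewrite ln_div in H by lra.
    replace (x / (x + 1) - 1) with (- / (x + 1)) in H by (field; lra). lra.
  - assert (H := Hln ((x + 1) / x) ltac:(apply Rdiv_lt_0_compat; lra)).
    rewrite ln_div in H by lra.
    replace ((x + 1) / x - 1) with (/ x) in H by (field; lra). lra.
Qed.

Lemma harm_ln (n : nat) :
  ln (INR (S n)) <= sumR (S n) (fun k => / INR (S k)) <= 1 + ln (INR (S n)).
Proof.
  assert (H : ln (INR (S n)) + / INR (S n) <= sumR (S n) (fun k => / INR (S k))
              <= 1 + ln (INR (S n))).
  { induction n as [|n IH].
    - cbn [sumR]; change (INR 1) with 1; rewrite ln_1, Rinv_1; lra.
    - change (sumR (S (S n)) (fun k => / INR (S k)))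
        with (sumR (S n) (fun k => / INR (S k)) + / INR (S (S n))).
      rewrite (S_INR (S n)) in *.
      pose proof (ln_step (INR (S n)) (INR_gt0 (S n) ltac:(lia))); lra. }
  pose proof (Rinv_0_lt_compat _ (INR_gt0 (S n) ltac:(lia))); lra.
Qed.

Lemma half_s_ln (n : nat) :
  rho / 2 * ln (INR (S n)) - rho <= s n <= rho / 2 * (1 + ln (INR (S n))).
Proof.
  pose proof rho_pos as Hr; pose proof (harm_ln n) as [H1 H2].
  pose proof (half_d_pos (S n)) as Hd.
  assert (Hd1 : d (S n) <= 1).
  { clear - n. rewrite <- half_d0. induction n as [|n IH]; [apply half_d_decr|].
    eapply Rle_trans; [apply half_d_decr|exact IH]. }
  rewrite half_s_harm.
  apply (Rmult_le_compat_l (rho / 2)) in H1; [|lra].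
  apply (Rmult_le_compat_l (rho / 2)) in H2; [|lra].
  assert (0 <= rho * d (S n)) by (apply Rmult_le_pos; lra).
  assert (0 <= rho * (1 - d (S n))) by (apply Rmult_le_pos; lra).
  lra.
Qed.

Lemma half_w0 : w 0%nat = 1.
Proof. unfold w; rewrite fmul_at0; unfold u; rewrite pole_free_0; simpl; ring. Qed.

Lemma half_w_S (n : nat) : w (S n) = w n + u (S n).
Proof.
  assert (E : forall k, w k = sumR (S k) u).
  { intros k; unfold w; rewrite fmul_comm; apply sumR_ext; intros i _; rewrite pw_m1; ring. }
  rewrite !E; reflexivity.
Qed.

(** The increments of [w] are the coefficients of [u], which Kaluza's theorem places between [-d]
    and 0. *)
Lemma half_w_step (n : nat) : 0 <= w n - w (S n) <= d (S n).
Proof.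
  rewrite half_w_S.
  pose proof (pole_free_nonpos z half_sing h half_log_0 half_log_pos half_log_log_convex
                fbounded_half_log PSeries_half_log n) as H.
  fold u d in H; lra.
Qed.

Lemma half_w_mono (m n : nat) : (m <= n)%nat -> w n <= w m.
Proof.
  intros H; induction H as [|n H IH]; [lra|]. pose proof (half_w_step n); lra.
Qed.

Lemma half_w_d : fmul w d = pw (-1).
Proof.
  unfold w. transitivity (fmul (pw (-1)) (fmul u d)); [ring|]. rewrite half_inv; ring.
Qed.

(* [(1 - z) d] has nonpositive coefficients after the first one, so that its reciprocal
   [w] satisfies a renewal equation with nonnegative weights. *)
Lemma half_w_nonneg (n : nat) : 0 <= w n.
Proof.
  assert (E : fmul (fmul fone_minus_z d) w = fconst 1).
  { transitivity (fmul fone_minus_z (fmul w d)); [ring|].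
    rewrite half_w_d, <- pw_1, pw_add, <- pw_0; f_equal; ring. }
  induction n as [n IH] using (well_founded_induction Wf_nat.lt_wf).
  destruct n as [|n]; [rewrite half_w0; lra|].
  rewrite (kaluza_renewal w _ half_w0 E); apply sumR_pos; intros i Hi.
  apply Rmult_le_pos; [|apply IH; lia].
  rewrite fmul_one_minus_z_S; pose proof (half_d_decr i); lra.
Qed.

(** [w s = 1/(1-z)^2] has coefficient [2n + 1] at [2n]. Keeping only the indices [i <= n], where
    [s (2n - i) >= s n], bounds the mean of [w] by [O(1/s n)]. *)
Lemma half_sum_w (n : nat) : s n * sumR (S n) w <= 2 * INR n + 1.
Proof.
  assert (E : fmul w s (n + n)%nat = 2 * INR n + 1).
  { replace (fmul w s) with (fmul (pw (-1)) (fmul w d)) by (unfold s; ring).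
    rewrite half_w_d; unfold fmul.
    rewrite (sumR_ext _ _ (fun _ => 1)) by (intros; rewrite !pw_m1; ring).
    assert (E1 : forall m, sumR m (fun _ => 1) = INR m)
      by (induction m as [|m IH]; [reflexivity|rewrite S_INR; simpl; rewrite IH; reflexivity]).
    rewrite E1, S_INR, plus_INR; ring. }
  rewrite <- E, <- sumR_scal. unfold fmul.
  replace (S (n + n)) with (S n + n)%nat by lia. rewrite sumR_add.
  assert (0 <= sumR n (fun i => w (S n + i)%nat * s (n + n - (S n + i))%nat)).
  { apply sumR_pos; intros i _; apply Rmult_le_pos; [apply half_w_nonneg|].
    eapply Rle_trans; [|apply half_s_ge_1]; lra. }
  assert (sumR (S n) (fun i => s n * w i) <= sumR (S n) (fun i => w i * s (n + n - i)%nat)).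
  { apply sumR_le; intros i Hi; rewrite Rmult_comm.
    apply Rmult_le_compat_l; [apply half_w_nonneg|apply half_s_mono; lia]. }
  lra.
Qed.

(** As [w] decreases, every [w (n - i)] in the renewal identity at [n] is at least [w n]. *)
Lemma half_w_upper (n : nat) : w n * s n <= 1.
Proof.
  assert (E := f_equal (fun f : fps => f n) half_w_d); cbv beta in E.
  rewrite pw_m1 in E; rewrite <- E, half_s_sum, <- sumR_scal, fmul_comm.
  apply sumR_le; intros i Hi; rewrite Rmult_comm.
  apply Rmult_le_compat_l; [left; apply half_d_pos|apply half_w_mono; lia].
Qed.

(** The renewal identity is taken at [2n]: for [i <= n] the factor [w (2n - i)] is at most [w n].
    For [i > n] the factor [d i] is [O(1/n)], and [half_sum_w] bounds the remaining sum of [w], in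
    total by [rho / s n]. *)
Lemma half_w_lower (n : nat) : 1 - rho / s n <= w n * s n.
Proof.
  pose proof rho_pos as Hr; pose proof (half_s_ge_1 n) as Hs.
  assert (E := f_equal (fun f : fps => f (n + n)%nat) half_w_d); cbv beta in E.
  rewrite pw_m1, fmul_comm in E; unfold fmul in E.
  replace (S (n + n)) with (S n + n)%nat in E by lia. rewrite sumR_add in E.
  assert (H1 : sumR (S n) (fun i => d i * w (n + n - i)%nat) <= w n * s n).
  { rewrite half_s_sum, <- sumR_scal; apply sumR_le; intros i Hi.
    rewrite (Rmult_comm (w n)).
    apply Rmult_le_compat_l; [left; apply half_d_pos|apply half_w_mono; lia]. }
  assert (H2 : sumR n (fun i => d (S n + i)%nat * w (n + n - (S n + i))%nat)
               <= rho / 2 * / INR (S n) * sumR (S n) w).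
  { apply Rle_trans with (rho / 2 * / INR (S n) * sumR n w).
    - rewrite (sumR_rev n w), <- sumR_scal; apply sumR_le; intros i Hi.
      replace (n + n - (S n + i))%nat with (n - 1 - i)%nat by lia.
      apply Rmult_le_compat_r; [apply half_w_nonneg|].
      eapply Rle_trans; [apply half_d_le|]. apply Rmult_le_compat_l; [lra|].
      apply Rinv_le_contravar; [apply INR_gt0; lia|apply le_INR; lia].
    - apply Rmult_le_compat_l.
      + apply Rmult_le_pos; [lra|]; left; apply Rinv_0_lt_compat, INR_gt0; lia.
      + simpl sumR; pose proof (half_w_nonneg n); lra. }
  assert (H3 : rho / 2 * / INR (S n) * sumR (S n) w <= rho / s n).
  { pose proof (half_sum_w n) as Hw. pose proof (INR_gt0 (S n) ltac:(lia)) as Hn.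
    apply (Rmult_le_reg_r (s n * INR (S n))); [apply Rmult_lt_0_compat; lra|].
    replace (rho / 2 * / INR (S n) * sumR (S n) w * (s n * INR (S n)))
      with (rho / 2 * (s n * sumR (S n) w)) by (field; lra).
    replace (rho / s n * (s n * INR (S n))) with (rho / 2 * (2 * INR (S n))) by (field; lra).
    apply Rmult_le_compat_l; [lra|]. rewrite S_INR; lra. }
  lra.
Qed.

Lemma fbounded_half_w : fbounded w.
Proof.
  exists 1; intros n; rewrite Rabs_pos_eq by apply half_w_nonneg.
  rewrite <- half_w0; apply half_w_mono; lia.
Qed.

(** Beyond [n] the steps of [w] are at most [rho/2/(n+1)], so its geometric average is [rho * w n]
    up to [O(1/n)]. *)
Lemma half_tail_w (n : nat) :
  rho * w n - (rho + rho * rho) * (rho / 2 * / INR (S n)) <= tail z w n <= rho * w n.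
Proof.
  pose proof rho_pos as Hr; pose proof half_sing as Hz; pose proof fbounded_half_w as Hb.
  set (K := rho / 2 * / INR (S n)).
  assert (HK : forall j, w (n + j)%nat - w (S (n + j)) <= K).
  { intros j; destruct (half_w_step (n + j)) as [_ H]; eapply Rle_trans; [exact H|].
    eapply Rle_trans; [apply half_d_le|]. apply Rmult_le_compat_l; [lra|].
    apply Rinv_le_contravar; [apply INR_gt0; lia|apply le_INR; lia]. }
  pose proof (tail_rec z Hz w n Hb) as E.
  assert (Hd : tail z w n - tail z w (S n) = tail z (fun k => w k + -1 * w (S k)) n).
  { rewrite (tail_plus z Hz), (tail_scal z), tail_shift; [ring|exact Hb|].
    apply fbounded_scal, fbounded_shift, Hb. }
  assert (Hd2 : 0 * (z / (1 - z)) <= tail z (fun k => w k + -1 * w (S k)) n <= K * (z / (1 - z))).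
  { apply (tail_ext_bounds z Hz).
    - apply fbounded_plus; [exact Hb|]. apply fbounded_scal, fbounded_shift, Hb.
    - intros j; pose proof (HK (S j)); pose proof (half_w_step (n + S j)); lra. }
  rewrite <- Hd in Hd2; fold rho in Hd2.
  assert (E2 : tail z w n = rho * w (S n) - rho * (tail z w n - tail z w (S n))).
  { unfold rho; apply (Rmult_eq_reg_r (1 - z)); [|lra].
    replace ((z / (1 - z) * w (S n) - z / (1 - z) * (tail z w n - tail z w (S n))) * (1 - z))
      with (z * w (S n) - z * (tail z w n - tail z w (S n))) by (field; lra). lra. }
  pose proof (HK 0%nat) as HK0; rewrite Nat.add_0_r in HK0.
  pose proof (half_w_step n) as [Hst _].
  assert (rho * (w n - w (S n)) <= rho * K) by (apply Rmult_le_compat_l; lra).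
  assert (0 <= rho * (w n - w (S n))) by (apply Rmult_le_pos; lra).
  assert (rho * (tail z w n - tail z w (S n)) <= rho * (K * rho))
    by (apply Rmult_le_compat_l; lra).
  assert (0 <= rho * (tail z w n - tail z w (S n))) by (apply Rmult_le_pos; lra).
  lra.
Qed.

(** Absorbs errors [O(1/n)] into [O(1/log^2 n)]. *)
Lemma ln_sqr_le (x : R) : 1 <= x -> ln x ^ 2 <= 4 * x.
Proof.
  intros Hx; assert (Hs : 0 < sqrt x) by (apply sqrt_lt_R0; lra).
  assert (Hl : 0 <= ln x) by (rewrite <- ln_1; apply ln_le; lra).
  assert (H : ln x <= 2 * sqrt x).
  { rewrite <- (sqrt_sqrt x) at 1 by lra. rewrite ln_mult by assumption.
    pose proof (exp_ineq1_le (ln (sqrt x))) as H; rewrite exp_ln in H by exact Hs; lra. }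
  apply Rle_trans with ((2 * sqrt x) ^ 2).
  - apply pow_incr; lra.
  - replace ((2 * sqrt x) ^ 2) with (4 * (sqrt x * sqrt x)) by ring.
    rewrite sqrt_sqrt by lra; lra.
Qed.

Lemma half_tail_asymp : exists C L, 1 <= L /\ forall n, L <= ln (INR (S n)) ->
  Rabs (tail z w n - 2 / ln (INR (S n))) <= C * / ln (INR (S n)) ^ 2.
Proof.
  pose proof rho_pos as Hr.
  (* For [l >= 5] the lower bound [rho (l/2 - 1)] of [s n] is at least [3/10 rho l]. The first
     summand of the constant comes from [1/n <= 4/l^2]. The rest is [19 = 12 + 7]: 12 exceeds
     [100/9], from [rho^2/q^2], and 7 exceeds [20/3], from [|rho/q - 2/l| <= 2 rho/(q l)], where
     [q = s n]. *)
  exists ((rho + rho * rho) * (rho / 2) * 4 + 19), 5.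
  split; [lra|]; intros n HL; set (l := ln (INR (S n))) in *.
  pose proof (half_s_ln n) as [Hs1 Hs2]; fold l in Hs1, Hs2.
  assert (Hn : 0 < INR (S n)) by (apply INR_gt0; lia).
  assert (Hn1 : 1 <= INR (S n)) by (apply (le_INR 1); lia).
  pose proof (half_s_ge_1 n) as Hs.
  pose proof (half_tail_w n) as [Ht1 Ht2]; rewrite <- Rmult_assoc in Ht1.
  pose proof (half_w_upper n) as Hw1; pose proof (half_w_lower n) as Hw2.
  set (A := (rho + rho * rho) * (rho / 2)) in *.
  assert (HA : 0 <= A) by (unfold A; assert (0 < rho * rho) by (apply Rmult_lt_0_compat; lra);
                           apply Rmult_le_pos; lra).
  clearbody rho A; revert Ht1 Ht2 Hw1 Hw2 Hs1 Hs2 Hs.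
  generalize (tail z w n) (w n) (s n); intros t v q Ht1 Ht2 Hw1 Hw2 Hs1 Hs2 Hs.
  assert (Hrl : rho * 5 <= rho * l) by (apply Rmult_le_compat_l; lra).
  assert (Hql : 3 / 10 * (rho * l) <= q) by lra.
  assert (Hl2 : 0 < l ^ 2) by (apply pow_lt; lra).
  assert (Hln : / INR (S n) <= 4 * / l ^ 2).
  { pose proof (ln_sqr_le (INR (S n)) Hn1) as H; fold l in H.
    apply (Rmult_le_reg_r (INR (S n) * l ^ 2)); [apply Rmult_lt_0_compat; lra|].
    replace (/ INR (S n) * (INR (S n) * l ^ 2)) with (l ^ 2) by (field; lra).
    replace (4 * / l ^ 2 * (INR (S n) * l ^ 2)) with (4 * INR (S n)) by (field; lra). exact H. }
  assert (HAn : A * / INR (S n) <= 4 * A * / l ^ 2)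
    by (apply (Rmult_le_compat_l A) in Hln; lra).
  assert (Hvq : v <= / q).
  { apply (Rmult_le_reg_r q); [lra|]. rewrite Rinv_l; lra. }
  assert (Hvq2 : / q - rho * / q ^ 2 <= v).
  { apply (Rmult_le_reg_r q); [lra|].
    replace ((/ q - rho * / q ^ 2) * q) with (1 - rho / q) by (field; lra). exact Hw2. }
  assert (Hq2 : rho * (rho * / q ^ 2) <= 12 * / l ^ 2).
  { apply (Rmult_le_reg_r (q ^ 2 * l ^ 2)).
    - apply Rmult_lt_0_compat; [apply pow_lt|]; lra.
    - replace (rho * (rho * / q ^ 2) * (q ^ 2 * l ^ 2)) with ((rho * l) ^ 2) by (field; lra).
      replace (12 * / l ^ 2 * (q ^ 2 * l ^ 2)) with (12 * q ^ 2) by (field; lra).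
      assert ((3 / 10 * (rho * l)) ^ 2 <= q ^ 2) by (apply pow_incr; lra).
      pose proof (pow2_ge_0 (rho * l)).
      replace ((3 / 10 * (rho * l)) ^ 2) with (9 / 100 * (rho * l) ^ 2) in H by field. lra. }
  assert (Hql2 : Rabs (rho * / q - 2 / l) <= 7 * / l ^ 2).
  { replace (rho * / q - 2 / l) with ((rho * l - 2 * q) / (q * l)) by (field; lra).
    assert (Hql0 : 0 < q * l) by (apply Rmult_lt_0_compat; lra).
    unfold Rdiv; rewrite Rabs_mult, (Rabs_pos_eq (/ _)) by (left; apply Rinv_0_lt_compat; exact Hql0).
    assert (H1 : Rabs (rho * l - 2 * q) <= 2 * rho) by (apply Rabs_le; lra).
    apply (Rmult_le_reg_r (q * l * l)); [apply Rmult_lt_0_compat; lra|].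
    replace (Rabs (rho * l - 2 * q) * / (q * l) * (q * l * l))
      with (Rabs (rho * l - 2 * q) * l) by (field; lra).
    replace (7 * / l ^ 2 * (q * l * l)) with (7 * q) by (field; lra).
    apply Rle_trans with (2 * rho * l); [apply Rmult_le_compat_r; lra|]. lra. }
  apply Rabs_le_between in Hql2.
  apply (Rmult_le_compat_l rho) in Hvq; [|lra].
  apply (Rmult_le_compat_l rho) in Hvq2; [|lra].
  assert (0 < / l ^ 2) by (apply Rinv_0_lt_compat; exact Hl2).
  assert (0 <= A * / INR (S n))
    by (apply Rmult_le_pos; [exact HA|left; apply Rinv_0_lt_compat; exact Hn]).
  rewrite Rmult_minus_distr_l in Hvq2.
  assert (0 <= A * / l ^ 2) by (apply Rmult_le_pos; lra).
  apply Rabs_le; lra.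
Qed.

Lemma EP_asymp_half :
  exists C : R, exists N : nat, forall n : nat, (N <= n)%nat ->
    Rabs (EP (1/2) n - alpha (1/2) ^ n / (1 - 1/2) - (- 2 / ln (INR n)))
    <= C * / (ln (INR n)) ^ 2.
Proof.
  pose proof half_sing as Hz.
  destruct half_tail_asymp as [C [L [HL HC]]].
  destruct (INR_unbounded (exp L)) as [N HN].
  exists C, (S N); intros n Hn.
  destruct n as [|n]; [lia|].
  assert (Hln : L <= ln (INR (S n))).
  { rewrite <- (ln_exp L); apply ln_le; [apply exp_pos|].
    apply Rlt_le, (Rlt_le_trans _ _ _ HN), le_INR; lia. }
  rewrite (EP_gf _ _ half_log_0 half_log_ode). simpl pred.
  change half_log with h.
  rewrite (pole_expansion z Hz h half_log_0 half_log_pos half_log_log_convex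
            fbounded_half_log PSeries_half_log);
    [|apply fbounded_pw; lra|exact fbounded_half_w].
  (* The pole constant is [(1/(1-z)) / (z/(2(1-z))) = 2/z], which matches [1/(1-p) = 2] and the
     shift from [n] to [n - 1]. *)
  fold u; fold w. rewrite PSeries_fder_half_log, PSeries_pw by lra.
  replace (Rpower (1 - z) (-1)) with (/ (1 - z))
    by (replace (-1) with (- (1)) by ring; rewrite Rpower_Ropp, Rpower_1 by lra; reflexivity).
  replace (alpha (1/2)) with (/ z)
    by (unfold alpha; destruct (Req_EM_T (1/2) (1/2)) as [_|E]; [reflexivity|lra]).
  specialize (HC n Hln).
  match goal with |- Rabs ?X <= _ =>
    replace X with (- (tail z w n - 2 / ln (INR (S n)))) end.
  - rewrite Rabs_Ropp; exact HC.
  - simpl pow; field; repeat split; lra.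
Qed.
End Half.

Theorem theorem3 (p : R) (hp0 : 0 < p) (hp1 : p < 1) :
  (p <> 1/2 -> forall n : nat, (1 <= n)%nat -> EP p n = EP_formula_ne p n) /\
  (p = 1/2 -> forall n : nat, (1 <= n)%nat -> EP p n = EP_formula_half n) /\
  (p < 1/2 ->
     exists C : R, exists N : nat, forall n : nat, (N <= n)%nat ->
       Rabs (EP p n - alpha p ^ n / (1 - p)
             - (- (1 - 2 * p) / (p * Gamma (2 * p)) * Rpower (INR n) (2 * p - 1)))
       <= C * Rpower (INR n) (2 * (2 * p - 1))) /\
  (p = 1/2 ->
     exists C : R, exists N : nat, forall n : nat, (N <= n)%nat ->
       Rabs (EP p n - alpha p ^ n / (1 - p) - (- 2 / ln (INR n)))
       <= C * / (ln (INR n)) ^ 2) /\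
  (1/2 < p ->
     exists C : R, exists N : nat, forall n : nat, (N <= n)%nat ->
       Rabs (EP p n - alpha p ^ n / (1 - p) - (- (2 * p - 1) / (1 - p)))
       <= C * Rpower (INR n) (1 - 2 * p)).
Proof.
  split; [intros Hp n; apply EP_exact_ne, Hp|].
  split; [intros -> n; apply EP_exact_half|].
  split; [intros Hp; exact (EP_asymp_small p hp0 Hp)|].
  split; [intros ->; exact EP_asymp_half|].
  intros Hp; exact (EP_asymp_large p Hp hp1).
Qed.
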